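(* Let $n\in\mathbb{N}$, let $\Delta_n$ be the simplex with vertex set $[n]=\{1,\dots,n\}$, and let $\Delta=\mathrm{sd}(\partial\Delta_n)$ be the barycentric subdivision of the boundary of $\Delta_n$; its vertices are the nonempty proper subsets of $[n]$ and its simplices are the (possibly empty) chains of such subsets with respect to inclusion. Let $\boldsymbol y=(y_I)$ be variables indexed by these vertices and let $\phi:\mathbb{Z}[\![\boldsymbol y]\!]\to\mathbb{Z}[\![\boldsymbol x,X]\!]$ be given by $y_I\mapsto x_0X\prod_{i\in I}x_i$. Then $$R^{\mathrm{pr}}_{n,p}(\boldsymbol x,X)\big|_{p\to1}=\phi\big(\mathrm{Hilb}(\mathbb{Z}[\Delta];\boldsymbol y)\big)=\sum_{\sigma\in\Delta}\prod_{J\in\sigma}\frac{\phi(y_J)}{1-\phi(y_J)}.$$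
   Context: Satake generating function. For a prime $p$ let $J_0=\begin{pmatrix}0&I_n\\-I_n&0\end{pmatrix}$; for a ring $K$, $\mathrm{GSp}_{2n}(K)=\{A\in\mathrm{GL}_{2n}(K):AJ_0A^{\mathrm t}=\mu(A)J_0,\ \mu(A)\in K^\times\}$; $\Gamma_n=\mathrm{GSp}_{2n}(\mathbb{Z}_p)$; $G_n^+=\mathrm{GSp}_{2n}(\mathbb{Q}_p)\cap\mathrm{Mat}_{2n}(\mathbb{Z}_p)$. For $m\in\mathbb{N}$ let $D_n^{\mathsf C}(m)=\{A\in G_n^+:AJ_0A^{\mathrm t}=mJ_0\}$ and let $T_n^{\mathsf C}(m)$ be the sum of the distinct double cosets $\Gamma_ng\Gamma_n$, $g\in D_n^{\mathsf C}(m)$, in the spherical Hecke algebra of $(G_n^+,\Gamma_n)$. $\Omega$ is the Satake isomorphism into $\mathbb{C}[x_0^{\pm1},\dots,x_n^{\pm1}]$ in Andrianov's normalization: if $\Gamma_ng\Gamma_n=\bigsqcup_i\Gamma_nM_i$ with $M_i=\begin{pmatrix}p^{\delta_i}(D_i^{\mathrm t})^{-1}&B_i\\0&D_i\end{pmatrix}$, $D_i$ upper triangular with diagonal $(p^{d_{i1}},\dots,p^{d_{in}})$, then $\Omega(\Gamma_ng\Gamma_n)=\sum_ix_0^{\delta_i}\prod_{j=1}^n(p^{-j}x_j)^{d_{ij}}$. With $\boldsymbol x=(x_0,\dots,x_n)$, $$R_{n,p}(\boldsymbol x,X)=\sum_{\alpha\ge0}\Omega(T_n^{\mathsf C}(p^\alpha))X^\alpha,\qquad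 R^{\mathrm{pr}}_{n,p}(\boldsymbol x,X)=(1-x_0X)(1-x_0x_1\cdots x_nX)R_{n,p}(\boldsymbol x,X).$$ As $p$ varies over the primes, $R^{\mathrm{pr}}_{n,p}(\boldsymbol x,X)$ is given by a single rational function in $p,\boldsymbol x,X$; the notation $|_{p\to1}$ means substituting $p=1$ in this rational function. Stanley–Reisner ring. For a simplicial complex $\Delta\subseteq2^V$ on a finite set $V$ and a ring $K$, $K[\Delta]=K[X_v\mid v\in V]/(\prod_{v\in\sigma}X_v\mid\sigma\in2^V\setminus\Delta)$. $\mathrm{Hilb}(\mathbb{Z}[\Delta];\boldsymbol y)$ is its fine ($\mathbb{N}_0^V$-graded) Hilbert series, with variable $y_v$ recording the degree in $X_v$. *)

(* Defs.v *)
From HB Require Import structures.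
From mathcomp Require Import all_boot all_order all_algebra.
From mathcomp Require Import mpoly.
From mathcomp Require Import boolp classical_sets cardinality fsbigop reals.
From mathcomp Require Import complex.

Set Implicit Arguments.
Unset Strict Implicit.
Unset Printing Implicit Defensive.

Import Order.TTheory GRing.Theory Num.Theory.

Local Open Scope ring_scope.

(* Inverses chosen classically: they turn any commutative ring into a
   [comUnitRingType]. *)
Section ClassicalInverse.
Variable A : comNzRingType.

Definition cl_unit : {pred A} := fun x => `[< exists y, y * x = 1 >].
Definition cl_inv (x : A) : A := xget x [set y | y * x = 1]%classic.

Lemma cl_mulVx : {in cl_unit, left_inverse 1 cl_inv *%R}.
Proof.
move=> x /asboolP [y yx1]; rewrite /cl_inv.
by case: xgetP => [z _ //|/(_ y)].
Qed.

Lemma cl_unitPl x y : y * x = 1 -> cl_unit x.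
Proof. by move=> yx1; apply/asboolP; exists y. Qed.

Lemma cl_inv_out : {in [predC cl_unit], cl_inv =1 id}.
Proof.
move=> x; rewrite inE => /asboolPn nx; rewrite /cl_inv.
by case: xgetP => // z _ zx1; case: nx; exists z.
Qed.

End ClassicalInverse.

(* Z_p as the inverse limit of the rings Z/p^k: the k-th component of an
   element is its canonical residue in {0, ..., p^k - 1}. *)
Section PadicIntegers.
Variables (p : nat) (p_pr : prime p).

Record padic_seq := PadicInt {
  pres : nat -> int;
  presP : forall k, (pres k.+1 %% (p ^ k)%:Z)%Z = pres k
}.

(* The ring structure is attached to the pair of p and a proof that it is
   prime. *)
Definition padic_int of prime p := padic_seq.
Local Notation Zp := (padic_int p_pr).

HB.instance Definition _ := gen_eqMixin Zp.
HB.instance Definition _ := gen_choiceMixin Zp.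

Implicit Types x y z : Zp.

Lemma padic_ext x y : pres x =1 pres y -> x = y.
Proof.
case: x => f fP; case: y => g gP /= /funext fg; rewrite {}fg in fP *.
by congr PadicInt; apply: Prop_irrelevance.
Qed.

Lemma pres_mod x k : (pres x k %% (p ^ k)%:Z)%Z = pres x k.
Proof. by rewrite -[in LHS]presP modz_mod presP. Qed.

Lemma modz_pexp (a : int) k :
  ((a %% (p ^ k.+1)%:Z)%Z %% (p ^ k)%:Z)%Z = (a %% (p ^ k)%:Z)%Z.
Proof.
apply/eqP; rewrite eqz_mod_dvd.
apply: (@dvdz_trans (p ^ k.+1)%:Z); first by rewrite dvdzE /= dvdn_exp2l.
by rewrite -eqz_mod_dvd modz_mod.
Qed.

Fact padic_of_int_subproof (a : nat -> int) :
    (forall k, (a k.+1 = a k %[mod (p ^ k)%:Z])%Z) ->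
  forall k, ((a k.+1 %% (p ^ k.+1)%:Z)%Z %% (p ^ k)%:Z)%Z
            = (a k %% (p ^ k)%:Z)%Z.
Proof. by move=> aP k; rewrite modz_pexp aP. Qed.

Definition padic_of (a : nat -> int)
    (aP : forall k, (a k.+1 = a k %[mod (p ^ k)%:Z])%Z) : Zp :=
  @PadicInt (fun k => (a k %% (p ^ k)%:Z)%Z) (padic_of_int_subproof aP).

Fact padic_cst_subproof (c : int) k : (c = c %[mod (p ^ k)%:Z])%Z.
Proof. by []. Qed.

Fact padic_add_subproof x y k :
  (pres x k.+1 + pres y k.+1 = pres x k + pres y k %[mod (p ^ k)%:Z])%Z.
Proof. by rewrite -modzDm !presP. Qed.

Fact padic_opp_subproof x k :
  (- pres x k.+1 = - pres x k %[mod (p ^ k)%:Z])%Z.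
Proof. by rewrite -modzNm presP. Qed.

Fact padic_mul_subproof x y k :
  (pres x k.+1 * pres y k.+1 = pres x k * pres y k %[mod (p ^ k)%:Z])%Z.
Proof. by rewrite -modzMm !presP. Qed.

Definition padic_zero := padic_of (padic_cst_subproof 0).
Definition padic_one := padic_of (padic_cst_subproof 1).
Definition padic_add x y := padic_of (padic_add_subproof x y).
Definition padic_opp x := padic_of (padic_opp_subproof x).
Definition padic_mul x y := padic_of (padic_mul_subproof x y).

Lemma padic_addA : associative padic_add.
Proof.
by move=> x y z; apply: padic_ext => k /=; rewrite modzDmr modzDml addrA.
Qed.

Lemma padic_addC : commutative padic_add.
Proof. by move=> x y; apply: padic_ext => k /=; rewrite addrC. Qed.

Lemma padic_add0 : left_id padic_zero padic_add.
Proof.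
by move=> x; apply: padic_ext => k /=; rewrite modzDml add0r pres_mod.
Qed.

Lemma padic_addN : left_inverse padic_zero padic_opp padic_add.
Proof. by move=> x; apply: padic_ext => k /=; rewrite modzDml addNr. Qed.

Lemma padic_mulA : associative padic_mul.
Proof.
by move=> x y z; apply: padic_ext => k /=; rewrite modzMmr modzMml mulrA.
Qed.

Lemma padic_mulC : commutative padic_mul.
Proof. by move=> x y; apply: padic_ext => k /=; rewrite mulrC. Qed.

Lemma padic_mul1 : left_id padic_one padic_mul.
Proof.
by move=> x; apply: padic_ext => k /=; rewrite modzMml mul1r pres_mod.
Qed.

Lemma padic_mulDl : left_distributive padic_mul padic_add.
Proof.
by move=> x y z; apply: padic_ext => k /=; rewrite modzMml modzDm mulrDl.
Qed.

Lemma padic_one_neq0 : padic_one != padic_zero.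
Proof.
apply/eqP => /(congr1 (fun x => pres x 1)) /=.
by rewrite expn1 mod0z modz_small // ltz_nat prime_gt1.
Qed.

HB.instance Definition _ := GRing.isZmodule.Build Zp
  padic_addA padic_addC padic_add0 padic_addN.
HB.instance Definition _ := GRing.Zmodule_isComNzRing.Build Zp
  padic_mulA padic_mulC padic_mul1 padic_mulDl padic_one_neq0.
HB.instance Definition _ := GRing.ComNzRing_hasMulInverse.Build Zp
  (@cl_mulVx Zp) (@cl_unitPl Zp) (@cl_inv_out Zp).

Lemma pres_le x j k : (j <= k)%N ->
  (pres x k %% (p ^ j)%:Z)%Z = pres x j.
Proof.
move=> /subnK <-; elim: (k - j)%N => [|m IHm]; first exact: pres_mod.
rewrite -{}IHm addSn -(presP x (m + j)).
apply/eqP; rewrite eq_sym eqz_mod_dvd.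
apply: (@dvdz_trans (p ^ (m + j))%:Z).
  by rewrite dvdzE /= dvdn_exp2l // leq_addl.
by rewrite -eqz_mod_dvd modz_mod.
Qed.

Lemma padic_neq0 x : x != 0 -> exists k, pres x k != 0.
Proof.
move=> /eqP x0; apply/not_existsP => xk0; apply: x0; apply: padic_ext => k.
by rewrite /= mod0z; apply/eqP/negPn/negP/xk0.
Qed.

Lemma padic_integral x y : x * y = 0 -> (x == 0) || (y == 0).
Proof.
move=> xy0; apply/norP => -[/padic_neq0 [i xi] /padic_neq0 [j yj]].
have := congr1 (fun z => pres z (i + j)) xy0.
rewrite /= mod0z => /dvdz_mod0P.
rewrite dvdzE abszM /= => dvd.
have Px : ~~ (p ^ i %| `|pres x (i + j)|)%N.
  apply: contra xi => d.
  by rewrite -(pres_le x (leq_addr j i)); apply/eqP/dvdz_mod0P; rewrite dvdzE.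
have Py : ~~ (p ^ j %| `|pres y (i + j)|)%N.
  apply: contra yj => d.
  by rewrite -(pres_le y (leq_addl i j)); apply/eqP/dvdz_mod0P; rewrite dvdzE.
have gt0 m k : ~~ (p ^ m %| k)%N -> (0 < k)%N by case: k; rewrite ?dvdn0.
move: Px Py dvd (gt0 _ _ Px) (gt0 _ _ Py).
move: `|pres x _|%N `|pres y _|%N => a b Pa Pb + a0 b0.
rewrite !pfactor_dvdn ?muln_gt0 ?a0 // lognM //.
move: Pa Pb; rewrite !pfactor_dvdn // -!ltnNge => la lb; apply/negP.
by rewrite -ltnNge -addnS; apply: leq_add => //; apply: ltnW.
Qed.

HB.instance Definition _ :=
  GRing.ComUnitRing_isIntegral.Build Zp padic_integral.

Definition padic_rat : fieldType := {fraction Zp}.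

End PadicIntegers.

Arguments padic_int {p} p_pr.
Arguments padic_rat {p} p_pr.

(* Formal power series in [n] variables: arbitrary families of coefficients
   indexed by the monomials of {mpoly K[n]}. *)
Section PowerSeries.
Variables (K : comNzRingType) (n : nat).

Record fps := FPS { fcoef : 'X_{1..n} -> K }.

HB.instance Definition _ := gen_eqMixin fps.
HB.instance Definition _ := gen_choiceMixin fps.

Implicit Types f g h : fps.
Implicit Types m : 'X_{1..n}.

Lemma fps_ext f g : fcoef f =1 fcoef g -> f = g.
Proof. by case: f => f; case: g => g /= /funext ->. Qed.

Definition fps_of_mpoly (P : {mpoly K[n]}) : fps := FPS (fun m => P@_m).

Definition fps_add f g := FPS (fun m => fcoef f m + fcoef g m).
Definition fps_opp f := FPS (fun m => - fcoef f m).
Definition fps_mul f g := FPS (fun m =>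
  \sum_(k : 'X_{1..n < (mdeg m).+1, (mdeg m).+1} | m == (k.1 + k.2)%MM)
    fcoef f k.1 * fcoef g k.2).

Definition fps_trunc b f : {mpoly K[n]} :=
  \sum_(m : 'X_{1..n < b}) fcoef f m *: 'X_[m].

Lemma fps_truncE b f m : (mdeg m < b)%N -> (fps_trunc b f)@_m = fcoef f m.
Proof. by move=> lt_mb; rewrite mcoeff_mpoly. Qed.

Lemma mcoeffM_agree b (P P' Q Q' : {mpoly K[n]}) m :
    (forall k, (mdeg k < b)%N -> P@_k = P'@_k) ->
    (forall k, (mdeg k < b)%N -> Q@_k = Q'@_k) ->
  (mdeg m < b)%N -> (P * Q)@_m = (P' * Q')@_m.
Proof.
move=> eP eQ lt_mb; rewrite !mcoeffM; apply: eq_bigr => -[k1 k2] _ /=.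
by rewrite eP ?eQ //; apply: leq_trans lt_mb; apply: bmdeg.
Qed.

Lemma fps_mulE b f g m : (mdeg m < b)%N ->
  fcoef (fps_mul f g) m = (fps_trunc b f * fps_trunc b g)@_m.
Proof.
move=> lt_mb; rewrite mcoeffM /=; apply: eq_bigr => -[k1 k2] _ /=.
by rewrite !fps_truncE //; apply: leq_trans lt_mb; apply: bmdeg.
Qed.

Lemma fps_addA : associative fps_add.
Proof. by move=> f g h; apply: fps_ext => m /=; rewrite addrA. Qed.

Lemma fps_addC : commutative fps_add.
Proof. by move=> f g; apply: fps_ext => m /=; rewrite addrC. Qed.

Lemma fps_add0 : left_id (fps_of_mpoly 0) fps_add.
Proof. by move=> f; apply: fps_ext => m /=; rewrite mcoeff0 add0r. Qed.

Lemma fps_addN : left_inverse (fps_of_mpoly 0) fps_opp fps_add.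
Proof. by move=> f; apply: fps_ext => m /=; rewrite mcoeff0 addNr. Qed.

Lemma fps_mulA : associative fps_mul.
Proof.
move=> f g h; apply: fps_ext => m; set b := (mdeg m).+1.
have lt_mb : (mdeg m < b)%N by [].
have E u v k : (mdeg k < b)%N ->
    (fps_trunc b (fps_mul u v))@_k = (fps_trunc b u * fps_trunc b v)@_k.
  by move=> lt_kb; rewrite fps_truncE // (fps_mulE _ _ lt_kb).
rewrite !(fps_mulE _ _ lt_mb).
transitivity ((fps_trunc b f * (fps_trunc b g * fps_trunc b h))@_m).
  by apply: (mcoeffM_agree (b := b)) => // k; apply: E.
by rewrite mulrA; apply/esym/(mcoeffM_agree (b := b)) => // k; apply: E.
Qed.

Lemma fps_mulC : commutative fps_mul.
Proof.
move=> f g; apply: fps_ext => m; have lt_mb := ltnSn (mdeg m).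
by rewrite !(fps_mulE _ _ lt_mb) mulrC.
Qed.

Lemma fps_mul1 : left_id (fps_of_mpoly 1) fps_mul.
Proof.
move=> f; apply: fps_ext => m; have lt_mb := ltnSn (mdeg m).
rewrite (fps_mulE _ _ lt_mb) -(fps_truncE f lt_mb) -[fps_trunc _ f in RHS]mul1r.
by apply: (mcoeffM_agree (b := (mdeg m).+1)) => // k lt_kb; rewrite fps_truncE.
Qed.

Lemma fps_mulDl : left_distributive fps_mul fps_add.
Proof.
move=> f g h; apply: fps_ext => m /=; rewrite -big_split /=.
by apply: eq_bigr => k _; rewrite mulrDl.
Qed.

Lemma fps_one_neq0 : fps_of_mpoly 1 != fps_of_mpoly 0.
Proof.
apply/eqP => /(congr1 (fun f => fcoef f 0%MM)) /= /eqP.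
by rewrite mcoeff1 mcoeff0 eqxx oner_eq0.
Qed.

HB.instance Definition _ := GRing.isZmodule.Build fps
  fps_addA fps_addC fps_add0 fps_addN.
HB.instance Definition _ := GRing.Zmodule_isComNzRing.Build fps
  fps_mulA fps_mulC fps_mul1 fps_mulDl fps_one_neq0.
HB.instance Definition _ := GRing.ComNzRing_hasMulInverse.Build fps
  (@cl_mulVx fps) (@cl_unitPl fps) (@cl_inv_out fps).

Definition fps_var (i : 'I_n) : fps := fps_of_mpoly 'X_i.

End PowerSeries.

Definition fps_map (K L : comNzRingType) (u : K -> L) (n : nat)
  (f : fps K n) : fps L n := FPS (fun m => u (fcoef f m)).

(* f(g_1, ..., g_k), the sum over all monomials a of f_a g^a; each coefficient
   is a finite sum as soon as the g_i have no constant term. *)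
Definition fps_subst (K : comNzRingType) (k n : nat) (g : 'I_k -> fps K n)
    (f : fps K k) : fps K n :=
  FPS (fun m => \sum_(a \in [set: 'X_{1..k}]%classic)
                   fcoef f a * fcoef (\prod_(i < k) g i ^+ a i) m).

Section StanleyReisner.

Record scomplex (V : finType) := SComplex {
  faces :> {set {set V}};
  faces0 : finset.set0 \in faces;
  facesS : forall s t : {set V}, s \subset t -> t \in faces -> s \in faces
}.

Variables (K : comNzRingType) (V : finType) (D : scomplex V).

(* The variable X_v is the one with index [enum_rank v]. *)
Definition SR_ideal (f : {mpoly K[#|V|]}) : bool :=
  `[< exists g : {set V} -> {mpoly K[#|V|]},
        f = \sum_(s : {set V} | s \notin faces D)
               g s * \prod_(v in s) 'X_(enum_rank v) >].

Lemma SR_idealr_closed : idealr_closed SR_ideal.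
Proof.
split.
- apply/asboolP; exists (fun=> 0); rewrite big1 // => s _; exact: mul0r.
- apply/asboolP => -[g /(congr1 (meval (fun=> 0))) /eqP].
  rewrite rmorph1 rmorph_sum big1 ?oner_eq0 // => s sD.
  have [v vs] : exists v, v \in s.
    by apply/set0Pn; apply: contraNneq sD => ->; apply: faces0.
  by rewrite /= mevalM rmorph_prod /= (bigD1 v) //= mevalXU mul0r mulr0.
- move=> a f f' /asboolP [g ->] /asboolP [g' ->]; apply/asboolP.
  exists (fun s => a * g s + g' s); rewrite mulr_sumr -big_split /=.
  by apply: eq_bigr => s _; rewrite mulrDl mulrA.
Qed.

HB.instance Definition _ :=
  isIdealr.Build {mpoly K[#|V|]} SR_ideal SR_idealr_closed.

Definition SR_ring : comNzRingType := {ideal_quot (SR_ideal : idealr _)}.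

Definition SR_graded (a : 'X_{1..#|V|}) : set SR_ring :=
  [set (\pi_SR_ring (c *: 'X_[a]))%qT | c in [set: K]]%classic.

End StanleyReisner.

(* The rank over Z of the subgroup S of M: the greatest size of a Z-linearly
   independent family in S. *)
Definition Zfree (M : zmodType) (S : set M) (k : nat) : Prop :=
  exists2 v : 'I_k -> M, (forall i, S (v i)) &
    forall c : 'I_k -> int, \sum_i v i *~ c i = 0 -> forall i, c i = 0.

Definition Zrank (M : zmodType) (S : set M) : nat :=
  xget 0%N [set k | Zfree S k /\ forall l, Zfree S l -> (l <= k)%N]%classic.

Definition SR_hilb (V : finType) (D : scomplex V) : fps int #|V| :=
  FPS (fun a => (Zrank (@SR_graded int V D a))%:Z).

Section Subdivision.
Variables (V : finType) (D : {set {set V}}).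

Definition sd_vertex : finType :=
  {I : {set V} | (I \in D) && (I != finset.set0)}.

Definition sd_faces : {set {set sd_vertex}} :=
  [set s : {set sd_vertex} | [forall I in s, forall J in s,
     (val I \subset val J) || (val J \subset val I)]].

Fact sd_faces0 : finset.set0 \in sd_faces.
Proof. by rewrite inE; apply/forall_inP => I; rewrite inE. Qed.

Fact sd_facesS (s t : {set sd_vertex}) :
  s \subset t -> t \in sd_faces -> s \in sd_faces.
Proof.
move=> /fintype.subsetP st; rewrite !inE => /forall_inP tP.
apply/forall_inP => I /st It; apply/forall_inP => J /st Jt.
by have /forall_inP := tP I It; apply.
Qed.

Definition sd : scomplex sd_vertex := SComplex sd_faces0 sd_facesS.

End Subdivision.

(* The boundary of the simplex on ['I_n]: all proper subsets. The vertex [i] in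
   {1, ..., n} is represented by the ordinal of value [i - 1]. *)
Definition bd_simplex (n : nat) : {set {set 'I_n}} :=
  [set I | I != [set: 'I_n]].

(* The [n.+2] variables of the series in x_0, ..., x_n, X: first the x_i, then
   X. *)
Section Variables.
Variables (K : comNzRingType) (n : nat).

Definition x_idx (i : 'I_n.+1) : 'I_n.+2 := widen_ord (leqnSn n.+1) i.
Definition X_idx : 'I_n.+2 := ord_max.
Definition xvar (i : 'I_n.+1) : fps K n.+2 := fps_var K (x_idx i).
Definition Xvar : fps K n.+2 := fps_var K X_idx.

End Variables.

Definition yvertex (n : nat) : finType := sd_vertex (bd_simplex n).

Definition yvar (n : nat) (I : yvertex n) : fps int #|yvertex n| :=
  fps_var int (enum_rank I).

Definition phi (n : nat) : fps int #|yvertex n| -> fps int n.+2 :=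
  fps_subst (fun j : 'I_#|yvertex n| => xvar int ord0 * Xvar int n
                      * \prod_(i in val (enum_val j)) xvar int (lift ord0 i)).

Lemma phi_yvar n (I : yvertex n) :
  phi (yvar I) = xvar int ord0 * Xvar int n
                 * \prod_(i in val I) xvar int (lift ord0 i).
Proof.
rewrite /phi; set g := fun j : 'I_#|_| => _.
rewrite -[RHS]/(xvar int ord0 * Xvar int n * \prod_(i in val I) _).
have gI : g (enum_rank I) = xvar int ord0 * Xvar int n
    * \prod_(i in val I) xvar int (lift ord0 i).
  by rewrite /g enum_rankK.
rewrite -{}gI; move: g => g; apply: fps_ext => m.
rewrite /fps_subst /yvar /fps_var [LHS]/=.
rewrite -(fsbig_widen [set U_(enum_rank I)%MM]%classic) //; last first.
  move=> a [_ ne]; rewrite /= mcoeffX.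
  by case: eqP => [e|_]; [case: ne|exact: mul0r].
rewrite fsbig_set1 mcoeffX eqxx mul1r; congr (fcoef _ m).
rewrite (bigD1 (enum_rank I)) // big1.
  by rewrite [LHS]mulr1 mnm1E eqxx expr1.
move=> j ne; rewrite mnm1E (_ : (enum_rank I == j) = false) ?expr0 //.
by apply/eqP => e; rewrite e eqxx in ne.
Qed.

Section Symplectic.
Variable n : nat.

Definition J0 (K : pzRingType) : 'M[K]_(n + n) := block_mx 0 1%:M (- 1%:M) 0.

Definition GSp (K : comUnitRingType) : set 'M[K]_(n + n) :=
  [set A | A \in unitmx /\
     exists2 mu : K, mu \is a GRing.unit &
       A *m J0 K *m A^T = mu *: J0 K]%classic.

Arguments GSp : clear implicits.

Variables (p : nat) (p_pr : prime p).

Local Notation Zp := (padic_int p_pr).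
Local Notation Qp := (padic_rat p_pr).

Definition toQp (m k : nat) (A : 'M[Zp]_(m, k)) : 'M[Qp]_(m, k) :=
  map_mx (@FracField.tofrac Zp) A.

Definition Gamma : set 'M[Zp]_(n + n) := GSp Zp.

Definition Gplus : set 'M[Zp]_(n + n) := [set A | GSp Qp (toQp A)]%classic.

Definition DC (m : nat) : set 'M[Zp]_(n + n) :=
  [set A | Gplus A /\ A *m J0 Zp *m A^T = m%:R *: J0 Zp]%classic.

Definition gcoset_of (A : 'M[Zp]_(n + n)) : set 'M[Zp]_(n + n) :=
  [set g *m A | g in Gamma]%classic.

Definition dcoset_of (A : 'M[Zp]_(n + n)) : set 'M[Zp]_(n + n) :=
  [set B | exists g h, [/\ Gamma g, Gamma h & B = g *m A *m h]]%classic.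

(* [M] = (p^delta (D^t)^-1, B; 0, D) with D upper triangular of diagonal
   (p^(d 0), ..., p^(d n.-1)). *)
Definition satake_form (M : 'M[Zp]_(n + n)) (delta : nat)
    (d : {ffun 'I_n -> nat}) : Prop :=
  exists B D : 'M[Zp]_n,
    [/\ forall i j : 'I_n, (j < i)%N -> D i j = 0,
        forall i, D i i = p%:R ^+ d i &
        toQp M = block_mx (p%:R ^+ delta *: invmx (toQp D)^T) (toQp B)
                          0 (toQp D)].

Variable C : fieldType.

(* The exponents (delta_i, (d_ij)_j) of a coset S = Gamma M_i; they do not depend
   on the representative of the prescribed form. *)
Definition satake_exponents (S : set 'M[Zp]_(n + n)) :
    nat * {ffun 'I_n -> nat} :=
  xget (0%N, [ffun=> 0%N])
    [set e | exists2 M, S M & satake_form M e.1 e.2]%classic.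

(* The variable x_j is ['X_j]. As the exponents delta_i and d_ij of integral
   matrices are nonnegative, the values lie in the subring C[x_0, ..., x_n] of
   the ring of Laurent polynomials. *)
Definition satake_monomial (e : nat * {ffun 'I_n -> nat}) : {mpoly C[n.+1]} :=
  'X_ord0 ^+ e.1 *
  \prod_(j < n) ((p%:R ^- j.+1 : C) *: 'X_(lift ord0 j)) ^+ e.2 j.

(* Omega on a double coset: the sum over the cosets Gamma M_i in it. *)
Definition Omega_dcoset (S : set 'M[Zp]_(n + n)) : {mpoly C[n.+1]} :=
  \sum_(L \in [set gcoset_of M | M in S]%classic)
     satake_monomial (satake_exponents L).

Definition dcosets : set (set 'M[Zp]_(n + n)) :=
  [set dcoset_of g | g in Gplus]%classic.

(* An element of the Hecke algebra is given by its (finitely supported)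
   coefficients in the basis of double cosets. *)
Definition Omega (T : set 'M[Zp]_(n + n) -> C) : {mpoly C[n.+1]} :=
  \sum_(S \in dcosets) T S *: Omega_dcoset S.

Definition TC (m : nat) : set 'M[Zp]_(n + n) -> C :=
  fun S => (S \in [set dcoset_of g | g in DC m]%classic)%:R.

(* \sum_alpha Omega(TC(p^alpha)) X^alpha *)
Definition Rser : fps C n.+2 :=
  FPS (fun m => (Omega (TC (p ^ m (X_idx n))))@_[multinom m (x_idx i) | i < n.+1]).

Definition Rpr : fps C n.+2 :=
  (1 - xvar C ord0 * Xvar C n) * (1 - (\prod_(i < n.+1) xvar C i) * Xvar C n)
  * Rser.

End Symplectic.

(* Rational functions in t, x_0, ..., x_n, X: the variable t, standing for the
   prime, is that of {poly C}. *)
Definition ratfun (C : fieldType) (n : nat) : fieldType :=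
  {fraction {mpoly {poly C}[n.+2]}}.

Definition specialize (C : fieldType) (n : nat) (a : C)
    (P : {mpoly {poly C}[n.+2]}) : {mpoly C[n.+2]} :=
  map_mpoly (horner_eval a) P.

(* Substituting t = a in W is meaningful when W has a denominator that does not
   vanish there, and f is then the power series expansion of the result. *)
Definition specializes_to (C : fieldType) (n : nat) (W : ratfun C n) (a : C)
    (f : fps C n.+2) : Prop :=
  exists P Q : {mpoly {poly C}[n.+2]},
    [/\ W = FracField.tofrac P / FracField.tofrac Q, specialize a Q != 0 &
        fps_of_mpoly (specialize a Q) * f = fps_of_mpoly (specialize a P)].

Definition represents_Rpr (C : fieldType) (n : nat) (W : ratfun C n) : Prop :=
  forall (p : nat) (p_pr : prime p), specializes_to W p%:R (Rpr n p_pr C).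

(* Main.v *)
Require Import Defs.
From HB Require Import structures.
From mathcomp Require Import all_boot all_order all_algebra.
From mathcomp Require Import mpoly.
From mathcomp Require Import boolp classical_sets cardinality fsbigop reals.
From mathcomp Require Import complex.
From mathcomp Require Import zify.
From mathcomp Require Import fingroup perm.
From mathcomp Require Import ring.

Set Implicit Arguments.
Unset Strict Implicit.
Unset Printing Implicit Defensive.
Import Order.TTheory GRing.Theory Num.Theory.
Local Open Scope ring_scope.

(** Why the theorem holds.

    The cosets [Gamma M] that occur in the Hecke operator of [p ^ a] have
    representatives [(p ^ a (D^t)^-1, B; 0, D)].  Here [D] runs over the
    sublattices [L] of [Z_p ^ n] that contain [p ^ a Z_p ^ n], given by
    triangular matrices, and [B = S D] with [S] symmetric, modulo integral
    symmetric matrices.  If [D] has elementary divisors [p ^ l_1, ..., p ^ l_n],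
    there are [p ^ m] such classes of [S], where [m] is the sum of the
    [min (l_i, l_j)] over [i <= j]: this is [card_sym_annihilator_chain].

    To sum over lattices, filter [L] by the lattices [L_i = L + p ^ i Z^n].  Each
    [L_(i+1)], expressed in an adapted basis of [L_i], is the preimage of a
    subspace of [F_p ^ n], hence a point of a Schubert cell, described by an
    echelon matrix and by the set [J] of its nonpivot coordinates.  In the
    adapted basis of [L_i] the lattice [p L_(i-1)] reduces to the coordinate
    subspace of the previous set, and a sequence of subspaces comes from a
    lattice exactly when each one is transversal to the coordinate subspace of
    the set before it ([chain_exists], [chain_inj]).  The exponent [m] is also
    the sum of the ['C(#|J| + 1, 2)] along the chain.  So the Hecke series is the
    sum over all paths of a transfer matrix indexed by the subsets of [[n]],
    whose entries involve the number of points of the cell of [J] that are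
    transversal to the coordinate subspace of [I]; this number is a product of
    binomials in [p] ([card_compatible_digits]).  The empty and the full set
    contribute exactly the two factors by which [R] is multiplied, and the
    primitive series is the sum over the paths through nonempty proper subsets
    ([Rpr_transfer_system]).

    Cramer's rule for this linear system, with [t] in place of [p], gives the
    rational function [transfer_fun].  Its denominator has a power of [t] as
    constant term, so it may be specialized at every nonzero [t].  Only one
    rational function can fit, as there are infinitely many primes.

    At [t = 1] the transfer coefficient from [I] to [J] is 1 if [J] is a subset
    of [I] and 0 otherwise.  The paths are then the multichains of nonempty
    proper subsets, that is, the monomials of the Stanley-Reisner ring of the
    barycentric subdivision: collecting equal sets turns the sum over multichains
    into a sum over chains of products of [phi_J / (1 - phi_J)], where [phi_J]
    is the image of [y_J].  This is [flag_sum_transfer_system], and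
    [subst_SR_hilb] compares the same sum with the Hilbert series. *)

(** * Valuations and residues of p-adic integers *)

Section PadicArithmetic.
Variables (p : nat) (p_pr : prime p).
Local Notation Zp := (padic_int p_pr).
Implicit Types x y : Zp.

Lemma pexpz_gt0 k : (0 < (p ^ k)%:Z).
Proof. by rewrite ltz_nat expn_gt0 prime_gt0. Qed.

Lemma pexpz_neq0 k : (p ^ k)%:Z != 0.
Proof. by rewrite gt_eqF ?pexpz_gt0. Qed.

Lemma pres_natr (a k : nat) : pres (a%:R : Zp) k = (a%:Z %% (p ^ k)%:Z)%Z.
Proof.
elim: a => [|a IHa]; first by rewrite /= mod0z.
by rewrite mulrSr /= IHa modzDm -PoszD addn1.
Qed.

Section DivideBy.
Variables (k : nat) (x : Zp).

Let shift_res i : int := (pres x (i + k) %/ (p ^ k)%:Z)%Z.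

Fact pdiv_subproof i : (shift_res i.+1 = shift_res i %[mod (p ^ i)%:Z])%Z.
Proof.
rewrite /shift_res addSn.
have pk0 := pexpz_neq0 k.
have <- := presP x (i + k); set a := pres x _.+1.
apply/eqP; rewrite eqz_mod_dvd.
rewrite {1}(divz_eq a (p ^ (i + k))%:Z) expnD PoszM mulrA divzMDl //.
by rewrite addrK dvdz_mull.
Qed.

(** The quotient by [p ^ k]: its digits are those of [x] shifted [k] places,
    which makes sense for every [x] and inverts the multiplication by [p ^ k]
    on its image. *)
Definition pdiv_pexp : Zp := padic_of p_pr pdiv_subproof.

Lemma pdiv_pexpK : pres x k = 0 -> p%:R ^+ k * pdiv_pexp = x.
Proof.
move=> xk0; apply: padic_ext => i.
have pk0 := pexpz_neq0 k.
rewrite -natrX /= pres_natr /= modzMml modzMmr /shift_res.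
have dvd : ((p ^ k)%:Z %| pres x (i + k))%Z.
  by apply/dvdz_mod0P; rewrite pres_le ?leq_addl.
by rewrite mulrC divzK // pres_le ?leq_addr.
Qed.

End DivideBy.

Lemma pres_pexpM k x : pres (p%:R ^+ k * x : Zp) k = 0.
Proof. by rewrite -natrX /= pres_natr /= modzz mul0r mod0z. Qed.

Lemma pnatr_neq0 : (p%:R : Zp) != 0.
Proof.
apply/eqP => /(congr1 (fun x => pres x 2)); rewrite pres_natr [RHS]mod0z.
have p1 := prime_gt1 p_pr; have p0 := prime_gt0 p_pr.
rewrite modz_small; first by case=> p00; rewrite p00 in p0.
by rewrite lez_nat ltz_nat leq0n -[X in (X < _)%N]expn1 ltn_exp2l.
Qed.

Lemma pexpr_neq0 k : (p%:R ^+ k : Zp) != 0.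
Proof. by rewrite expf_neq0 ?pnatr_neq0. Qed.

Section Inverse.
Variables (x : Zp) (x1 : pres x 1 != 0).

Let inv_res k : int := (egcdz (pres x k) (p ^ k)%:Z).1.

Let inv_resP k : (inv_res k * pres x k = 1 %[mod (p ^ k)%:Z])%Z.
Proof.
have g1 : gcdz (pres x k) (p ^ k)%:Z = 1.
  case: k => [|k]; first by rewrite expn0 /gcdz absz1 gcdn1.
  apply/eqP; rewrite -[_ == _]/(coprimez _ _) coprimezE absz_nat.
  rewrite coprimeXr // coprime_sym prime_coprime //.
  apply: contra x1 => dvd; rewrite -(pres_le x (ltn0Sn k)) expn1.
  by apply/eqP/dvdz_mod0P; rewrite dvdzE.
rewrite /inv_res; case: egcdzP => u v + _ /=; rewrite {}g1 => uv.
have -> : u * pres x k = 1 - v * (p ^ k)%:Z by rewrite -uv addrK.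
by apply/eqP; rewrite eqz_mod_dvd addrC addKr -mulNr dvdz_mull.
Qed.

Fact padic_inv_subproof k : (inv_res k.+1 = inv_res k %[mod (p ^ k)%:Z])%Z.
Proof.
have E1 : (inv_res k.+1 * pres x k = 1 %[mod (p ^ k)%:Z])%Z.
  rewrite -(presP x k) modzMmr.
  by rewrite -modz_pexp inv_resP modz_pexp.
rewrite -[inv_res k.+1]mulr1 -modzMmr -(inv_resP k) modzMmr mulrCA.
by rewrite -modzMmr E1 modzMmr mulr1.
Qed.

Lemma padic_unit : x \is a GRing.unit.
Proof.
apply/asboolP; exists (padic_of p_pr padic_inv_subproof).
by apply: padic_ext => k /=; rewrite modzMml inv_resP.
Qed.

End Inverse.

Lemma padic_unitE x : (x \is a GRing.unit) = (pres x 1 != 0).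
Proof.
apply/idP/idP => [/divrr xx1|]; last exact: padic_unit.
apply: contraTneq isT => x0; have := congr1 (fun y => pres y 1) xx1.
by rewrite /= x0 mul0r mod0z modz_small // ltz_nat expn1 prime_gt1.
Qed.

Lemma padic_factor x : x != 0 ->
  exists k (u : Zp), u \is a GRing.unit /\ x = p%:R ^+ k * u.
Proof.
case/padic_neq0 => k; elim: k x => [x|k IHk x xk].
  by rewrite -pres_mod expn0 modz1 eqxx.
have [x1|x1] := eqVneq (pres x 1) 0; last first.
  by exists 0%N, x; rewrite padic_unit // expr0 mul1r.
have Dx := pdiv_pexpK x1; set y := pdiv_pexp 1 x in Dx.
case: (IHk y) => [|l [u [uu Dy]]].
  apply: contra xk => /eqP yk; rewrite -Dx -(@pdiv_pexpK k y yk) mulrA -exprD.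
  by rewrite add1n pres_pexpM.
by exists l.+1, u; split=> //; rewrite -Dx Dy mulrA -exprD add1n.
Qed.

Lemma padic_dvd_total x y : (exists z, y = z * x) \/ (exists z, x = z * y).
Proof.
have [->|/padic_factor [k [u [uu ->]]]] := eqVneq x 0.
  by right; exists 0; rewrite mul0r.
have [->|/padic_factor [l [v [vu ->]]]] := eqVneq y 0.
  by left; exists 0; rewrite mul0r.
have [/subnK <-|/ltnW/subnK <-] := leqP k l.
  left; exists (p%:R ^+ (l - k) * v / u); rewrite exprD.
  by rewrite [p%:R ^+ k * u]mulrC mulrA divrK // mulrAC.
right; exists (p%:R ^+ (k - l) * u / v); rewrite exprD.
by rewrite [p%:R ^+ l * v]mulrC mulrA divrK // mulrAC.
Qed.

(** The valuation is well defined. *)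
Lemma pexpr_unit_inj k l (u v : Zp) : u \is a GRing.unit ->
  v \is a GRing.unit -> p%:R ^+ k * u = p%:R ^+ l * v -> k = l.
Proof.
wlog le_kl : k l u v / (k <= l)%N => [IH uu vu E|uu vu].
  by case: (leqP k l) => [le|/ltnW le]; [|apply/esym]; [move: E|move/esym: E];
    apply: IH.
rewrite -(subnK le_kl) addnC exprD -mulrA => /(mulfI (pexpr_neq0 k)) Du.
case: (l - k)%N Du => [|d Du]; first by rewrite addn0.
move: uu; rewrite padic_unitE Du exprS -mulrA.
by have := pres_pexpM 1 (p%:R ^+ d * v); rewrite expr1 => ->; rewrite eqxx.
Qed.

Lemma pexpr_unit k : (p%:R ^+ k : Zp) \is a GRing.unit = (k == 0%N).
Proof.
case: k => [|k]; first by rewrite expr0 unitr1.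
by rewrite padic_unitE -[p%:R ^+ _]mulr1 exprS -mulrA -{1}[p%:R]expr1 pres_pexpM eqxx.
Qed.

End PadicArithmetic.

(** Reduction modulo [p ^ k], with values in any ring where [p ^ k] vanishes:
    this covers the residue field and the quotients [Z / p ^ k] at once. *)
Section Reduction.
Variables (p : nat) (p_pr : prime p) (k : nat) (A : comNzRingType).
Hypothesis pA : (p ^ k)%:R = 0 :> A.
Local Notation Zp := (padic_int p_pr).

Definition pred_mod of (p ^ k)%:R = 0 :> A := fun x : Zp => (pres x k)%:~R : A.
Local Notation red := (pred_mod pA).

Lemma intr_mod_pexp (a : int) : (a %% (p ^ k)%:Z)%Z%:~R = a%:~R :> A.
Proof.
rewrite [in RHS](divz_eq a (p ^ k)%:Z) [RHS]intrD intrM -[X in _ * X]pmulrn.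
by rewrite pA mulr0 add0r.
Qed.

Fact pred_mod_is_zmod_morphism : zmod_morphism red.
Proof.
by move=> x y; rewrite /pred_mod /= modzDmr intr_mod_pexp intrB.
Qed.

Fact pred_mod_is_monoid_morphism : monoid_morphism red.
Proof.
split=> [|x y]; first by rewrite /pred_mod /= intr_mod_pexp.
by rewrite /pred_mod /= intr_mod_pexp intrM.
Qed.

HB.instance Definition _ :=
  GRing.isZmodMorphism.Build Zp A red pred_mod_is_zmod_morphism.
HB.instance Definition _ :=
  GRing.isMonoidMorphism.Build Zp A red pred_mod_is_monoid_morphism.

Lemma pred_mod_eq0 (A_faithful : forall a : nat, a%:R = 0 :> A -> (p ^ k %| a)%N) (x : Zp) :
  red x = 0 -> x = p%:R ^+ k * pdiv_pexp k x.
Proof.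
rewrite /pred_mod => x0; rewrite pdiv_pexpK // -pres_mod; apply/dvdz_mod0P.
have x_ge0 : 0 <= pres x k by rewrite -pres_mod modz_ge0 // pexpz_neq0.
rewrite dvdzE /=; apply: A_faithful.
by rewrite -[LHS]/(`|pres x k|%:Z%:~R) gez0_abs.
Qed.

Lemma pred_mod_pexp : red (p%:R ^+ k) = 0.
Proof. by rewrite -natrX rmorph_nat. Qed.

End Reduction.

Section Residues.
Variables (p : nat) (p_pr : prime p).
Local Notation Zp := (padic_int p_pr).

Fact Fp_pexp : (p ^ 1)%:R = 0 :> 'F_p.
Proof. by rewrite expn1; apply/eqP; rewrite -(dvdn_pcharf (pchar_Fp p_pr)). Qed.

Fact Fp_faithful (a : nat) : a%:R = 0 :> 'F_p -> (p ^ 1 %| a)%N.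
Proof. by move=> a0; rewrite expn1 (dvdn_pcharf (pchar_Fp p_pr)) a0. Qed.

Fact Zmod_gt1 a : (1 < p ^ a.+1)%N.
Proof. by rewrite -(expn0 p) ltn_exp2l ?prime_gt1. Qed.

Fact Zmod_pexp a : (p ^ a.+1)%:R = 0 :> 'Z_(p ^ a.+1).
Proof. exact: char_Zp (Zmod_gt1 a). Qed.

Fact Zmod_faithful k (a : nat) : a%:R = 0 :> 'Z_(p ^ k.+1) -> (p ^ k.+1 %| a)%N.
Proof.
by move=> /(congr1 val) /=; rewrite val_Zp_nat ?Zmod_gt1 // => /eqP.
Qed.

Definition residue : Zp -> 'F_p := pred_mod Fp_pexp.
(** The exponent of [p] is shifted by one, as ['Z_q] is the ring of integers
    modulo [q] only for [q > 1]. *)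
Definition reduce a : Zp -> 'Z_(p ^ a.+1) := pred_mod (Zmod_pexp a).

HB.instance Definition _ := GRing.RMorphism.on residue.
HB.instance Definition _ a := GRing.RMorphism.on (reduce a).

Definition lift_Z q (x : 'Z_q) : Zp := (x : nat)%:R.

Lemma residueK (x : 'F_p) : residue (lift_Z x) = x.
Proof. by rewrite rmorph_nat natr_Zp. Qed.

Lemma reduceK a (x : 'Z_(p ^ a.+1)) : reduce a (lift_Z x) = x.
Proof. by rewrite rmorph_nat natr_Zp. Qed.

Lemma residue_unit x : (x \is a GRing.unit) = (residue x != 0).
Proof.
rewrite padic_unitE; congr (~~ _).
apply/eqP/eqP => [x0 | /(@pred_mod_eq0 _ _ _ _ Fp_pexp Fp_faithful) ->].
  by rewrite /residue /pred_mod x0.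
by rewrite pres_pexpM.
Qed.

Lemma residue_p : residue p%:R = 0.
Proof. by have := pred_mod_pexp p_pr Fp_pexp; rewrite expr1. Qed.

Section Matrices.
Variables m n : nat.

Lemma mx_residue_eq0 (A : 'M[Zp]_(m, n)) :
  map_mx residue A = 0 -> exists B, A = p%:R *: B.
Proof.
move=> A0; exists (map_mx (pdiv_pexp 1) A); apply/matrixP=> i j.
rewrite !mxE -[p%:R]expr1 -(@pred_mod_eq0 _ _ _ _ Fp_pexp Fp_faithful) //.
by have /matrixP/(_ i j) := A0; rewrite !mxE.
Qed.

Lemma mx_reduce_eq0 a (A : 'M[Zp]_(m, n)) :
  map_mx (reduce a) A = 0 -> exists B, A = p%:R ^+ a.+1 *: B.
Proof.
move=> A0; exists (map_mx (pdiv_pexp a.+1) A); apply/matrixP=> i j.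
rewrite !mxE -(@pred_mod_eq0 _ _ _ _ (Zmod_pexp a) (@Zmod_faithful a)) //.
by have /matrixP/(_ i j) := A0; rewrite !mxE.
Qed.

Lemma mx_residueK (A : 'M['F_p]_(m, n)) : map_mx residue (map_mx (@lift_Z _) A) = A.
Proof. by apply/matrixP=> i j; rewrite !mxE residueK. Qed.

Lemma mx_reduceK a (A : 'M['Z_(p ^ a.+1)]_(m, n)) :
  map_mx (reduce a) (map_mx (@lift_Z _) A) = A.
Proof. by apply/matrixP=> i j; rewrite !mxE reduceK. Qed.

Lemma pexp_scale_inj k (A B : 'M[Zp]_(m, n)) : p%:R ^+ k *: A = p%:R ^+ k *: B -> A = B.
Proof.
move=> /matrixP E; apply/matrixP=> i j; have := E i j; rewrite !mxE.
exact/mulfI/pexpr_neq0.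
Qed.

End Matrices.
End Residues.

(** * Elementary divisors over a valuation ring *)

Section Smith.
Variable K : comUnitRingType.
Hypothesis dvd_total : forall x y : K, (exists z, y = z * x) \/ (exists z, x = z * y).

Lemma exists_common_divisor (I : finType) (i0 : I) (f : I -> K) :
  exists i, forall j, exists z, f j = z * f i.
Proof.
suff [i iP] : exists i, forall j, j \in enum I -> exists z, f j = z * f i.
  by exists i => j; apply: iP; rewrite mem_enum.
elim: (enum I) => [|j s [i iP]]; first by exists i0.
case: (dvd_total (f i) (f j)) => [[z Dj]|[z Di]].
  by exists i => k; rewrite inE => /predU1P[->|/iP //]; exists z.
exists j => k; rewrite inE => /predU1P[->|/iP[y ->]].
  by exists 1; rewrite mul1r.
by exists (y * z); rewrite -mulrA -Di.
Qed.

Definition rect_diag m n (d : nat -> K) : 'M[K]_(m, n) :=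
  \matrix_(i, j) (d i *+ (i == j :> nat)).

(** In a valuation ring some entry divides all the others, so that a single
    pivoting step clears its row and its column. *)
Lemma Smith_form m n (M : 'M[K]_(m, n)) :
  exists L R d, [/\ L \in unitmx, R \in unitmx & M = L *m rect_diag m n d *m R].
Proof.
elim: m => [|m IHm] in n M *.
  by exists 1%:M, 1%:M, (fun=> 0); rewrite !unitmx1; split=> //; apply/matrixP=> [[]].
case: n M => [|n] M.
  by exists 1%:M, 1%:M, (fun=> 0); rewrite !unitmx1; split=> //; apply/matrixP=> i [[]].
have [[i j] /= dvd_ij] := exists_common_divisor (ord0, ord0) (fun k => M k.1 k.2).
wlog [Di Dj] : M i j dvd_ij / i = 0 /\ j = 0.
  move=> /(_ (xrow i 0 (xcol j 0 M)) 0 0) [k||L [R [d [uL uR DM]]]] //.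
    by rewrite !mxE !tpermR; apply: (dvd_ij (_, _)).
  exists (xrow i 0 L), (xcol j 0 R), d; split.
  - by rewrite xrowE unitmx_mul unitmx_perm.
  - by rewrite xcolE unitmx_mul uR unitmx_perm.
  rewrite xrowE xcolE !mulmxA -[_ *m L *m _]mulmxA -[_ *m _ *m R]mulmxA -DM xrowE xcolE.
  rewrite !mulmxA -perm_mxM tperm2 perm_mx1 mul1mx -mulmxA -perm_mxM tperm2.
  by rewrite perm_mx1 mulmx1.
rewrite {i}Di {j}Dj in dvd_ij; set a := M 0 0 in dvd_ij.
have /choice [q Dq] : forall k : 'I_m.+1 * 'I_n.+1, exists z, M k.1 k.2 = z * a.
  exact: dvd_ij.
pose u : 'rV_n := \row_j q (0, rshift 1 j); pose v : 'cV_m := \col_i q (rshift 1 i, 0).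
pose N : 'M_(m, n) := @drsubmx _ 1 m 1 n M.
have [L [R [d [uL uR DN]]]] := IHm n (N - a *: (v *m u)).
exists (block_mx 1%:M 0 v L : 'M_(1 + m)), (block_mx 1%:M u 0 R : 'M_(1 + n)).
exists (fun k => if k is k'.+1 then d k' else a); split.
- by rewrite unitmxE (@det_lblock _ 1 m) det1 mul1r -unitmxE.
- by rewrite unitmxE (@det_ublock _ 1 n) det1 mul1r -unitmxE.
have -> : rect_diag m.+1 n.+1 (fun k => if k is k'.+1 then d k' else a)
    = block_mx a%:M 0 0 (rect_diag m n d) :> 'M_(1 + m, 1 + n).
  apply/matrixP=> i j; rewrite !mxE.
  case: splitP => k Dk; rewrite Dk !mxE; case: splitP => l Dl; rewrite Dl !mxE.
  - by rewrite !ord1 eqxx.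
  - by rewrite ord1.
  - by rewrite !ord1.
  by rewrite eqSS.
rewrite (@mulmx_block _ 1 m 1 m 1 n) (@mulmx_block _ 1 m 1 n 1 n).
rewrite !(mul1mx, mulmx1, mul0mx, mulmx0, addr0, add0r).
rewrite -DN -[M in LHS](@submxK _ 1 m 1 n) !mul_mx_scalar !mul_scalar_mx.
congr (@block_mx K 1 m 1 n _ _ _ _).
- by apply/matrixP=> i j; rewrite !ord1 !mxE !lshift0 mulr1n.
- apply/matrixP=> i j; rewrite !ord1 !mxE !lshift0.
  by rewrite (Dq (_, _)) mulrC.
- apply/matrixP=> i j; rewrite !ord1 !mxE !lshift0.
  by rewrite (Dq (_, _)) mulrC.
by rewrite -scalemxAl addrC subrK.
Qed.

End Smith.

(** * Symplectic matrices and block triangular representatives *)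

Section SymplecticForm.
Variables (K : comNzRingType) (n : nat).
Implicit Types A B C D : 'M[K]_n.

Lemma J0_sqr : J0 n K *m J0 n K = - 1%:M.
Proof.
rewrite /J0 mulmx_block !(mul0mx, mulmx0, mul1mx, mulmx1, add0r, addr0).
by rewrite [in RHS]scalar_mx_block opp_block_mx oppr0.
Qed.

Lemma block_mul_J0 A B C D :
  block_mx A B C D *m J0 n K = block_mx (- B) A (- D) C.
Proof.
by rewrite /J0 mulmx_block !(mulmx0, mulmx1, mulmxN, add0r, addr0).
Qed.

Lemma block_J0_form A B C D :
  block_mx A B C D *m J0 n K *m (block_mx A B C D)^T
  = block_mx (A *m B^T - B *m A^T) (A *m D^T - B *m C^T)
             (C *m B^T - D *m A^T) (C *m D^T - D *m C^T).
Proof.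
rewrite block_mul_J0 tr_block_mx mulmx_block !mulNmx.
by congr block_mx; rewrite addrC.
Qed.

Lemma scale_J0 (m : K) : m *: J0 n K = block_mx 0 m%:M (- m%:M) 0.
Proof. by rewrite /J0 scale_block_mx !scaler0 scalerN scalemx1. Qed.

Lemma J0_formM (g h : 'M[K]_(n + n)) (a b : K) :
    g *m J0 n K *m g^T = a *: J0 n K -> h *m J0 n K *m h^T = b *: J0 n K ->
  (g *m h) *m J0 n K *m (g *m h)^T = (a * b) *: J0 n K.
Proof.
move=> gJ hJ; rewrite trmx_mul; have -> : forall A B C D : 'M[K]_(n + n),
    g *m A *m B *m (C *m D) = g *m (A *m B *m C) *m D by move=> *; rewrite !mulmxA.
by rewrite hJ -scalemxAr -scalemxAl gJ scalerA mulrC.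
Qed.

Lemma upper_unipotent_J0 S : S^T = S ->
  let g := block_mx 1%:M S 0 1%:M in g *m J0 n K *m g^T = J0 n K.
Proof.
move=> sS /=; rewrite block_J0_form !(trmx0, trmx1, mulmx0, mul0mx, mulmx1, mul1mx).
by rewrite sS subrr subr0 sub0r subrr.
Qed.

Lemma lower_unipotent_J0 S : S^T = S ->
  let g := block_mx 1%:M 0 S 1%:M in g *m J0 n K *m g^T = J0 n K.
Proof.
move=> sS /=; rewrite block_J0_form !(trmx0, trmx1, mulmx0, mul0mx, mulmx1, mul1mx).
by rewrite sS subrr subr0 sub0r subrr.
Qed.

End SymplecticForm.

Lemma unitmx_J0_form (K : comUnitRingType) n (A : 'M[K]_(n + n)) (mu : K) :
  mu \is a GRing.unit -> A *m J0 n K *m A^T = mu *: J0 n K -> A \in unitmx.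
Proof.
move=> umu AJ; suff /mulmx1_unit[] :
  A *m (- mu^-1 *: (J0 n K *m A^T *m J0 n K)) = 1%:M by [].
rewrite -scalemxAr !mulmxA AJ -scalemxAl J0_sqr !scalerN scaleNr opprK scalerA.
by rewrite mulVr // scale1r.
Qed.

(** Over a domain, a square matrix of nonzero determinant can be cancelled even
    when it is not invertible. *)
Section RegularMatrices.
Variable K : idomainType.

Lemma mulmx_regular m n (A : 'M[K]_m) (B : 'M_(m, n)) :
  \det A != 0 -> A *m B = 0 -> B = 0.
Proof.
move=> dA AB; have : \adj A *m (A *m B) = 0 by rewrite AB mulmx0.
rewrite mulmxA mul_adj_mx mul_scalar_mx => E; apply/matrixP=> i j.
move/matrixP/(_ i j): E; rewrite !mxE => /eqP.
by rewrite mulf_eq0 (negPf dA) => /eqP.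
Qed.

Lemma mulmxr_regular m n (A : 'M[K]_m) (B : 'M_(n, m)) :
  \det A != 0 -> B *m A = 0 -> B = 0.
Proof.
move=> dA BA; apply: trmx_inj; rewrite trmx0; apply: (@mulmx_regular _ _ A^T).
  by rewrite det_tr.
by rewrite -trmx_mul BA trmx0.
Qed.

Lemma mulmx_regular_inj m n (A : 'M[K]_m) (B C : 'M_(m, n)) :
  \det A != 0 -> A *m B = A *m C -> B = C.
Proof.
move=> dA E; apply/eqP; rewrite -subr_eq0; apply/eqP/(mulmx_regular dA).
by rewrite mulmxBr E subrr.
Qed.

Lemma mulmxr_regular_inj m n (A : 'M[K]_m) (B C : 'M_(n, m)) :
  \det A != 0 -> B *m A = C *m A -> B = C.
Proof.
move=> dA E; apply/eqP; rewrite -subr_eq0; apply/eqP/(mulmxr_regular dA).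
by rewrite mulmxBl E subrr.
Qed.

Lemma det_mul_scalar_neq0 n (A B : 'M[K]_n) (m : K) :
  m != 0 -> A *m B = m%:M -> \det A != 0 /\ \det B != 0.
Proof.
move=> m0 /(congr1 determinant); rewrite det_mulmx det_scalar => E.
by apply/norP; rewrite -mulf_eq0 E expf_neq0.
Qed.

Lemma mulmx_scalarC n (A B : 'M[K]_n) (m : K) :
  m != 0 -> A *m B = m%:M -> B *m A = m%:M.
Proof.
move=> m0 AB; have [dA _] := det_mul_scalar_neq0 m0 AB.
apply: (mulmx_regular_inj dA); rewrite mulmxA AB mul_scalar_mx.
by rewrite mul_mx_scalar.
Qed.

End RegularMatrices.

(** If the rank of [A1] is not full, some vector [v] has [v A1 = 0] and
    [u := v A2 <> 0]; the symmetry makes [u] orthogonal to the rows of [A1],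
    so adding to one column of [A1], where [u] does not vanish, the same column
    of [A2] strictly decreases the kernel. *)
Lemma isotropic_shift (F : fieldType) n (A1 A2 : 'M[F]_n) :
  A1 *m A2^T = A2 *m A1^T -> row_free (row_mx A1 A2) ->
  exists s : 'I_n -> nat, A1 + A2 *m diag_mx (\row_i (s i)%:R) \in unitmx.
Proof.
have [k] := ubnP (n - \rank A1); elim: k A1 => // k IHk A1 ltk sA fA.
have [uA|] := boolP (A1 \in unitmx).
  exists (fun=> 0%N); rewrite (_ : diag_mx _ = 0) ?mulmx0 ?addr0 //.
  by apply/matrixP=> i j; rewrite !mxE mul0rn.
rewrite -row_free_unit -kermx_eq0 => /rowV0Pn[v /sub_kermxP vA1 v0].
pose u := v *m A2.
have /rV0Pn [i ui] : u != 0.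
  apply: contra v0 => /eqP u0; rewrite -(mulmx_free_eq0 _ fA).
  by rewrite mul_mx_row vA1 -/u u0 row_mx0.
pose D : 'M[F]_n := diag_mx (delta_mx 0 i).
pose A := A1 + A2 *m D.
have symA : A *m A2^T = A2 *m A^T.
  rewrite mulmxDl [A^T]raddfD mulmxDr sA /= trmx_mul tr_diag_mx.
  by rewrite mulmxA.
have wD (w : 'rV[F]_n) : w *m D = w 0 i *: delta_mx 0 i.
  apply/rowP=> j; rewrite mul_mx_diag !mxE /=.
  by case: eqP => [->|]; rewrite ?mulr1 ?mulr0.
have lt_ker : (kermx A < kermx A1)%MS.
  rewrite ltmxE; apply/andP; split; last first.
    apply: contra v0 => /(submx_trans (introT sub_kermxP vA1))/sub_kermxP.
    rewrite mulmxDr vA1 add0r mulmxA -/u wD => /eqP.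
    rewrite scaler_eq0 (negPf ui) /= => /eqP/rowP/(_ i)/eqP.
    rewrite !mxE; by rewrite !eqxx oner_eq0.
  apply/row_subP=> l; set w := row l _; apply/sub_kermxP.
  have : w *m A = 0 by apply/sub_kermxP; rewrite row_sub.
  rewrite mulmxDr mulmxA wD => E.
  suff w0 : (w *m A2) 0 i = 0 by move: E; rewrite w0 scale0r addr0.
  have A1u : A1 *m u^T = 0.
    by rewrite trmx_mul mulmxA sA -mulmxA -trmx_mul vA1 trmx0 mulmx0.
  have := congr1 (mulmx^~ u^T) E; rewrite mul0mx mulmxDl -mulmxA A1u mulmx0 add0r.
  rewrite -scalemxAl -rowE => /rowP/(_ 0)/eqP.
  rewrite mxE [X in _ * X]mxE [X in _ * X]mxE [X in _ == X]mxE.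
  by rewrite mulf_eq0 (negPf ui) orbF => /eqP.
have [] := IHk A.
- have := rank_ltmx lt_ker; rewrite !mxrank_ker; lia.
- exact: symA.
- rewrite (_ : row_mx A A2 = row_mx A1 A2 *m block_mx 1%:M 0 D 1%:M).
    rewrite /row_free mxrankMfree // row_free_unit.
    by rewrite unitmxE det_lblock !det1 mulr1 unitr1.
  by rewrite mul_row_block !(mulmx1, mulmx0, add0r).
move=> s us; exists (fun j => s j + (i == j))%N.
rewrite (_ : diag_mx _ = D + diag_mx (\row_j (s j)%:R)); first by rewrite mulmxDr addrA.
apply/matrixP=> a b; rewrite !mxE /= -mulrnDl eq_sym.
by rewrite addnC natrD.
Qed.

Section SymplecticReduction.
Variables (K : idomainType) (F : fieldType) (r : {rmorphism K -> F}).
Hypothesis dvd_total : forall x y : K, (exists z, y = z * x) \/ (exists z, x = z * y).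
Hypothesis unit_r : forall x : K, (x \is a GRing.unit) = (r x != 0).

Lemma unitmx_residue n (A : 'M[K]_n) : (A \in unitmx) = (map_mx r A \in unitmx).
Proof. by rewrite !unitmxE det_map_mx unit_r unitfE. Qed.

(** The first [n] columns span a lattice in an isotropic subspace; its
    saturation stays isotropic modulo the maximal ideal, so a shift makes its
    upper half invertible, and then the lower half is a symmetric multiple of
    the upper one, to be cleared by a unipotent symplectic matrix. *)
Lemma symplectic_triangular n (M : 'M[K]_(n + n)) (m : K) : m != 0 ->
    M *m J0 n K *m M^T = m *: J0 n K ->
  exists g : 'M[K]_(n + n), g *m J0 n K *m g^T = J0 n K /\ dlsubmx (g *m M) = 0.
Proof.
move=> m0 MJ.
pose Y := - (J0 n K *m M^T *m J0 n K).
have MY : M *m Y = m%:M.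
  by rewrite mulmxN !mulmxA MJ -scalemxAl J0_sqr scalerN opprK scalemx1.
have YM := mulmx_scalarC m0 MY.
have MtJ : M^T *m J0 n K *m M = m *: J0 n K.
  have := congr1 (mulmx (J0 n K)) YM.
  rewrite mulNmx mulmxN !mulmxA J0_sqr mulNmx mul1mx !mulNmx opprK => ->.
  by rewrite mul_mx_scalar.
have [L [R [d [uL uR DC]]]] := Smith_form dvd_total (lsubmx M).
pose H := rect_diag n n d *m R.
pose C := lsubmx L; pose C1 := usubmx C; pose C2 := dsubmx C.
have DM : lsubmx M = C *m H.
  rewrite DC mulmxA; congr (_ *m R).
  have -> : rect_diag (n + n) n d = col_mx (rect_diag n n d) 0.
    apply/matrixP=> i j; rewrite !mxE; case: splitP => k Dk; rewrite !mxE Dk //.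
    by rewrite gtn_eqF // ltn_addr.
  by rewrite -[L in LHS]hsubmxK mul_row_col mulmx0 addr0.
have dH : \det H != 0.
  have [] // := @det_mul_scalar_neq0 _ _ (usubmx Y *m C) H m m0.
  have : usubmx Y *m lsubmx M = ulsubmx (Y *m M).
    by rewrite -[Y in RHS]vsubmxK -[M in RHS]hsubmxK mul_col_row block_mxKul.
  by rewrite DM mulmxA YM scalar_mx_block block_mxKul => ->.
have symC : C1^T *m C2 = C2^T *m C1.
  have : C^T *m J0 n K *m C = 0.
    apply: (mulmxr_regular dH); apply: (@mulmx_regular _ _ _ H^T); rewrite ?det_tr //.
    rewrite -!mulmxA -DM !mulmxA -trmx_mul -DM.
    have := congr1 ulsubmx MtJ; rewrite scale_J0 block_mxKul => <-.
    rewrite -[in RHS](hsubmxK M) tr_row_mx mul_col_mx mul_col_row block_mxKul.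
    by [].
  rewrite -[C]vsubmxK -/C1 -/C2 tr_col_mx mul_row_block !(mulmx0, mulmx1, mulmxN, add0r, addr0).
  by rewrite mul_row_col mulNmx addrC => /subr0_eq.
have [||s us] := @isotropic_shift F n (map_mx r C1^T) (map_mx r C2^T).
- by rewrite !map_trmx !trmxK -!map_mxM symC.
- rewrite -map_row_mx -tr_col_mx vsubmxK /C.
  have : row_free (map_mx r L^T) by rewrite row_free_unit -unitmx_residue unitmx_tr.
  rewrite -[L in L^T]hsubmxK tr_row_mx map_col_mx -!kermx_eq0 -!submx0 => fL.
  apply/row_subP=> i; set w := row i _.
  have wC : w *m map_mx r (lsubmx L)^T = 0 by apply/sub_kermxP; rewrite row_sub.
  have : (row_mx w 0 <= kermx (col_mx (map_mx r (lsubmx L)^T) (map_mx r (rsubmx L)^T)))%MS.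
    by apply/sub_kermxP; rewrite mul_row_col wC mul0mx addr0.
  move=> /submx_trans/(_ fL); rewrite submx0 => /eqP E.
  by rewrite submx0 -(row_mxKl w (0 : 'rV_n)) E linear0.
pose S : 'M[K]_n := diag_mx (\row_i (s i)%:R).
have sS : S^T = S by rewrite tr_diag_mx.
pose P := C1 + S *m C2.
have uP : P \in unitmx.
  rewrite -unitmx_tr unitmx_residue raddfD /= trmx_mul sS map_mxD map_mxM.
  have <- : diag_mx (\row_i (s i)%:R) = map_mx r S.
    by apply/matrixP=> i j; rewrite !mxE rmorphMn rmorph_nat.
  exact: us.
have symP : P^T *m C2 = C2^T *m P.
  by rewrite raddfD /= trmx_mul sS mulmxDl mulmxDr symC mulmxA.
pose T := C2 *m invmx P.
have sT : T^T = T.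
  apply: (can_inj (mulmxK uP)); rewrite -mulmxA mulVmx // mulmx1.
  apply: (can_inj (mulKmx (_ : P^T \in unitmx))); first by rewrite unitmx_tr.
  by rewrite symP mulmxA -trmx_mul mulmxKV.
exists (block_mx 1%:M 0 (- T) 1%:M *m block_mx 1%:M S 0 1%:M); split.
  rewrite -[RHS]scale1r -[X in X *: _]mulr1; apply: J0_formM; rewrite scale1r.
    by apply: lower_unipotent_J0; rewrite raddfN /= sT.
  exact: upper_unipotent_J0.
rewrite -[M]hsubmxK mul_mx_row DM -[C]vsubmxK -/C1 -/C2.
rewrite [X in row_mx X](_ : _ = col_mx P 0 *m H).
  by rewrite mul_col_mx mul0mx -[X in row_mx _ X]vsubmxK -block_mxEh block_mxKdl.
rewrite mulmxA; congr (_ *m H).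
rewrite -mulmxA !mul_block_col !mul1mx !mul0mx add0r addr0 -/P.
by rewrite mulNmx mulmxKV // addNr.
Qed.

End SymplecticReduction.

(** * Echelon forms and the Schubert cells of a vector space *)

Section Echelon.
Variables (n : nat).

Definition coordmx (K : pzSemiRingType) (I : {set 'I_n}) : 'M[K]_n :=
  diag_mx (\row_j (j \in I)%:R).

Section Coordinates.
Variable K : comPzRingType.
Implicit Types I : {set 'I_n}.

Lemma mulmx_coord m I (A : 'M[K]_(m, n)) i j :
  (A *m coordmx K I) i j = A i j *+ (j \in I).
Proof. by rewrite mul_mx_diag !mxE mulr_natr. Qed.

Lemma mul_coordmx m I (A : 'M[K]_(n, m)) i j :
  (coordmx K I *m A) i j = A i j *+ (i \in I).
Proof. by rewrite mul_diag_mx !mxE mulr_natl. Qed.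

Lemma coordmx_idem I : coordmx K I *m coordmx K I = coordmx K I.
Proof.
apply/matrixP=> i j; rewrite mulmx_coord !mxE.
by case: eqP => [->|_]; case: (j \in I).
Qed.

End Coordinates.

Variable F : fieldType.
Implicit Types (I J : {set 'I_n}) (Q : 'M[F]_n).

(** A reduced echelon matrix [P] whose rows are normalised at the columns
    outside [J], completed by zero rows at [J], is encoded by the complementary
    projection [Q = 1 - P]: it is the identity on the coordinates in [J], and
    its other rows are supported on the later coordinates of [J]. *)
Definition digit Q := [forall i, forall j, (Q i j != 0) ==>
  (Q j j == 1) && ((i == j) || (Q i i == 0) && (i < j)%N)].

Definition digit_set Q : {set 'I_n} := [set j | Q j j != 0].

(** The free entries are the ones left to [Q i j] on the right-hand side: this form
    survives the lifting of [Q] to another ring. *)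
Lemma digitP J Q : reflect
  (forall i j, Q i j = if j \in J then
     if i == j then 1 else if (i \notin J) && (i < j)%N then Q i j else 0 else 0)
  (digit Q && (digit_set Q == J)).
Proof.
apply: (iffP andP) => [[/'forall_'forall_implyP dQ /eqP <-] i j | DQ].
  rewrite !inE; have [Qjj|Qjj] := eqVneq (Q j j) 0.
    by apply/eqP/idPn => /dQ/andP[/eqP]; rewrite Qjj => /esym/eqP; rewrite oner_eq0.
  have [->|ne_ij] := eqVneq i j; first by have /andP[/eqP] := dQ _ _ Qjj.
  have [->|/dQ/andP[_]] := eqVneq (Q i j) 0; first by rewrite if_same.
  by rewrite (negPf ne_ij) /= negbK => ->.
have QJ j : (Q j j != 0) = (j \in J).
  by rewrite DQ eqxx; case: ifP => _; rewrite ?oner_eq0 ?eqxx.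
split; last by apply/eqP/setP => j; rewrite inE QJ.
apply/'forall_'forall_implyP => i j.
have [jJ|jJ] := boolP (j \in J); last by rewrite DQ (negPf jJ) eqxx.
rewrite [Q j j]DQ jJ !eqxx /=; have [->|ne_ij] := eqVneq i j; first by [].
rewrite -[Q i i == 0]negbK QJ [Q i j]DQ jJ (negPf ne_ij).
by case: ifP => // _; rewrite eqxx.
Qed.

Lemma digitW Q : digit Q -> forall i j, Q i j = if j \in digit_set Q then
     if i == j then 1 else if (i \notin digit_set Q) && (i < j)%N then Q i j else 0 else 0.
Proof. by move=> dQ; apply/digitP; rewrite dQ eqxx. Qed.

Section Relations.
Variables (K : comPzRingType) (J : {set 'I_n}) (Q : 'M[K]_n).
Hypothesis DQ : forall i j, Q i j = if j \in J then
     if i == j then 1 else if (i \notin J) && (i < j)%N then Q i j else 0 else 0.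

Lemma echelon_coord : Q *m coordmx K J = Q.
Proof.
by apply/matrixP=> i j; rewrite mulmx_coord DQ; case: (j \in J); rewrite ?mulr1n ?mulr0n.
Qed.

Lemma coord_echelon : coordmx K J *m Q = coordmx K J.
Proof.
apply/matrixP=> i j; rewrite mul_coordmx DQ !mxE.
have [->|ne_ij] := eqVneq i j; first by case: (j \in J).
by case: (boolP (i \in J)) => //=; rewrite !if_same mul0rn.
Qed.

Lemma echelon_idem : Q *m Q = Q.
Proof. by rewrite -{1}echelon_coord -mulmxA coord_echelon echelon_coord. Qed.

Lemma echelon_above (i j : 'I_n) : (j < i)%N -> Q i j = 0.
Proof.
move=> lt_ji; rewrite DQ; have [Dij|_] := eqVneq i j; first by rewrite Dij ltnn in lt_ji.
by rewrite ltnNge ltnW // andbF if_same.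
Qed.

End Relations.

Lemma delta_sub_coord I i : i \in I -> ((delta_mx 0 i : 'rV[F]_n) <= coordmx F I)%MS.
Proof.
move=> iI; rewrite (_ : delta_mx 0 i = row i (coordmx F I)) ?row_sub //.
by apply/rowP=> j; rewrite !mxE iI eqxx eq_sym.
Qed.

Lemma coordmx_sub m I (A : 'M[F]_(m, n)) :
  (forall i, i \in I -> ((delta_mx 0 i : 'rV[F]_n) <= A)%MS) -> (coordmx F I <= A)%MS.
Proof.
move=> IA; apply/row_subP=> i; rewrite row_diag_mx !mxE.
by case: (boolP (i \in I)) => [/IA|_]; rewrite ?scale1r ?scale0r ?sub0mx.
Qed.

Lemma coordmxS I J : I \subset J -> (coordmx F I <= coordmx F J)%MS.
Proof. by move=> /fintype.subsetP IJ; apply: coordmx_sub => i /IJ /delta_sub_coord. Qed.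

Lemma sub_coordmx I (v : 'rV[F]_n) :
  (forall i, i \notin I -> v 0 i = 0) -> (v <= coordmx F I)%MS.
Proof.
move=> vI; apply/submxP; exists v; apply/rowP=> i; rewrite mulmx_coord.
by case: (boolP (i \in I)) => // /vI ->.
Qed.

(** [J] collects the coordinates that are not leading positions of vectors of
    the row space of [A]: they form a basis of the quotient. *)
Lemma digit_exists m (A : 'M[F]_(m, n)) :
  exists Q, [/\ digit Q, A *m Q = 0 & (1%:M - Q <= A)%MS].
Proof.
pose above (i : 'I_n) := [set b : 'I_n | (i < b)%N].
pose J := [set j | ~~ ((delta_mx 0 j : 'rV[F]_n) <= A + coordmx F (above j))%MS].
pose after i := J :&: above i.
have afterE i j : (j \in after i) = (j \in J) && (i < j)%N
  by rewrite finset.in_setI [in X in _ && X]inE.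
have spanJ i : i \notin J -> ((delta_mx 0 i : 'rV[F]_n) <= A + coordmx F (after i))%MS.
  have [k] := ubnP (n - i); elim: k i => // k IHk i lt_ik.
  rewrite inE negbK => /submx_trans; apply; rewrite addsmx_sub addsmxSl.
  apply: coordmx_sub => b; rewrite inE => lt_ib.
  have [bJ|bJ] := boolP (b \in J).
    by apply: submx_trans (addsmxSr _ _); apply: delta_sub_coord; rewrite inE bJ inE.
  apply: submx_trans (IHk b _ bJ) _; first by move: lt_ik (ltn_ord b); rewrite ltnS; lia.
  apply: addsmxS => //; apply: coordmxS.
  by apply: finset.setIS; apply/fintype.subsetP => c; rewrite !inE; apply: ltn_trans.
have /choice [w wP] : forall i, exists w : 'rV[F]_n,
    (delta_mx 0 i - w <= A)%MS /\ forall j, w 0 j =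
      if i \in J then (i == j)%:R else if j \in after i then w 0 j else 0.
  move=> i; case: (boolP (i \in J)) => [iJ|/spanJ/sub_addsmxP[[u v] /= Di]].
    exists (delta_mx 0 i); rewrite subrr sub0mx; split=> // j.
    by rewrite mxE eqxx eq_sym.
  exists (v *m coordmx F (after i)); split; first by rewrite Di addrK submxMl.
  by move=> j; rewrite mulmx_coord; case: (_ \in _).
pose Q : 'M[F]_n := \matrix_i w i.
have /andP[dQ /eqP JQ] : digit Q && (digit_set Q == J).
  apply/digitP => i j; rewrite mxE (wP i).2 afterE.
  have [->|ne_ij] := eqVneq i j; first by rewrite ltnn andbF; case: (j \in J).
  case: (i \in J) => /=; first by rewrite if_same.
  by case: (j \in J); case: (i < j)%N.
have QE := digitW dQ; rewrite {}JQ in QE.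
have subA : (1%:M - Q <= A)%MS.
  by apply/row_subP=> i; rewrite linearB /= rowK row1; case: (wP i).
exists Q; split=> //; apply/row_matrixP=> i; rewrite row0.
set u := row i _; have uA : (u <= A)%MS.
  have -> : u = row i A - row i A *m (1%:M - Q).
    by rewrite mulmxBr mulmx1 opprB addrC subrK -row_mul.
  by rewrite addmx_sub ?row_sub // eqmx_opp mulmx_sub.
have uJ : u = u *m coordmx F J by rewrite /u row_mul -mulmxA (echelon_coord QE).
clearbody u; apply/eqP/idPn => /rV0Pn [j0 uj0].
case: (@arg_minnP _ j0 (fun j => u 0 j != 0) (@nat_of_ord n)) => // j uj minj.
have: j \in J by move: uj; rewrite uJ mulmx_coord; case: (j \in J) => //; rewrite eqxx.
rewrite inE => /negP; apply.
have -> : delta_mx 0 j = (u 0 j)^-1 *: u + (delta_mx 0 j - (u 0 j)^-1 *: u).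
  by rewrite addrC subrK.
apply: addmx_sub; first by rewrite (submx_trans _ (addsmxSl _ _)) ?scalemx_sub.
rewrite (submx_trans _ (addsmxSr _ _)) //; apply: sub_coordmx => k; rewrite inE -leqNgt => le_kj.
rewrite !mxE eqxx /=; have [->|ne_kj] := eqVneq k j; first by rewrite mulVf ?subrr.
have [->|/minj] := eqVneq (u 0 k) 0; first by rewrite mulr0 subrr.
by rewrite leqNgt ltn_neqAle ne_kj le_kj.
Qed.

(** Two projections with the same kernel satisfy [Q Q' = Q'] and [Q' Q = Q];
    comparing the diagonals of these triangular matrices gives the same set of
    coordinates, and then [Q Q' = Q]. *)
Lemma digit_inj Q Q' : digit Q -> digit Q' -> (1%:M - Q :=: 1%:M - Q')%MS -> Q = Q'.
Proof.
move=> dQ dQ' eqQ.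
have half (A B : 'M[F]_n) : digit B -> (1%:M - A <= 1%:M - B)%MS -> B = A *m B.
  move=> dB /submxP[X DA]; apply/eqP; rewrite -subr_eq0 -[X in X - _]mul1mx -mulmxBl DA.
  by rewrite -mulmxA mulmxBl mul1mx (echelon_idem (digitW dB)) subrr mulmx0.
have QQ' : Q' = Q *m Q' by apply: half; rewrite // eqQ.
have Q'Q : Q = Q' *m Q by apply: half; rewrite // -eqQ.
have diag (A B : 'M[F]_n) i : digit A -> digit B -> (A *m B) i i = A i i * B i i.
  move=> dA dB; rewrite mxE (bigD1 i) //= big1 ?addr0 // => k ne_ki.
  have [lt_ki|lt_ik|/val_inj Dk] := ltngtP k i.
  - by rewrite (echelon_above (digitW dA)) ?mul0r.
  - by rewrite (echelon_above (digitW dB)) ?mulr0.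
  by rewrite Dk eqxx in ne_ki.
have JQ : digit_set Q = digit_set Q'.
  apply/setP => j; rewrite !inE; apply/idP/idP => nz.
    by move: nz; rewrite Q'Q diag // mulf_eq0 => /norP[].
  by move: nz; rewrite QQ' diag // mulf_eq0 => /norP[].
rewrite QQ' -[X in _ = X *m _](echelon_coord (digitW dQ)) -mulmxA JQ.
by rewrite (coord_echelon (digitW dQ')) -JQ (echelon_coord (digitW dQ)).
Qed.

(** Transversality to a coordinate subspace: the condition that links consecutive
    steps of the filtration of a lattice. *)
Definition compatible I Q := (1%:M <= (1%:M - Q) + coordmx F I)%MS.

(** In this form the condition is an independence of the columns of [Q], restricted
    to the rows in [I]. *)
Lemma compatibleP I Q : digit Q -> reflect
  (forall u : 'cV[F]_n, coordmx F I *m (Q *m u) = 0 -> Q *m u = 0) (compatible I Q).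
Proof.
move=> dQ; apply: (iffP idP) => [/sub_addsmxP[[X Y] /= E] u Qu0 | inj].
  have QQu : Q *m (Q *m u) = Q *m u by rewrite mulmxA (echelon_idem (digitW dQ)).
  by rewrite -[LHS]mul1mx E mulmxDl -!mulmxA mulmxBl mul1mx QQu subrr Qu0 !mulmx0 addr0.
have /submxP[Y DQ] : (Q <= coordmx F I *m Q)%MS.
  rewrite submxE; apply/eqP/matrixP=> i k; set N := cokermx _.
  have CN : coordmx F I *m Q *m N = 0 := mulmx_coker _; clearbody N.
  have : Q *m col k N = 0.
    by apply: inj; rewrite colE !mulmxA CN mul0mx.
  by rewrite colE mulmxA -colE => /colP/(_ i); rewrite mxE => ->; rewrite !mxE.
apply/sub_addsmxP; exists (1%:M - Y *m coordmx F I, Y *m coordmx F I) => /=.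
rewrite mulmxBr mulmx1 mulmxBl -(mulmxA Y _ Q) -DQ mul1mx subrr subr0.
by rewrite -mulmxA coordmx_idem subrK.
Qed.

End Echelon.

(** With [Q] an echelon projection and [J] its set of coordinates, the rows of
    [digit_mx] generate the lattice of the vectors whose reduction lies in the
    row space of [1 - Q]; [codigit_mx] is [c] times its inverse.  Modulo [c] the
    latter is [Q], whose row space is the coordinate subspace of [J]: this is the
    position of the multiples of [c] with respect to the new basis. *)
Section DigitMatrix.
Variables (K : comPzRingType) (n : nat) (c : K) (J : {set 'I_n}) (Q : 'M[K]_n).
Hypothesis DQ : forall i j, Q i j = if j \in J then
     if i == j then 1 else if (i \notin J) && (i < j)%N then Q i j else 0 else 0.

Definition digit_mx := 1%:M - Q + c *: coordmx K J.
Definition codigit_mx := Q + c *: (1%:M - coordmx K J).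

Let QJ := echelon_coord DQ.
Let JQ := coord_echelon DQ.
Let QQ := echelon_idem DQ.

Lemma digit_mxK : digit_mx *m codigit_mx = c%:M.
Proof.
have e1 : (1%:M - Q) *m Q = 0 by rewrite mulmxBl mul1mx QQ subrr.
have e2 : (1%:M - Q) *m (1%:M - coordmx K J) = 1%:M - coordmx K J.
  by rewrite mulmxBr mulmx1 mulmxBl mul1mx QJ opprB addrA subrK.
have e3 : coordmx K J *m (1%:M - coordmx K J) = 0.
  by rewrite mulmxBr mulmx1 coordmx_idem subrr.
rewrite mulmxDl !mulmxDr -!scalemxAl -!scalemxAr e1 e2 e3 JQ.
by rewrite !scaler0 addr0 add0r -scalerDr subrK scalemx1.
Qed.

Lemma codigit_mxK : codigit_mx *m digit_mx = c%:M.
Proof.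
have e1 : Q *m (1%:M - Q) = 0 by rewrite mulmxBr mulmx1 QQ subrr.
have e2 : (1%:M - coordmx K J) *m (1%:M - Q) = 1%:M - Q.
  by rewrite mulmxBl mul1mx mulmxBr mulmx1 JQ subrr subr0.
have e3 : (1%:M - coordmx K J) *m coordmx K J = 0.
  by rewrite mulmxBl mul1mx coordmx_idem subrr.
rewrite mulmxDl (mulmxDr Q) (mulmxDr (_ *: _)) -!scalemxAl -!scalemxAr e1 e2 e3 QJ.
by rewrite !scaler0 addr0 add0r -scalerDr addrC subrK scalemx1.
Qed.

Lemma digit_mx_above (i j : 'I_n) : (j < i)%N -> digit_mx i j = 0.
Proof.
move=> lt_ji; rewrite !mxE (echelon_above DQ lt_ji).
by case: eqP => [Dij|_]; rewrite ?Dij ?ltnn // in lt_ji *; rewrite !mulr0n mulr0 subr0 addr0.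
Qed.

Lemma digit_mx_diag i : digit_mx i i = c ^+ (i \in J).
Proof.
rewrite !mxE DQ !eqxx; case: (i \in J); first by rewrite subrr add0r mulr1.
by rewrite subr0 mulr0 addr0.
Qed.

Lemma det_digit_mx : \det digit_mx = c ^+ #|J|.
Proof.
rewrite -det_tr det_trig; last first.
  by apply/is_trig_mxP => i j lt_ij; rewrite mxE digit_mx_above.
under eq_bigr => i _ do rewrite mxE digit_mx_diag.
rewrite prodrXr; congr (_ ^+ _); rewrite -sum1_card [RHS]big_mkcond.
by apply: eq_bigr => i _; case: (i \in J).
Qed.

End DigitMatrix.

(** * Counting transversal points of a Schubert cell *)

Section CellCount.
Variables (F : finFieldType) (n : nat).
Implicit Types (I J T : {set 'I_n}) (Q : 'M[F]_n) (x y u : 'cV[F]_n).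

Definition supported T : {set 'cV[F]_n} :=
  [set x : 'cV[F]_n | [forall i, (x i 0 != 0) ==> (i \in T)]].

Lemma supportedP T x : reflect (forall i, i \notin T -> x i 0 = 0) (x \in supported T).
Proof.
rewrite inE; apply: (iffP 'forall_implyP) => xT i; first by apply: contraNeq => /xT.
by apply: contraNT => /xT ->.
Qed.

Lemma card_supported T : #|supported T| = (#|F| ^ #|T|)%N.
Proof.
rewrite -(@card_pffun_on _ _ 0 T predT).
rewrite -(@card_imset _ _ (fun f : {ffun 'I_n -> F} => \col_i f i)) => [|f g /colP fg]; last first.
  by apply/ffunP => i; have := fg i; rewrite !mxE.
apply: eq_card => x; apply/supportedP/imsetP => [xT | [f + ->] i iT].
  exists [ffun i => x i 0]; last by apply/colP=> i; rewrite mxE ffunE.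
  apply/pffun_onP; split=> //; apply/fintype.subsetP => i; rewrite inE ffunE.
  by apply: contraNT => /xT ->.
by case/pffun_onP => /supportP fT _; rewrite mxE fT.
Qed.

Definition before (m : nat) I := [set i : 'I_n | (i < m)%N && (i \notin I)].

Section Cell.
Variables I J : {set 'I_n}.

Definition independent Q :=
  [forall u : 'cV[F]_n, (coordmx F I *m (Q *m u) == 0) ==> (Q *m u == 0)].

(** The stages of the construction of a point of the cell, column by column. *)
Definition partial_cell m : {set 'M[F]_n} := [set Q : 'M[F]_n | [&&
  [forall i, forall j, (Q i j != 0) ==>
    [&& (j < m)%N, j \in J & (i == j) || (i \notin J) && (i < j)%N]],
  [forall j : 'I_n, (j < m)%N && (j \in J) ==> (Q j j == 1)] & independent Q]].

Lemma partial_cellP m Q : reflect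
  [/\ forall i j, Q i j != 0 -> [/\ (j < m)%N, j \in J & (i == j) || (i \notin J) && (i < j)%N],
      forall j : 'I_n, (j < m)%N -> j \in J -> Q j j = 1 & independent Q]
  (Q \in partial_cell m).
Proof.
rewrite inE; apply: (iffP and3P) => [[/'forall_'forall_implyP Q1 /forallP Q2 iQ] | [Q1 Q2 iQ]].
  split=> // [i j /Q1/and3P[] //|j jm jJ].
  by apply/eqP; have := Q2 j; rewrite jm jJ.
split=> //; first by apply/'forall_'forall_implyP => i j /Q1 [-> -> ->].
by apply/forallP => j; apply/implyP => /andP[jm jJ]; rewrite Q2.
Qed.

Lemma partial_cell_digit Q :
  (Q \in partial_cell n) = [&& digit Q, digit_set Q == J & compatible I Q].
Proof.
apply/partial_cellP/and3P => [[Q1 Q2 iQ] | [dQ JQ cQ]].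
  have /andP[dQ JQ] : digit Q && (digit_set Q == J).
    apply/digitP => i j; have [jJ|jJ] := boolP (j \in J); last first.
      by apply/eqP; apply: contraNT jJ => /Q1[].
    have [->|ne_ij] := eqVneq i j; first exact: Q2.
    have [->|/Q1[_ _]] := eqVneq (Q i j) 0; first by rewrite if_same.
    by rewrite (negPf ne_ij) /= => ->.
  split=> //; apply/(compatibleP _ dQ) => u /eqP cu.
  by apply/eqP; have /forallP/(_ u) := iQ; rewrite cu.
have DQ : forall i j, _ := elimT (digitP J Q) (introT andP (conj dQ JQ)).
split=> [i j | j _ jJ |]; first 1 last.
- by rewrite DQ jJ eqxx.
- by apply/forallP => u; apply/implyP => /eqP/(elimT (compatibleP _ dQ) cQ) ->.
rewrite DQ; have [jJ|] := boolP (j \in J); last by rewrite eqxx.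
have [->|ne_ij] := eqVneq i j; first by [].
by case: ifP => //; rewrite eqxx.
Qed.

Section Step.
Variables (m : 'I_n) (mJ : m \in J) (Q0 : 'M[F]_n) (Q0P : Q0 \in partial_cell m).

Definition add_col (Q : 'M[F]_n) x : 'M[F]_n := Q + (delta_mx m 0 + x) *m delta_mx 0 m.

Lemma add_colE Q x i j : add_col Q x i j = Q i j + ((i == m)%:R + x i 0) *+ (j == m).
Proof.
rewrite !mxE big_ord1 !mxE eqxx andbT /=.
by case: (j == m); rewrite ?mulr1 ?mulr0.
Qed.

Lemma add_col_mul Q x u : add_col Q x *m u = Q *m u + u m 0 *: (delta_mx m 0 + x).
Proof.
rewrite mulmxDl -mulmxA -rowE; congr (_ + _).
by apply/colP=> i; rewrite mxE big_ord1 mulrC !mxE.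
Qed.

Let J0 := J :&: [set i : 'I_n | (i < m)%N].

Let Q0E i j : Q0 i j = if j \in J0 then
     if i == j then 1 else if (i \notin J0) && (i < j)%N then Q0 i j else 0 else 0.
Proof.
have [Q1 Q2 _] := partial_cellP _ _ Q0P; rewrite !inE.
have [jJ|jJ] /= := boolP (j \in J); last first.
  by apply/eqP; apply: contraNT jJ => /Q1[].
have [jm|jm] := boolP (j < m)%N; last first.
  by apply/eqP; apply: contraNT jm => /Q1[].
have [->|ne_ij] := eqVneq i j; first exact: Q2.
have [->|/Q1[_ _]] := eqVneq (Q0 i j) 0; first by rewrite if_same.
by rewrite (negPf ne_ij) /= => /andP[/negPf-> ->].
Qed.

Let Q0_row (i : 'I_n) u : (m <= i)%N -> (Q0 *m u) i 0 = 0.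
Proof.
move=> le_mi; rewrite mxE big1 // => j _.
have [Q1 _ _] := partial_cellP _ _ Q0P.
have [->|/Q1[jm _]] := eqVneq (Q0 i j) 0; first by rewrite mul0r.
by case/predU1P => [ij|/andP[_ ij]]; exfalso; move: jm le_mi; [rewrite ij|move: ij]; lia.
Qed.

Let Q0_indep u : coordmx F I *m (Q0 *m u) = 0 -> Q0 *m u = 0.
Proof.
have [_ _ /forallP/(_ u)/implyP iQ] := partial_cellP _ _ Q0P.
by move/eqP/iQ/eqP.
Qed.

Let Q0_idem := echelon_idem Q0E.

Let Q0_outside x : x \in supported (before m J) -> Q0 *m x = 0.
Proof.
move=> /supportedP xT; rewrite -(echelon_coord Q0E) -mulmxA.
suff -> : coordmx F J0 *m x = 0 by rewrite mulmx0.
apply/colP=> i; rewrite mul_coordmx mxE !inE.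
by case: (boolP (i \in J)) => //= iJ; rewrite xT ?mulr0n ?mul0rn ?inE ?iJ ?andbF.
Qed.

Let indep_pivot x : m \in I -> x \in supported (before m J) -> independent (add_col Q0 x).
Proof.
move=> mI /supportedP xT; apply/forallP => u; apply/implyP; rewrite add_col_mul => /eqP E.
have um : u m 0 = 0.
  have := congr1 (fun v : 'cV_n => v m 0) E; rewrite mul_coordmx mI mulr1n mxE.
  by rewrite Q0_row // add0r !mxE !eqxx xT ?inE ?ltnn // addr0 mulr1.
by move: E; rewrite um scale0r addr0 => /Q0_indep ->.
Qed.

(** A dependence on the rows in [I] must involve the new column; scaled so that its
    coefficient there is [-1], it is a combination [Q0 v] that agrees with [x] on
    these rows, and [y] is [x - Q0 v]. *)
Let indep_nonpivot x : m \notin I -> x \in supported (before m J) ->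
  independent (add_col Q0 x) =
    (x \notin [set (1%:M - Q0) *m y | y in supported (before m I)]).
Proof.
move=> mI xT; have /supportedP xT0 := xT; apply/forallP/idP => [indep | /imsetP nbad u].
  apply/imsetP => -[y /supportedP yT Dx].
  have := indep (y + delta_mx m 0); rewrite add_col_mul (mulmxDr Q0).
  have -> : Q0 *m delta_mx m 0 = 0 :> 'cV_n.
    rewrite -colE; apply/colP=> i; rewrite !mxE Q0E !inE ltnn andbF.
    by [].
  have -> : (y + delta_mx m 0) m 0 = 1.
    by rewrite !mxE !eqxx yT ?inE ?ltnn // add0r.
  rewrite scale1r addr0 Dx mulmxBl mul1mx addrCA [X in _ + X]addrC subrK.
  have -> : coordmx F I *m (delta_mx m 0 + y) = 0.
    apply/colP=> i; rewrite mul_coordmx [RHS]mxE; case: (boolP (i \in I)) => // iI.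
    rewrite mulr1n !mxE eqxx andbT yT ?inE ?iI ?andbF // addr0.
    by case: eqP => // im; rewrite -im iI in mI.
  rewrite eqxx /= => /eqP/colP/(_ m)/eqP; rewrite !mxE !eqxx yT ?inE ?ltnn //.
  by rewrite addr0 oner_eq0.
apply/implyP; rewrite add_col_mul => /eqP E.
have [um|um] := eqVneq (u m 0) 0.
  by move: E; rewrite um scale0r addr0 => /Q0_indep ->.
pose v := - (u m 0)^-1 *: u; pose y := x - Q0 *m v.
case: nbad; exists y; last first.
  rewrite mulmxBl mul1mx mulmxBr mulmxA Q0_idem (Q0_outside xT) sub0r opprK.
  by rewrite /y subrK.
apply/supportedP => i; rewrite inE negb_and negbK -leqNgt => /orP[le_mi|iI].
  by rewrite 2!mxE Q0_row // subr0 xT0 // inE ltnNge le_mi.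
have := congr1 (fun v : 'cV_n => v i 0) E; rewrite mul_coordmx iI mulr1n.
rewrite /y /v -scalemxAr scaleNr opprK !mxE eqxx andbT.
have -> : (i == m) = false by apply/eqP => im; rewrite -im iI in mI.
move=> E0; apply: (mulfI um); rewrite mulr0 mulrDr mulrA mulfV // mul1r.
by rewrite addrC -[RHS]E0 add0r.
Qed.

(** The map [y |-> (1 - Q0) y] is injective on the parameters of the excluded
    columns, by the independence of the columns of [Q0]. *)
Lemma card_good_col :
  #|[set x in supported (before m J) | independent (add_col Q0 x)]|%:Z
  = (#|F| ^ #|before m J|)%:Z - (m \notin I)%:Z * (#|F| ^ #|before m I|)%:Z.
Proof.
have [mI|mI] /= := boolP (m \in I).
  rewrite mul0r subr0 -card_supported; congr (Posz _); apply: eq_card => x.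
  by rewrite [LHS]inE; apply/andb_idr/indep_pivot.
rewrite mul1r -!card_supported; set bad := [set (1%:M - Q0) *m y | y in supported (before m I)].
have sub_bad : bad \subset supported (before m J).
  apply/fintype.subsetP => _ /imsetP[y /supportedP yT ->]; apply/supportedP => i.
  rewrite mulmxBl mul1mx inE negb_and negbK 2!mxE.
  case: (ltnP i m) => [im iJ|le_mi _]; last by rewrite Q0_row // subr0 yT // inE ltnNge le_mi.
  have := congr1 (fun v : 'cV_n => v i 0) (congr1 (mulmx^~ y) (coord_echelon Q0E)).
  rewrite /= -mulmxA !mul_coordmx !inE im andbT.
  by move: iJ => /= ->; rewrite !mulr1n => ->; rewrite subrr.
have <- : #|bad| = #|supported (before m I)|.
  apply: card_in_imset => y y' /supportedP yT /supportedP yT' E.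
  apply/eqP; rewrite -subr_eq0; set z := y - y'.
  have : (1%:M - Q0) *m z = 0 by rewrite mulmxBr E subrr.
  rewrite mulmxBl mul1mx => /subr0_eq Dz.
  rewrite Dz Q0_indep //; rewrite -Dz; apply/colP=> i; rewrite mul_coordmx [RHS]mxE.
  case: (boolP (i \in I)) => // iI.
  by rewrite mulr1n !mxE yT ?yT' ?subrr // inE iI andbF.
have -> : [set x in supported (before m J) | independent (add_col Q0 x)]
    = supported (before m J) :\: bad.
  apply/setP => x; rewrite finset.in_setD inE andbC.
  by case: (boolP (x \in _ )) => [xT|]; rewrite ?andbF // indep_nonpivot.
rewrite cardsD (finset.setIidPr sub_bad) subzn //; exact: subset_leq_card.
Qed.

End Step.
Lemma card_partial_cellS (m : 'I_n) : m \in J ->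
  #|partial_cell m.+1| = (\sum_(Q in partial_cell m)
     #|[set x in supported (before m J) | independent (add_col m Q x)]|)%N.
Proof.
move=> mJ; pose good Q := [set x in supported (before m J) | independent (add_col m Q x)].
transitivity #|[set k : 'M[F]_n * 'cV[F]_n | (k.1 \in partial_cell m) && (k.2 \in good k.1)]|;
    last first.
  rewrite cardsE -sum1_card -(pair_big_dep (fun Q => Q \in partial_cell m)
    (fun Q x => x \in good Q) (fun _ _ => 1%N)) /=.
  by apply: eq_bigr => Q _; rewrite sum1_card.
have colm Q i : Q \in partial_cell m -> Q i m = 0.
  by case/partial_cellP=> Q1 _ _; apply/eqP; apply: contraTT isT => /Q1[]; rewrite ltnn.
rewrite -(@card_in_imset _ _ (fun k => add_col m k.1 k.2)) => [|[Q x] [Q' x'] /=]; last first.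
  move=> kP kP' /matrixP E; have [QP QP'] : Q \in partial_cell m /\ Q' \in partial_cell m.
    by split; [move: kP | move: kP']; rewrite inE => /andP[].
  congr (_, _).
    apply/matrixP=> i j; have [->|ne_jm] := eqVneq j m; first by rewrite !colm.
    by have := E i j; rewrite !add_colE (negPf ne_jm) !mulr0n !addr0.
  apply/colP=> i; have := E i m; rewrite !add_colE eqxx !colm // !add0r !mulr1n.
  exact: addrI.
apply: eq_card => Q; apply/idP/imsetP => [QP | [[Q0 x] /=]].
  have /partial_cellP[Q1 Q2 iQ] := QP.
  pose Q0 := Q *m coordmx F [set~ m]; pose x := col m Q - delta_mx m 0.
  have DQ : Q = add_col m Q0 x.
    apply/matrixP=> i j; rewrite add_colE mulmx_coord !inE.
    have [->|_] := eqVneq j m; last by rewrite mulr1n mulr0n addr0.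
    by rewrite mulr0n add0r !mxE eqxx andbT [RHS]addrC subrK.
  exists (Q0, x) => //; rewrite inE /=; apply/andP; split; last first.
    rewrite inE -DQ iQ andbT; apply/supportedP => i; rewrite inE negb_and negbK !mxE eqxx andbT.
    have [->|ne_im] := eqVneq i m; first by rewrite Q2 ?subrr.
    rewrite subr0 => iT; apply/eqP; apply: contraTT iT => /Q1[_ _].
    by rewrite (negPf ne_im) negb_or negbK andbC.
  apply/partial_cellP; split=> [i j|j jm jJ|].
  - rewrite mulmx_coord !inE; have [_|ne_jm] := eqVneq j m; first by rewrite mulr0n eqxx.
    rewrite mulr1n => /Q1[jm jJ Qij]; split=> //; move: jm.
    by rewrite ltnS leq_eqVlt => /orP[/eqP/val_inj/eqP|//]; rewrite (negPf ne_jm).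
  - rewrite mulmx_coord !inE; have [jm'|_] := eqVneq j m; first by rewrite jm' ltnn in jm.
    by rewrite mulr1n Q2 // ltnW.
  by apply/forallP => u; rewrite -mulmxA; apply: (forallP iQ).
move=> + ->; rewrite inE => /andP[/= Q0P]; rewrite inE => /andP[xT iQ].
have /partial_cellP[Q1 Q2 _] := Q0P.
move/supportedP in xT.
apply/partial_cellP; split=> // [i j|j].
  rewrite add_colE; have [->|ne_jm] := eqVneq j m; last first.
    by rewrite mulr0n addr0 => /Q1[jm jJ ij]; split=> //; apply: ltnW.
  rewrite colm // add0r mulr1n => nz; split=> //; have [//|ne_im] := eqVneq i m.
  by apply: contraNT nz => iT; rewrite (negPf ne_im) add0r xT // inE andbC.
move=> lt_jm jJ; rewrite add_colE; have [->|ne_jm] := eqVneq j m.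
  by rewrite colm // xT ?inE ?ltnn // add0r addr0.
rewrite mulr0n addr0 Q2 //; move: lt_jm.
by rewrite ltnS leq_eqVlt => /orP[/eqP/val_inj/eqP|//]; rewrite (negPf ne_jm).
Qed.

Lemma partial_cell_skip (m : 'I_n) : m \notin J -> partial_cell m.+1 = partial_cell m.
Proof.
move=> mJ; have ltS (j : 'I_n) : j \in J -> (j < m.+1)%N = (j < m)%N.
  move=> jJ; rewrite ltnS leq_eqVlt; case: eqP => // /val_inj jm.
  by rewrite -jm jJ in mJ.
apply/setP => Q; apply/partial_cellP/partial_cellP=> -[Q1 Q2 iQ]; split=> // [i j|j jm jJ].
- by case/Q1=> jm jJ; rewrite -ltS.
- by rewrite Q2 // ltS.
- by case/Q1=> jm jJ; rewrite ltS.
by rewrite Q2 // -ltS.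
Qed.

Lemma card_partial_cell m : (m <= n)%N ->
  #|partial_cell m|%:Z = \prod_(j : 'I_n | (j < m)%N && (j \in J))
    ((#|F| ^ #|before j J|)%:Z - (j \notin I)%:Z * (#|F| ^ #|before j I|)%:Z).
Proof.
elim: m => [_ | m IHm lt_mn].
  rewrite big_pred0 //; have -> : partial_cell 0 = [set 0]; last by rewrite cards1.
  apply/setP => Q; rewrite [RHS]inE; apply/partial_cellP/eqP => [[Q1 _ _] | ->].
    by apply/matrixP=> i j; rewrite mxE; apply/eqP; apply: contraTT isT => /Q1[].
  split=> [i j|//|]; first by rewrite mxE eqxx.
  by apply/forallP => u; rewrite mul0mx eqxx implybT.
pose m' := Ordinal lt_mn.
have ltS (j : 'I_n) : (j < m.+1)%N = (j == m') || (j < m)%N by rewrite ltnS leq_eqVlt.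
have [mJ|mJ] := boolP (m' \in J); last first.
  rewrite (partial_cell_skip mJ) (IHm (ltnW lt_mn)); apply: eq_bigl => j.
  by rewrite ltS; case: eqP => // ->; rewrite (negPf mJ) ltnn.
rewrite (card_partial_cellS mJ) (bigD1 m') /=; last by rewrite ltnSn.
rewrite (eq_bigl (fun j : 'I_n => (j < m)%N && (j \in J))) => [|j]; last first.
  rewrite ltS; case: eqP => [->|_] /=; first by rewrite ltnn !andbF.
  by rewrite andbT.
rewrite -(IHm (ltnW lt_mn)) -natz natr_sum.
under eq_bigr => Q QP do rewrite natz (card_good_col mJ QP).
by rewrite sumr_const -mulr_natr natz.
Qed.

End Cell.

(** The [j]-th factor counts the admissible choices of the [j]-th column. *)
Theorem card_compatible_digits I J :
  #|[set Q : 'M[F]_n | [&& digit Q, digit_set Q == J & compatible I Q]]|%:Z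
  = \prod_(j in J) ((#|F| ^ #|before j J|)%:Z
                     - (j \notin I)%:Z * (#|F| ^ #|before j I|)%:Z).
Proof.
rewrite (eq_bigl (fun j : 'I_n => (j < n)%N && (j \in J))) => [|j]; last by rewrite ltn_ord.
rewrite -card_partial_cell //; congr (Posz _); apply: eq_card => Q.
by rewrite inE partial_cell_digit.
Qed.

End CellCount.

(** * Lattices as chains of Schubert cells *)

Section Chains.
Variables (p : nat) (p_pr : prime p) (n : nat).
Local Notation Zp := (padic_int p_pr).
Local Notation red := (map_mx (@residue p p_pr)).
Local Notation lift := (map_mx (@lift_Z p p_pr _)).
Implicit Types (I J : {set 'I_n}) (Q : 'M['F_p]_n) (c : seq 'M['F_p]_n).

Definition digit_lift Q : 'M[Zp]_n := digit_mx p%:R (digit_set Q) (lift Q).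
Definition codigit_lift Q : 'M[Zp]_n := codigit_mx p%:R (digit_set Q) (lift Q).

(** The head of the sequence is the first step of the filtration, hence the
    rightmost factor: each lattice is expressed in the basis of the previous one. *)
Definition chain_mx c : 'M[Zp]_n := foldr (fun Q D => D *m digit_lift Q) 1%:M c.
Definition cochain_mx c : 'M[Zp]_n := foldr (fun Q D => codigit_lift Q *m D) 1%:M c.

Fixpoint chain I c : bool :=
  if c is Q :: c' then [&& digit Q, compatible I Q & chain (digit_set Q) c'] else true.

Lemma lift_digit Q : digit Q -> forall i j, lift Q i j = if j \in digit_set Q then
  if i == j then 1 else if (i \notin digit_set Q) && (i < j)%N then lift Q i j else 0 else 0.
Proof.
move=> dQ i j; rewrite !mxE {1}(digitW dQ).
by case: (j \in _) => //; case: (i == j) => //; case: (_ && _).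
Qed.

Lemma digit_liftK Q : digit Q -> digit_lift Q *m codigit_lift Q = p%:R%:M.
Proof. by move=> dQ; apply: digit_mxK (lift_digit dQ). Qed.

Lemma codigit_liftK Q : digit Q -> codigit_lift Q *m digit_lift Q = p%:R%:M.
Proof. by move=> dQ; apply: codigit_mxK (lift_digit dQ). Qed.

Lemma det_digit_lift Q : digit Q -> \det (digit_lift Q) = p%:R ^+ #|digit_set Q|.
Proof. by move=> dQ; apply: det_digit_mx (lift_digit dQ). Qed.

Lemma det_digit_lift_neq0 Q : digit Q -> \det (digit_lift Q) != 0.
Proof. by move=> dQ; rewrite det_digit_lift // pexpr_neq0. Qed.

Lemma red_digit_lift Q : red (digit_lift Q) = 1%:M - Q.
Proof.
rewrite /digit_lift /digit_mx map_mxD map_mxB map_mx1 mx_residueK map_mxZ.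
by rewrite /= residue_p scale0r addr0.
Qed.

Lemma red_codigit_lift Q : red (codigit_lift Q) = Q.
Proof.
by rewrite /codigit_lift /codigit_mx map_mxD mx_residueK map_mxZ /= residue_p scale0r addr0.
Qed.

Lemma chain_mxK I c : chain I c -> chain_mx c *m cochain_mx c = (p%:R ^+ size c)%:M.
Proof.
elim: c I => [|Q c IHc] I /=; first by rewrite mulmx1 expr0.
case/and3P=> dQ _ /IHc Dc; rewrite mulmxA -(mulmxA _ (digit_lift Q)) digit_liftK //.
by rewrite mul_mx_scalar -scalemxAl Dc exprS scale_scalar_mx.
Qed.

Lemma cochain_mxK I c : chain I c -> cochain_mx c *m chain_mx c = (p%:R ^+ size c)%:M.
Proof. by move=> /chain_mxK/mulmx_scalarC -> //; rewrite pexpr_neq0. Qed.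

Lemma det_chain_neq0 I c : chain I c -> \det (chain_mx c) != 0.
Proof. by move=> /chain_mxK/(det_mul_scalar_neq0 (pexpr_neq0 _ _))[]. Qed.

(** The first digit records the lattice modulo [p]: the transversality of the
    next digit guarantees that nothing is lost. *)
Lemma red_chain_cons Q c : digit Q ->
    (1%:M <= red (chain_mx c) + coordmx _ (digit_set Q))%MS ->
  (red (chain_mx (Q :: c)) :=: 1%:M - Q)%MS.
Proof.
move=> dQ /sub_addsmxP[[X Y] /= E]; apply/eqmxP.
rewrite map_mxM red_digit_lift submxMl /=; apply/submxP; exists X.
rewrite mulmxA -[LHS]mul1mx {1}E mulmxDl -[RHS]addr0; congr (_ + _).
by rewrite -mulmxA mulmxBr mulmx1 (coord_echelon (digitW dQ)) subrr mulmx0.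
Qed.

Lemma chain_full I c : chain I c -> (1%:M <= red (chain_mx c) + coordmx _ I)%MS.
Proof.
elim: c I => [|Q c IHc] I /=; first by rewrite map_mx1 addsmxSl.
case/and3P=> dQ cQ /IHc/(red_chain_cons dQ) eqQ.
by apply: submx_trans cQ _; rewrite addsmxS // -eqQ.
Qed.

(** The first digit is the echelon form of [D] modulo [p], for which the rows of
    [digit_lift Q] generate [L + p Z^n].  The matrix [D2] of [L] in this basis is
    one step shorter, and transversal to the coordinate subspace of the set of
    [Q], which is [p Z^n] modulo [p (L + p Z^n)]. *)
Lemma chain_exists a I (D D' : 'M[Zp]_n) :
    D' *m D = (p%:R ^+ a)%:M -> (1%:M <= red D + coordmx _ I)%MS ->
  exists c U, [/\ size c = a, chain I c, U \in unitmx & D = U *m chain_mx c].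
Proof.
elim: a I D D' => [|a IHa] I D D' D'D fullD.
  exists [::], D; split; rewrite ?mulmx1 //.
  by rewrite expr0 in D'D; have [] := mulmx1_unit D'D.
have [Q [dQ DQ0 /submxP[X DX]]] := digit_exists (red D).
have dE := det_digit_lift_neq0 dQ; have EsE := codigit_liftK dQ.
have [D2 DD2] : exists D2, D *m codigit_lift Q = p%:R *: D2.
  by apply: mx_residue_eq0; rewrite map_mxM red_codigit_lift.
have {DD2} DD2 : D = D2 *m digit_lift Q.
  apply: (@pexp_scale_inj _ p_pr _ _ 1); rewrite expr1 scalemxAl -DD2 -mulmxA EsE.
  by rewrite mul_mx_scalar.
have [Y DY] : exists Y, lift X *m D - digit_lift Q = p%:R *: Y.
  apply: mx_residue_eq0; rewrite map_mxB map_mxM mx_residueK red_digit_lift DX.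
  by rewrite subrr.
have {}DY : digit_lift Q = lift X *m D - p%:R *: Y by rewrite -DY opprB addrC subrK.
have full2 : 1%:M = lift X *m D2 - Y *m codigit_lift Q.
  apply: (mulmxr_regular_inj dE); rewrite mul1mx mulmxBl -!mulmxA -DD2 EsE.
  by rewrite mul_mx_scalar.
have [||c [U [szc cc uU D2E]]] := IHa (digit_set Q) D2 (p%:R ^+ a *: lift X - Y *m D').
- apply: (mulmxr_regular_inj dE); rewrite mul_scalar_mx {2}DY scalerBr scalerA -exprSr.
  rewrite -mulmxA -DD2 mulmxBl -scalemxAl; congr (_ - _).
  by rewrite -mulmxA D'D mul_mx_scalar.
- apply/sub_addsmxP; exists (X, - (red Y *m Q)) => /=.
  rewrite mulNmx -mulmxA (echelon_coord (digitW dQ)).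
  have := congr1 (fun A => red A) full2.
  by rewrite map_mx1 map_mxB !map_mxM mx_residueK red_codigit_lift.
exists (Q :: c), U; rewrite /= szc dQ cc uU DD2 D2E mulmxA andbT; split=> //.
have eqQ : (red D <= 1%:M - Q)%MS.
  by apply/submxP; exists (red D); rewrite mulmxBr mulmx1 DQ0 subr0.
by apply: submx_trans fullD _; rewrite addsmxS.
Qed.

(** The first digit is read off from the lattice modulo [p]; then it is cancelled. *)
Lemma chain_inj I c c' U : chain I c -> chain I c' -> size c = size c' ->
  U \in unitmx -> chain_mx c' = U *m chain_mx c -> c = c'.
Proof.
elim: c c' I => [|Q c IHc] [|Q' c'] I //=.
case/and3P=> dQ _ cc /and3P[dQ' _ cc'] [szc] uU E.
have QQ' : Q = Q'.
  apply: digit_inj => //.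
  apply: eqmx_trans (eqmx_sym (red_chain_cons dQ (chain_full cc))) _.
  apply: eqmx_trans _ (red_chain_cons dQ' (chain_full cc')).
  rewrite [chain_mx (Q' :: c')]E (map_mxM _ U); apply/eqmx_sym/eqmxMfull.
  by rewrite row_full_unit -(unitmx_residue (@residue_unit _ p_pr)).
rewrite -{}QQ' in E cc' *; congr (_ :: _); apply: IHc cc cc' szc uU _.
by apply: (mulmxr_regular_inj (det_digit_lift_neq0 dQ)); rewrite E mulmxA.
Qed.

End Chains.

(** * Symmetric matrices killed by a lattice *)

Section SymmetricCount.
Variables (p : nat) (p_pr : prime p) (n : nat).
Local Notation Zp := (padic_int p_pr).
Local Notation red := (map_mx (@residue p p_pr)).

Definition pdiag (l : 'I_n -> nat) : 'M[Zp]_n := diag_mx (\row_i p%:R ^+ l i).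

Lemma pdiagM l l' : pdiag l *m pdiag l' = pdiag (fun i => l i + l' i)%N.
Proof. by rewrite mulmx_diag; congr diag_mx; apply/rowP=> i; rewrite !mxE exprD. Qed.

Lemma det_pdiag l : \det (pdiag l) = p%:R ^+ (\sum_i l i)%N.
Proof. by rewrite det_diag; under eq_bigr do rewrite mxE; rewrite prodrXr. Qed.

Lemma padic_Smith_form (D : 'M[Zp]_n) : \det D != 0 ->
  exists U V l, [/\ U \in unitmx, V \in unitmx & D = U *m pdiag l *m V].
Proof.
move=> dD; have [L [R [d [uL uR DD]]]] := Smith_form (@padic_dvd_total _ p_pr) D.
have Dd : rect_diag n n d = diag_mx (\row_i d i).
  by apply/matrixP=> i j; rewrite !mxE.
have d0 (i : 'I_n) : d i != 0.
  apply: contraNneq dD => di; rewrite DD !det_mulmx Dd det_diag (bigD1 i) //=.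
  by rewrite mxE di mul0r mulr0 mul0r.
have /choice [q qP] : forall i : 'I_n, exists q : nat * Zp,
    q.2 \is a GRing.unit /\ d i = p%:R ^+ q.1 * q.2.
  by move=> i; have [k [u ?]] := padic_factor (d0 i); exists (k, u).
exists (L *m diag_mx (\row_i (q i).2)), R, (fun i => (q i).1); split=> //.
  rewrite unitmx_mul uL unitmxE det_diag; apply/rpred_prod => i _.
  by rewrite mxE; case: (qP i).
rewrite DD Dd -(mulmxA L (diag_mx _) (pdiag _)); congr (L *m _ *m R); rewrite mulmx_diag.
by congr diag_mx; apply/rowP=> i; rewrite !mxE (qP i).2 mulrC.
Qed.

Lemma card_pairs (Z : {set 'I_n}) :
  (\sum_(k : 'I_n * 'I_n | (k.1 <= k.2)%N) (k.1 \in Z) * (k.2 \in Z))%N = 'C(#|Z|.+1, 2).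
Proof.
set S := LHS; have sumZ : (\sum_(i < n) (i \in Z) = #|Z|)%N.
  by rewrite -sum1_card big_mkcond [RHS]big_mkcond; apply: eq_bigr => i _; case: (i \in Z).
have S2 : (S + S = #|Z| * #|Z| + #|Z|)%N.
  have Dtot : (\sum_(k : 'I_n * 'I_n) (k.1 \in Z) * (k.2 \in Z) = #|Z| * #|Z|)%N.
    rewrite -(pair_bigA _ (fun i j => (i \in Z) * (j \in Z))%N) /=.
    by under eq_bigr do rewrite -big_distrr sumZ; rewrite -big_distrl sumZ.
  have Ddiag : (\sum_(k : 'I_n * 'I_n | k.1 == k.2) (k.1 \in Z) * (k.2 \in Z) = #|Z|)%N.
    rewrite -(pair_big_dep xpredT (fun i j => i == j) (fun i j => (i \in Z) * (j \in Z))%N) /=.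
    rewrite -sumZ; apply: eq_bigr => i _; rewrite (big_pred1 i) => [|j]; last by rewrite eq_sym.
    by case: (i \in Z).
  have DS' : S = (\sum_(k : 'I_n * 'I_n | (k.2 <= k.1)%N) (k.1 \in Z) * (k.2 \in Z))%N.
    have swap_inj : injective (fun k : 'I_n * 'I_n => (k.2, k.1)) by move=> [i j] [k m] [-> ->].
    rewrite /S (reindex_inj swap_inj) /=.
    by apply: eq_bigr => k _; rewrite mulnC.
  rewrite -Dtot (bigID (fun k : 'I_n * 'I_n => k.1 <= k.2)%N) /= -/S -addnA; congr (_ + _)%N.
  rewrite {1}DS' -Ddiag (bigID (fun k : 'I_n * 'I_n => k.1 == k.2)) /= addnC; congr (_ + _)%N.
    by apply: eq_bigl => -[i j] /=; rewrite -ltnNge ltn_neqAle andbC eq_sym.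
  apply: eq_bigl => -[i j] /=; have [->|] := eqVneq i j; first by rewrite leqnn.
  by rewrite andbF.
have -> : 'C(#|Z|.+1, 2) = (S + S)./2 by rewrite bin2 /= S2 mulSn addnC.
by rewrite addnn doubleK.
Qed.

Lemma elementary_divisor_le (C D U V : 'M[Zp]_n) a l : U \in unitmx -> V \in unitmx ->
  C *m D = (p%:R ^+ a)%:M -> D = U *m pdiag l *m V -> forall i, (l i <= a)%N.
Proof.
move=> uU uV CD DD i; have E : V *m C *m U *m pdiag l = (p%:R ^+ a)%:M.
  apply: (can_inj (mulmxK uV)); rewrite -!mulmxA (mulmxA U) -DD CD.
  by rewrite mul_mx_scalar mul_scalar_mx.
have /matrixP/(_ i i) := E; rewrite mul_mx_diag !mxE eqxx mulr1n.
set x := (X in X * _); rewrite leqNgt => Dx; apply/negP => lt_al.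
move: Dx; rewrite -(subnK (ltnW lt_al)) exprD mulrA -[RHS]mul1r.
move/(mulIf (pexpr_neq0 p_pr a)) => x1.
have : (p%:R ^+ (l i - a) : Zp) \is a GRing.unit by apply/unitrPr; exists x; rewrite mulrC.
by rewrite pexpr_unit subn_eq0 leqNgt lt_al.
Qed.

(** In a basis of [L + p Z^n] the nonzero exponents of the elementary divisors of
    [L] are lowered by one; their number is the size of the first set of the
    chain. *)
Lemma sum_min_elementary_divisors I c (U V : 'M[Zp]_n) l : chain I c ->
    U \in unitmx -> V \in unitmx -> chain_mx p_pr c = U *m pdiag l *m V ->
  (\sum_(k : 'I_n * 'I_n | (k.1 <= k.2)%N) minn (l k.1) (l k.2)
   = \sum_(Q <- c) 'C(#|digit_set Q|.+1, 2))%N.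
Proof.
elim: c I U V l => [|Q c IHc] I U V l.
  move=> cc uU uV E; have l0 i : l i = 0%N.
    apply/eqP; rewrite -leqn0; apply: (elementary_divisor_le uU uV (C := 1%:M)) E _.
    by rewrite mulmx1 expr0.
  by rewrite big_nil big1 // => k _; rewrite !l0.
move=> cQc uU uV E; have /= /and3P[dQ _ cc] := cQc.
have dE := det_digit_lift_neq0 p_pr dQ; have EsE := codigit_liftK p_pr dQ.
pose l1 i := (0 < l i)%N : nat; pose l' i := (l i).-1.
have Dl : pdiag l = pdiag l' *m pdiag l1.
  rewrite pdiagM; congr diag_mx; apply/rowP=> i; rewrite !mxE /l' /l1.
  by case: (l i) => //= k; rewrite addn1.
have Dp : pdiag (fun i => 1 - l1 i)%N *m pdiag l1 = p%:R%:M.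
  rewrite pdiagM; apply/matrixP=> i j; rewrite !mxE /l1.
  by case: (l i) => //= k; rewrite ?subn1 ?expr1.
set E1 := digit_lift p_pr Q in dE EsE.
(* [E1] and [pdiag l1 *m V] are two bases of [L + p Z^n]: [G] and [H] express
   each one in the other. *)
have [X [Y DE]] : exists X Y, E1 = X *m chain_mx p_pr (Q :: c) - p%:R *: Y.
  have /submxP[X DX] : (1%:M - Q <= red (chain_mx p_pr (Q :: c)))%MS.
    by rewrite (red_chain_cons dQ (chain_full p_pr cc)).
  have [Y DY] : exists Y,
      map_mx (@lift_Z p p_pr _) X *m chain_mx p_pr (Q :: c) - E1 = p%:R *: Y.
    by apply: mx_residue_eq0; rewrite map_mxB map_mxM mx_residueK red_digit_lift -DX subrr.
  by exists (map_mx (@lift_Z p p_pr _) X), Y; rewrite -DY opprB addrC subrK.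
pose G := X *m U *m pdiag l' - Y *m invmx V *m pdiag (fun i => 1 - l1 i)%N.
have EG : E1 = G *m (pdiag l1 *m V).
  have e1 : pdiag l' *m (pdiag l1 *m V) = pdiag l *m V by rewrite mulmxA -Dl.
  have e2 : pdiag (fun i => 1 - l1 i)%N *m (pdiag l1 *m V) = p%:R *: V.
    by rewrite mulmxA Dp mul_scalar_mx.
  rewrite mulmxBl -!mulmxA e1 e2 -!scalemxAr mulVmx // mulmx1 (mulmxA U) -E.
  exact: DE.
pose A : 'M[Zp]_n := diag_mx (\row_i (l i == 0)%N%:R).
pose B : 'M[Zp]_n := diag_mx (\row_i (l i != 0)%N%:R).
have DAB : pdiag l1 = A *m pdiag l + p%:R *: B.
  apply/matrixP=> i j; rewrite mul_diag_mx !mxE /l1.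
  case: (l i) => [|k] /=; first by rewrite mul1r mul0rn mulr0 addr0.
  by rewrite mul0r add0r mulrnAr mulr1 expr1.
pose H := A *m invmx U *m chain_mx p_pr c + B *m V *m codigit_lift p_pr Q.
have HE : pdiag l1 *m V = H *m E1.
  rewrite DAB mulmxDl -scalemxAl mulmxDl; congr (_ + _); last first.
    by rewrite -!mulmxA EsE mul_mx_scalar -scalemxAr.
  by rewrite -!mulmxA -[chain_mx _ c *m _]/(chain_mx p_pr (Q :: c)) E -!mulmxA mulKmx.
have GH : G *m H = 1%:M.
  by apply: (mulmxr_regular_inj dE); rewrite -mulmxA -HE -EG mul1mx.
have [_ uH] := mulmx1_unit GH.
have D2 : chain_mx p_pr c = U *m pdiag l' *m H.
  apply: (mulmxr_regular_inj dE); rewrite -[LHS]/(chain_mx p_pr (Q :: c)) E Dl.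
  by rewrite -!mulmxA HE.
have cardJ : #|digit_set Q| = #|[set i | (0 < l i)%N]|.
  have := congr1 determinant HE; rewrite !det_mulmx det_pdiag det_digit_lift // mulrC.
  have -> : (\sum_i l1 i)%N = #|[set i | (0 < l i)%N]|.
    rewrite -sum1_card [RHS]big_mkcond; apply: eq_bigr => i _.
    by rewrite inE /l1; case: (0 < l i)%N.
  rewrite mulrC [_ * _ ^+ _]mulrC => /pexpr_unit_inj -> //; by rewrite -unitmxE.
rewrite big_cons -(IHc _ _ _ _ cc uU uH D2) cardJ -card_pairs -big_split /=.
apply: eq_bigr => -[i j] _ /=; rewrite !inE /l'.
by case: (l i) => [|a]; case: (l j) => [|b];
  rewrite ?(min0n, minn0, minnSS, mul0n, muln0, muln1, add0n, add1n).
Qed.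

End SymmetricCount.

Section SymmetricAnnihilators.
Variables (p : nat) (p_pr : prime p) (n a : nat).
Local Notation R := 'Z_(p ^ a.+1).
Local Notation red := (map_mx (@reduce p p_pr a)).

Lemma card_Zmod_torsion k : (k <= a)%N ->
  #|[set x : R | x * p%:R ^+ k == 0]| = (p ^ k)%N.
Proof.
move=> le_ka; have q1 : (1 < p ^ a.+1)%N by rewrite Zmod_gt1.
have p0 := prime_gt0 p_pr; pose b := (a.+1 - k)%N.
have Dq : (p ^ a.+1 = p ^ k * p ^ b)%N by rewrite -expnD subnKC // ltnW.
have val_mul (y : 'I_(p ^ k)) : nat_of_ord ((y * p ^ b)%:R : R) = (y * p ^ b)%N.
  by rewrite val_Zp_nat // modn_small // Dq ltn_pmul2r ?expn_gt0 ?p0.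
rewrite -[RHS]card_ord -cardsT.
rewrite -(@card_imset _ _ (fun y : 'I_(p ^ k) => (y * p ^ b)%:R : R)) => [|y y' E]; last first.
  have := congr1 (fun x : R => nat_of_ord x) E; rewrite !val_mul => /eqP.
  by rewrite eqn_pmul2r ?expn_gt0 ?p0 // => /eqP/val_inj.
apply: eq_card => x; rewrite inE; apply/eqP/imsetP => [xk | [y _ ->]]; last first.
  by rewrite -natrX -natrM -mulnA -expnD subnK ?leqW // natrM (Zmod_pexp p_pr a) mulr0.
have : (p ^ b %| x)%N.
  rewrite -(@dvdn_pmul2l (p ^ k)) ?expn_gt0 ?p0 // -Dq mulnC.
  by apply: (@Zmod_faithful p p_pr a); rewrite natrM natr_Zp natrX.
case/dvdnP=> y Dx; have lt_y : (y < p ^ k)%N.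
  rewrite -(@ltn_pmul2r (p ^ b)) ?expn_gt0 ?p0 // -Dq -Dx.
  by apply: leq_trans (ltn_ord x) _; rewrite Zp_cast.
by exists (Ordinal lt_y); rewrite ?inE //= -Dx natr_Zp.
Qed.

(** The symmetric [S] with [S D] integral, modulo integral matrices: [S] is
    recovered as [p ^ - (a + 1) s].  For a lattice [D] containing [p ^ a Z^n],
    [p ^ a S] is already integral. *)
Definition sym_annihilator (D : 'M[padic_int p_pr]_n) : {set 'M[R]_n} :=
  [set s | (s^T == s) && (s *m red D == 0)].

(** The entry [s i j] is killed by [p ^ l j] and, by symmetry, by [p ^ l i]. *)
Lemma card_sym_annihilator_pdiag l : (forall i, l i <= a)%N ->
  #|sym_annihilator (pdiag p_pr l)|
  = (p ^ \sum_(k : 'I_n * 'I_n | (k.1 <= k.2)%N) minn (l k.1) (l k.2))%N.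
Proof.
move=> la; pose T (k : 'I_n * 'I_n) : {set R} := [set x : R |
  if (k.1 <= k.2)%N then x * p%:R ^+ minn (l k.1) (l k.2) == 0 else x == 0].
pose h (f : {ffun 'I_n * 'I_n -> R}) : 'M[R]_n :=
  \matrix_(i, j) if (i <= j)%N then f (i, j) else f (j, i).
have solP s : reflect (s^T = s /\ forall i j, s i j * p%:R ^+ l j = 0)
                      (s \in sym_annihilator (pdiag p_pr l)).
  rewrite inE; have -> : red (pdiag p_pr l) = diag_mx (\row_i p%:R ^+ l i).
    by apply/matrixP=> i j; rewrite !mxE raddfMn /= rmorphXn rmorph_nat.
  rewrite mul_mx_diag; apply: (iffP andP) => -[/eqP sT].
    by move/eqP/matrixP=> E; split=> // i j; have := E i j; rewrite !mxE.
  by move=> E; split=> //; apply/eqP/matrixP=> i j; rewrite !mxE E.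
transitivity #|family (fun k => mem (T k))|; last first.
  rewrite card_family foldrE big_map big_enum /= (big_mkcond (fun k => _ <= _)%N) expn_sum.
  apply: eq_bigr => -[i j] _ /=; case: ifP => ij.
    rewrite -[RHS]card_Zmod_torsion ?geq_min ?la //.
    by apply: eq_card => x; rewrite !inE /= ij.
  by rewrite expn0 -[RHS](cards1 (0 : R)); apply: eq_card => x; rewrite !inE /= ij.
rewrite -(@card_in_imset _ _ h) => [|f g /familyP fT /familyP gT /matrixP fg]; last first.
  apply/ffunP => -[i j]; have := fg i j; rewrite !mxE.
  by case: leqP => // lt_ji _; have := fT (i, j); have := gT (i, j);
     rewrite !inE /= leqNgt lt_ji /= => /eqP -> /eqP ->.
apply: eq_card => s; apply/solP/imsetP => [[sT s0] | [f /familyP fT ->]].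
  exists [ffun k : 'I_n * 'I_n => if (k.1 <= k.2)%N then s k.1 k.2 else 0].
    apply/familyP => -[i j]; rewrite !inE ffunE /=; case: (i <= j)%N => //.
    rewrite /minn; case: ifP => _; last by rewrite s0.
    by rewrite -sT mxE s0.
  apply/matrixP=> i j; rewrite !mxE !ffunE /=; case: leqP => // /ltnW ->.
  by rewrite -[in LHS]sT mxE.
split; first by apply/matrixP=> i j; rewrite !mxE; case: ltngtP => // /val_inj ->.
move=> i j; rewrite mxE; case: leqP => ij; have := fT (_, _) => /(_ _ _); last first.
  move/(_ j i); rewrite !inE /= (ltnW ij) => /eqP E.
  by rewrite -[l j](subnKC (geq_minl (l j) (l i))) exprD mulrA E mul0r.
move/(_ i j); rewrite !inE /= ij => /eqP E.
by rewrite -[l j](subnKC (geq_minr (l i) (l j))) exprD mulrA E mul0r.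
Qed.

Lemma card_sym_annihilator_equiv (U V D : 'M[padic_int p_pr]_n) :
  U \in unitmx -> V \in unitmx ->
  #|sym_annihilator (U *m D *m V)| = #|sym_annihilator D|.
Proof.
move=> uU uV; have uU' : red U \in unitmx by rewrite unitmxE det_map_mx rmorph_unit.
have uV' : red V \in unitmx by rewrite unitmxE det_map_mx rmorph_unit.
rewrite -[RHS](@card_imset _ _ (fun s => (invmx (red U))^T *m s *m invmx (red U))); last first.
  by apply: (can_inj (g := fun s => (red U)^T *m s *m red U)) => s;
     rewrite !mulmxA -trmx_mul mulVmx // trmx1 mul1mx mulmxKV.
apply: eq_card => s; apply/idP/imsetP => [|[t + ->]].
  rewrite inE => /andP[/eqP sT sD]; exists ((red U)^T *m s *m red U); last first.
    by rewrite !mulmxA -trmx_mul mulmxV // trmx1 mul1mx mulmxK.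
  rewrite inE !trmx_mul trmxK sT mulmxA eqxx /=; apply/eqP.
  have sD0 : s *m red U *m red D *m red V = 0.
    by rewrite -!mulmxA -!map_mxM mulmxA (eqP sD).
  by apply: (can_inj (mulmxK uV')); rewrite mul0mx -!(mulmxA (red U)^T) sD0 mulmx0.
rewrite !inE => /andP[/eqP tT /eqP tD]; apply/andP; split.
  by rewrite !trmx_mul trmxK tT mulmxA.
by rewrite !map_mxM !mulmxA mulmxKV // -(mulmxA _ t) tD mulmx0 mul0mx.
Qed.

Lemma card_sym_annihilator_chain I c : chain I c -> (size c <= a)%N ->
  #|sym_annihilator (chain_mx p_pr c)| = (p ^ \sum_(Q <- c) 'C(#|digit_set Q|.+1, 2))%N.
Proof.
move=> cc le_ca; have [U [V [l [uU uV E]]]] := padic_Smith_form (det_chain_neq0 p_pr cc).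
have la := elementary_divisor_le uU uV (cochain_mxK p_pr cc) E.
rewrite -(sum_min_elementary_divisors cc uU uV E) E card_sym_annihilator_equiv //.
by rewrite card_sym_annihilator_pdiag // => i; apply: leq_trans (la i) le_ca.
Qed.

End SymmetricAnnihilators.

(** * The cosets in the Hecke operators *)

Section Cosets.
Variables (p : nat) (p_pr : prime p) (n : nat).
Local Notation Zp := (padic_int p_pr).
Local Notation Qp := (padic_rat p_pr).
Local Notation frac := (@FracField.tofrac Zp).
Implicit Types (M g h : 'M[Zp]_(n + n)).

Lemma toQp_inj m k : injective (@toQp p p_pr m k).
Proof.
move=> A B /matrixP E; apply/matrixP=> i j; have := E i j; rewrite !mxE.
by move/eqP; rewrite tofrac_eq => /eqP.
Qed.

Lemma toQp_J0 : toQp (J0 n Zp) = J0 n Qp.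
Proof. by rewrite /toQp /J0 map_block_mx map_mxN map_mx1 !map_mx0. Qed.

Lemma Gamma_J0 g mu : mu \is a GRing.unit ->
  g *m J0 n Zp *m g^T = mu *: J0 n Zp -> Gamma g.
Proof. by move=> umu gJ; split; [apply: unitmx_J0_form gJ | exists mu]. Qed.

Lemma Gamma_Sp g : g *m J0 n Zp *m g^T = J0 n Zp -> Gamma g.
Proof. by move=> gJ; apply: (@Gamma_J0 g 1); rewrite ?unitr1 ?scale1r. Qed.

Lemma GammaM g h : Gamma g -> Gamma h -> Gamma (g *m h).
Proof.
move=> [_ [mu umu gJ]] [_ [nu unu hJ]].
by apply: (@Gamma_J0 _ (mu * nu)); rewrite ?unitrM ?umu //; apply: J0_formM.
Qed.

Lemma GammaV g : Gamma g -> Gamma (invmx g).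
Proof.
move=> [ug [mu umu gJ]]; apply: (@Gamma_J0 _ mu^-1); first by rewrite unitrV.
apply: (can_inj (mulKmx ug)); apply: (can_inj (mulmxK (_ : g^T \in unitmx))).
  by rewrite unitmx_tr.
rewrite !mulmxA mulmxV // mul1mx -mulmxA -trmx_mul mulmxV // trmx1 mulmx1.
by rewrite -scalemxAr -scalemxAl gJ scalerA mulVr // scale1r.
Qed.

Lemma Gamma1 : Gamma (1%:M : 'M[Zp]_(n + n)).
Proof. by apply: Gamma_Sp; rewrite mul1mx trmx1 mulmx1. Qed.

Lemma gcoset_ofM g M : Gamma g -> gcoset_of (g *m M) = gcoset_of M.
Proof.
move=> Gg; apply/seteqP; split=> _ [h Gh <-].
  by exists (h *m g); rewrite ?mulmxA //; apply: GammaM.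
exists (h *m invmx g); first by apply: GammaM => //; apply: GammaV.
by rewrite mulmxA mulmxKV //; case: Gg.
Qed.

Lemma gcoset_of_eq M M' : gcoset_of M = gcoset_of M' -> exists2 g, Gamma g & M' = g *m M.
Proof.
move=> E; have : gcoset_of M' M' by exists 1%:M; [apply: Gamma1 | rewrite mul1mx].
by rewrite -E => -[g Gg <-]; exists g.
Qed.

(** [M = (A, B; 0, D)] with [A = p ^ delta (D^t)^-1], without denominators. *)
Lemma satake_formP M delta d : satake_form M delta d <-> exists A B D : 'M[Zp]_n,
  [/\ M = block_mx A B 0 D, A *m D^T = (p%:R ^+ delta)%:M,
      forall i j : 'I_n, (j < i)%N -> D i j = 0 & forall i, D i i = p%:R ^+ d i].
Proof.
have detD (D : 'M[Zp]_n) : (forall i j : 'I_n, (j < i)%N -> D i j = 0) ->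
    (forall i, D i i = p%:R ^+ d i) -> toQp D^T \in unitmx.
  move=> D0 D1; rewrite unitmxE det_map_mx unitfE tofrac_eq0.
  rewrite det_trig; last by apply/is_trig_mxP => i j ij; rewrite mxE D0.
  by apply/prodf_neq0 => i _; rewrite mxE D1 pexpr_neq0.
split=> [[B [D [D0 D1 E]]] | [A [B [D [-> AD D0 D1]]]]]; last first.
  exists B, D; split=> //; rewrite /toQp map_block_mx map_mx0; congr block_mx.
  have uD := detD _ D0 D1; apply: (can_inj (mulmxK uD)); rewrite -map_mxM AD map_trmx.
  by rewrite -scalemxAl mulVmx // map_scalar_mx /= rmorphXn rmorph_nat scalemx1.
exists (ulsubmx M), B, D; have uD := detD _ D0 D1; rewrite /toQp -map_trmx in uD.
have EB : ursubmx M = B.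
  by apply: toQp_inj; rewrite /toQp map_ursubmx -/(toQp M) E block_mxKur.
have E0 : dlsubmx M = 0.
  by apply: toQp_inj; rewrite /toQp map_dlsubmx -/(toQp M) E block_mxKdl map_mx0.
have ED : drsubmx M = D.
  by apply: toQp_inj; rewrite /toQp map_drsubmx -/(toQp M) E block_mxKdr.
split=> //; first by rewrite -{1}EB -E0 -ED submxK.
apply: toQp_inj; rewrite /toQp map_mxM map_ulsubmx -/(toQp M) E block_mxKul -map_trmx.
by rewrite -scalemxAl mulVmx // map_scalar_mx /= rmorphXn rmorph_nat scalemx1.
Qed.

(** The diagonal exponents of a triangular basis depend only on the lattice. *)
Lemma upper_triangular_quotient (e D D' : 'M[Zp]_n) (d d' : 'I_n -> nat) :
    (forall i j : 'I_n, (j < i)%N -> D i j = 0) -> (forall i, D i i = p%:R ^+ d i) ->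
    (forall i j : 'I_n, (j < i)%N -> D' i j = 0) -> (forall i, D' i i = p%:R ^+ d' i) ->
  e \in unitmx -> D' = e *m D -> d =1 d'.
Proof.
move=> D0 D1 D'0 D'1 ue De.
have e0 : forall i j : 'I_n, (j < i)%N -> e i j = 0.
  move=> i j; have [k] := ubnP (j : nat); elim: k j => // k IHk j lt_jk lt_ji.
  have := D'0 i j lt_ji; rewrite De mxE (bigD1 j) //= big1 ?addr0 => [|l ne_lj].
    by move/eqP; rewrite D1 mulf_eq0 (negPf (pexpr_neq0 _ _)) orbF => /eqP.
  have [lt_lj|lt_jl|/val_inj lj] := ltngtP l j.
  - by rewrite IHk ?mul0r //; [apply: leq_trans lt_lj _ | apply: ltn_trans lt_ji].
  - by rewrite D0 ?mulr0.
  by rewrite lj eqxx in ne_lj.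
move=> i; have := D'1 i; rewrite De mxE (bigD1 i) //= big1 ?addr0 => [|l ne_li]; last first.
  have [lt_li|lt_il|/val_inj li] := ltngtP l i; last by rewrite li eqxx in ne_li.
    by rewrite e0 ?mul0r.
  by rewrite D0 ?mulr0.
rewrite D1 mulrC -[RHS]mulr1 => /pexpr_unit_inj -> //; rewrite ?unitr1 //.
move: ue; rewrite -unitmx_tr unitmxE det_trig; last first.
  by apply/is_trig_mxP => k l kl; rewrite mxE e0.
by rewrite (bigD1 i) //= unitrM mxE => /andP[].
Qed.

Lemma Gamma_triangular g (A B D A' B' D' : 'M[Zp]_n) delta : Gamma g ->
    A *m D^T = (p%:R ^+ delta)%:M -> g *m block_mx A B 0 D = block_mx A' B' 0 D' ->
  exists a b e, [/\ g = block_mx a b 0 e, a \in unitmx, e \in unitmx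
    & [/\ a *m A = A', a *m B + b *m D = B' & e *m D = D']].
Proof.
move=> [ug _] AD; rewrite -[g]submxK mulmx_block => /eq_block_mx[].
have [dA _] := det_mul_scalar_neq0 (pexpr_neq0 p_pr delta) AD.
rewrite !mulmx0 !addr0 => EA EB /(mulmxr_regular dA) g0; rewrite g0 mul0mx add0r => ED.
exists (ulsubmx g), (ursubmx g), (drsubmx g); rewrite -g0 submxK.
move: ug; rewrite -[g in g \in _]submxK g0 unitmxE det_ublock unitrM => /andP[ua ue].
by split.
Qed.

(** Hence any representative of the prescribed form gives the exponents. *)
Lemma satake_form_inj g M delta d delta' d' : (0 < n)%N -> Gamma g ->
  satake_form M delta d -> satake_form (g *m M) delta' d' -> (delta', d') = (delta, d).
Proof.
move=> n0 Gg /satake_formP[A [B [D [-> AD D0 D1]]]].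
case/satake_formP=> A' [B' [D' [E A'D' D'0 D'1]]].
have [a [b [e [_ ua ue [EA _ ED]]]]] := Gamma_triangular Gg AD E.
congr (_, _); last first.
  by apply/ffunP => i; rewrite (upper_triangular_quotient D0 D1 D'0 D'1 ue (esym ED)).
move: A'D'; rewrite -EA -ED trmx_mul mulmxA -(mulmxA a) AD mul_mx_scalar -scalemxAl.
move/(congr1 determinant); rewrite detZ det_scalar -!exprM -[RHS]mulr1.
move/pexpr_unit_inj; rewrite -unitmxE unitmx_mul unitmx_tr ua ue unitr1 => /(_ isT isT)/eqP.
by rewrite eqn_mul2r gtn_eqF //= => /eqP.
Qed.

End Cosets.

Section Representatives.
Variables (p : nat) (p_pr : prime p) (n a : nat).
Hypothesis n_gt0 : (0 < n)%N.
Local Notation Zp := (padic_int p_pr).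
Local Notation Qp := (padic_rat p_pr).
Local Notation lift := (map_mx (@lift_Z p p_pr _)).
Local Notation red := (map_mx (@reduce p p_pr a)).
Implicit Types (c : seq 'M['F_p]_n) (s : 'M['Z_(p ^ a.+1)]_n).

Definition rep_corner c s : 'M[Zp]_n :=
  map_mx (pdiv_pexp a.+1) (lift s *m chain_mx p_pr c).

(** The pair of a chain [c] with lattice matrix [D] and of [s], a symmetric
    matrix modulo [p ^ (a + 1)] with [s D = 0], stands for the coset of
    [(p ^ a (D^t)^-1, S D; 0, D)] where [S = p ^ - (a + 1) s]. *)
Definition coset_rep c s : 'M[Zp]_(n + n) :=
  block_mx (cochain_mx p_pr c)^T (rep_corner c s) 0 (chain_mx p_pr c).

Definition chain_exponents c : {ffun 'I_n -> nat} :=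
  [ffun i => \sum_(Q <- c) (i \in digit_set Q)]%N.

Definition index_pair c s :=
  [/\ chain [set: 'I_n] c, size c = a & s \in sym_annihilator a (chain_mx p_pr c)].

Lemma rep_cornerK c s : s \in sym_annihilator a (chain_mx p_pr c) ->
  p%:R ^+ a.+1 *: rep_corner c s = lift s *m chain_mx p_pr c.
Proof.
rewrite inE => /andP[_ /eqP sD].
have : red (lift s *m chain_mx p_pr c) = 0 by rewrite map_mxM mx_reduceK.
move=> /matrixP E; apply/matrixP=> i j; rewrite !mxE.
rewrite -(@pred_mod_eq0 _ _ _ _ (Zmod_pexp p_pr a) (@Zmod_faithful _ p_pr a)) //.
by have := E i j; rewrite !mxE.
Qed.

Lemma lift_sym s : s^T = s -> (lift s)^T = lift s.
Proof. by move=> sT; rewrite map_trmx sT. Qed.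

Lemma chain_mx_triangular c I : chain I c ->
  (forall i j : 'I_n, (j < i)%N -> chain_mx p_pr c i j = 0) /\
  (forall i, chain_mx p_pr c i i = p%:R ^+ chain_exponents c i).
Proof.
elim: c I => [|Q c IHc] I /=.
  move=> _; split=> [i j ji|i]; rewrite mxE ?eqxx.
    by rewrite -val_eqE /= gtn_eqF.
  by rewrite ffunE big_nil.
case/and3P=> dQ _ /IHc[c0 c1]; have lQ := lift_digit p_pr dQ; split=> [i j ji|i].
  rewrite mxE big1 // => k _; have [ki|ik] := ltnP k i; first by rewrite c0 ?mul0r.
  by rewrite (digit_mx_above _ lQ) ?mulr0 //; apply: leq_trans ji ik.
rewrite mxE (bigD1 i) //= big1 ?addr0 => [|k ne_ki]; last first.
  have [ki|ik|/val_inj ki] := ltngtP k i; last by rewrite ki eqxx in ne_ki.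
    by rewrite c0 ?mul0r.
  by rewrite (digit_mx_above _ lQ) ?mulr0.
by rewrite c1 (digit_mx_diag _ lQ) -exprD !ffunE big_cons addnC.
Qed.

Lemma coset_rep_DC c s : index_pair c s -> DC (p ^ a) (coset_rep c s).
Proof.
case=> cc sza sP; have DC := chain_mxK p_pr cc; have CD := cochain_mxK p_pr cc.
have MJ : coset_rep c s *m J0 n Zp *m (coset_rep c s)^T = (p%:R ^+ a) *: J0 n Zp.
  rewrite block_J0_form scale_J0 !(trmx0, mulmx0, mul0mx) sub0r !subr0 trmxK.
  have -> : (cochain_mx p_pr c)^T *m (chain_mx p_pr c)^T = (p%:R ^+ a)%:M.
    by rewrite -trmx_mul DC tr_scalar_mx sza.
  rewrite DC sza; congr block_mx.
  apply: (@pexp_scale_inj _ p_pr _ _ a.+1); rewrite scaler0 scalerBr.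
  rewrite scalemxAr scalemxAl -linearZ /= rep_cornerK // -mulmxA DC.
  rewrite trmx_mul lift_sym; last by move: sP; rewrite inE => /andP[/eqP].
  by rewrite mulmxA -trmx_mul DC tr_scalar_mx mul_mx_scalar mul_scalar_mx subrr.
split; last by rewrite MJ natrX.
have MJQ : toQp (coset_rep c s) *m J0 n Qp *m (toQp (coset_rep c s))^T = p%:R ^+ a *: J0 n Qp.
  have := congr1 (@toQp _ p_pr _ _) MJ.
  by rewrite /toQp !map_mxM map_mxZ -map_trmx -!/(toQp _) toQp_J0 /= rmorphXn rmorph_nat.
have pu : (p%:R ^+ a : Qp) \is a GRing.unit.
  rewrite unitfE expf_neq0 // -(rmorph_nat (@FracField.tofrac Zp)) tofrac_eq0.
  exact: pnatr_neq0.
by split; [apply: unitmx_J0_form pu MJQ | exists (p%:R ^+ a)].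
Qed.

Lemma coset_rep_form c s : index_pair c s ->
  satake_form (coset_rep c s) a (chain_exponents c).
Proof.
case=> cc sza _; have [c0 c1] := chain_mx_triangular cc; apply/satake_formP.
exists (cochain_mx p_pr c)^T, (rep_corner c s), (chain_mx p_pr c); split=> //.
by rewrite -trmx_mul (chain_mxK p_pr cc) tr_scalar_mx sza.
Qed.

Lemma coset_rep_exponents c s : index_pair c s ->
  satake_exponents (gcoset_of (coset_rep c s)) = (a, chain_exponents c).
Proof.
move=> cs; rewrite /satake_exponents; case: xgetP => [[delta d] _ /= [_ [g Gg <-]]|].
  exact: (satake_form_inj n_gt0 Gg (coset_rep_form cs)).
move/(_ (a, chain_exponents c)) => [] /=; exists (coset_rep c s); last exact: coset_rep_form.
by exists 1%:M; rewrite ?mul1mx //; apply: Gamma1.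
Qed.

(** A matrix of [Gamma] that carries one representative to another is block
    triangular: its diagonal blocks fix the lattice, and its upper right block
    changes [S] by an integral matrix. *)
Lemma coset_rep_inj c s c' s' : index_pair c s -> index_pair c' s' ->
  gcoset_of (coset_rep c s) = gcoset_of (coset_rep c' s') -> (c, s) = (c', s').
Proof.
move=> [cc sza sP] [cc' sza' sP'] /gcoset_of_eq[g Gg] /esym E.
have CD : (cochain_mx p_pr c)^T *m (chain_mx p_pr c)^T = (p%:R ^+ size c)%:M.
  by rewrite -trmx_mul (chain_mxK p_pr cc) tr_scalar_mx.
have [u [b [e [_ uu ue [EA EB ED]]]]] := Gamma_triangular Gg CD E.
have szc : size c = size c' by rewrite sza sza'.
have Dc := chain_inj cc cc' szc ue (esym ED).
rewrite -{}Dc {cc' sza' E szc ED} in sP' EA EB *; congr (_, _).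
have u1 : u = 1%:M.
  have [dC _] := det_mul_scalar_neq0 (pexpr_neq0 p_pr _) CD.
  by apply: (mulmxr_regular_inj dC); rewrite EA mul1mx.
rewrite u1 mul1mx in EB.
have dD := det_chain_neq0 p_pr cc.
have Ds : lift s + p%:R ^+ a.+1 *: b = lift s'.
  apply: (mulmxr_regular_inj dD); rewrite mulmxDl -!rep_cornerK // -scalemxAl.
  by rewrite -scalerDr EB.
have := congr1 (fun A => red A) Ds; rewrite map_mxD !mx_reduceK map_mxZ /=.
have -> : @reduce p p_pr a (p%:R ^+ a.+1) = 0 := pred_mod_pexp p_pr (Zmod_pexp p_pr a).
by rewrite scale0r addr0.
Qed.

(** Elements of [Gamma] normalise in turn the multiplier, the lower left block,
    the basis of the lattice, and the symmetric matrix. *)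
Lemma coset_rep_exists g M : DC (p ^ a) g -> dcoset_of g M ->
  exists c s, index_pair c s /\ gcoset_of M = gcoset_of (coset_rep c s).
Proof.
move=> [_ gJ] [h1 [h2 [[_ [mu umu h1J]] [_ [nu unu h2J]] DM]]].
pose m : Zp := p%:R ^+ a; have m0 : m != 0 := pexpr_neq0 p_pr a.
have {gJ h1J h2J} MJ : M *m J0 n Zp *m M^T = (mu * nu * m) *: J0 n Zp.
  by rewrite DM mulrAC /m -natrX; do 2?apply: J0_formM.
pose u := mu * nu; have uu : u \is a GRing.unit by rewrite unitrM umu.
pose g1 : 'M[Zp]_(n + n) := block_mx u^-1%:M 0 0 1%:M.
have g1J : g1 *m J0 n Zp *m g1^T = u^-1 *: J0 n Zp.
  rewrite block_J0_form scale_J0 !(trmx0, trmx1, mulmx0, mul0mx, mulmx1, mul1mx).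
  by rewrite !subr0 sub0r tr_scalar_mx.
have Gg1 : Gamma g1 by apply: Gamma_J0 g1J; rewrite unitrV.
have M1J : (g1 *m M) *m J0 n Zp *m (g1 *m M)^T = m *: J0 n Zp.
  by have := J0_formM g1J MJ; rewrite mulrA mulVr // mul1r.
have [g2 [g2J M2_0]] := symplectic_triangular (@padic_dvd_total _ p_pr)
  (@residue_unit _ p_pr) m0 M1J.
have Gg2 : Gamma g2 := Gamma_Sp g2J.
have M2J : (g2 *m (g1 *m M)) *m J0 n Zp *m (g2 *m (g1 *m M))^T = m *: J0 n Zp.
  by rewrite -[m]mul1r; apply: J0_formM; rewrite ?scale1r.
pose A := ulsubmx (g2 *m (g1 *m M)); pose B := ursubmx (g2 *m (g1 *m M)).
pose D := drsubmx (g2 *m (g1 *m M)).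
have DM2 : g2 *m (g1 *m M) = block_mx A B 0 D by rewrite -M2_0 submxK.
have [ABsym ADt] : A *m B^T = B *m A^T /\ A *m D^T = m%:M.
  move: M2J; rewrite DM2 block_J0_form scale_J0 => /eq_block_mx[/subr0_eq ? E _ _].
  by rewrite trmx0 mulmx0 subr0 in E.
have AtD : A^T *m D = m%:M.
  by apply: mulmx_scalarC => //; rewrite -[D]trmxK -trmx_mul ADt tr_scalar_mx.
have [|c [U [sza cc uU DU]]] := chain_exists (I := [set: 'I_n]) AtD.
  rewrite (_ : coordmx _ _ = 1%:M) ?addsmxSr //.
  by apply/matrixP=> i j; rewrite !mxE finset.in_setT.
have CD := cochain_mxK p_pr cc; have DC := chain_mxK p_pr cc.
have dD := det_chain_neq0 p_pr cc.
have UtA : U^T *m A = (cochain_mx p_pr c)^T.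
  apply: trmx_inj; rewrite trmx_mul !trmxK; apply: (mulmxr_regular_inj dD).
  by rewrite -mulmxA -DU AtD CD sza.
pose g3 : 'M[Zp]_(n + n) := block_mx U^T 0 0 (invmx U).
have Gg3 : Gamma g3.
  apply: Gamma_Sp; rewrite block_J0_form !(trmx0, mulmx0, mul0mx, subr0, sub0r).
  by rewrite -trmx_mul mulVmx // trmx1 trmxK mulVmx // oppr0.
pose B3 := U^T *m B.
have DM3 : g3 *m (g2 *m (g1 *m M)) = block_mx (cochain_mx p_pr c)^T B3 0 (chain_mx p_pr c).
  by rewrite DM2 mulmx_block !(mul0mx, mulmx0, addr0, add0r) UtA DU mulKmx.
pose S := B3 *m cochain_mx p_pr c.
have symS : S^T = S.
  have DC0 : cochain_mx p_pr c = A^T *m U by rewrite -[LHS]trmxK -UtA trmx_mul trmxK.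
  by rewrite /S /B3 DC0 !trmx_mul !trmxK !mulmxA -(mulmxA _ A) ABsym !mulmxA.
pose s := red (p%:R *: S).
have Ds : red (lift s - p%:R *: S) = 0 by rewrite map_mxB mx_reduceK subrr.
have [b Db] := mx_reduce_eq0 Ds.
have sP : s \in sym_annihilator a (chain_mx p_pr c).
  rewrite inE map_trmx linearZ /= symS eqxx /= -map_mxM -scalemxAl -mulmxA CD.
  rewrite mul_mx_scalar scalerA -exprS sza map_mxZ /=.
  have -> : @reduce p p_pr a (p%:R ^+ a.+1) = 0 := pred_mod_pexp p_pr (Zmod_pexp p_pr a).
  by rewrite scale0r.
have sT : s^T = s by move: sP; rewrite inE => /andP[/eqP].
have symb : b^T = b.
  apply: (@pexp_scale_inj _ p_pr _ _ a.+1); rewrite -linearZ -Db linearB /=.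
  by rewrite lift_sym // linearZ /= symS.
have DB : rep_corner c s = B3 + b *m chain_mx p_pr c.
  apply: (@pexp_scale_inj _ p_pr _ _ a.+1); rewrite rep_cornerK // scalerDr.
  rewrite scalemxAl -Db mulmxBl addrC -scalemxAl /S -mulmxA CD mul_mx_scalar sza.
  by rewrite scalerA -exprS subrK.
exists c, s; split=> //.
have -> : coset_rep c s = block_mx 1%:M b 0 1%:M *m (g3 *m (g2 *m (g1 *m M))).
  by rewrite DM3 mulmx_block !(mul0mx, mulmx0, mul1mx, addr0, add0r) /coset_rep DB.
by rewrite !gcoset_ofM //; apply: Gamma_Sp; apply: upper_unipotent_J0.
Qed.

End Representatives.

(** * The image of the Hecke operators as a sum over chains *)

Lemma fsum_fibers (I T U : choiceType) (V : nmodType) (r : seq I) (h : I -> T) (k : I -> U)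
    (f : U -> V) (A : set T) (B : T -> set U) :
    uniq r -> {in r &, injective k} ->
    (forall S, A S <-> exists2 x, x \in r & h x = S) ->
    (forall S L, A S -> (B S L <-> exists2 x, x \in r & h x = S /\ k x = L)) ->
  \sum_(S \in A) \sum_(L \in B S) f L = \sum_(x <- r) f (k x).
Proof.
move=> ur kI AE BE; rewrite (fsbigE (undup (map h r))) ?undup_uniq //; last 2 first.
- by move=> S /=; rewrite mem_undup => /mapP[x xr ->]; apply/AE; exists x.
- by move=> S /AE[x xr <-]; rewrite mem_undup map_f.
transitivity (\sum_(S <- undup (map h r)) \sum_(x <- r | h x == S) f (k x)).
  rewrite big_seq_cond [RHS]big_seq_cond; apply: eq_big => [S|S].
    rewrite andbT; apply/andb_idr; rewrite mem_undup => /mapP[x xr ->].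
    by apply/mem_set/AE; exists x.
  case/andP=> _ /set_mem AS.
  transitivity (\sum_(L <- map k [seq x <- r | h x == S]) f L); last first.
    by rewrite big_map big_filter.
  rewrite [RHS]fsbig_seq; last first.
    rewrite map_inj_in_uniq ?filter_uniq // => x y.
    by rewrite !mem_filter => /andP[_ xr] /andP[_ yr]; apply: kI.
  apply: eq_fsbigl; apply/seteqP; split=> L /=.
    case/(BE _ _ AS) => x xr [hx <-]; apply: map_f.
    by rewrite mem_filter hx eqxx.
  case/mapP=> x; rewrite mem_filter => /andP[/eqP hx xr] ->.
  by apply/(BE _ _ AS); exists x.
rewrite (exchange_big_dep xpredT) //= big_seq [RHS]big_seq; apply: eq_bigr => x xr.
rewrite -big_filter (_ : [seq _ <- _ | _] = [:: h x]) ?big_seq1 //.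
apply/perm_small_eq => //; apply: uniq_perm; rewrite ?filter_uniq ?undup_uniq // => S.
rewrite mem_filter mem_undup inE [S == _]eq_sym; apply/andb_idr => /eqP <-.
exact: map_f.
Qed.

Section OmegaSum.
Variables (p : nat) (p_pr : prime p) (n : nat) (C : fieldType).
Hypothesis n_gt0 : (0 < n)%N.
Local Notation Zp := (padic_int p_pr).

Definition digits (I : {set 'I_n}) : seq 'M['F_p]_n :=
  enum [set Q : 'M['F_p]_n | digit Q && compatible I Q].

Fixpoint chains (I : {set 'I_n}) (a : nat) : seq (seq 'M['F_p]_n) :=
  if a is a'.+1 then [seq Q :: c | Q <- digits I, c <- chains (digit_set Q) a']
  else [:: [::]].

Lemma mem_chains I a c : (c \in chains I a) = chain I c && (size c == a).
Proof.
elim: a I c => [|a IHa] I c /=.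
  by rewrite inE; case: c => //= Q c; rewrite andbF.
apply/allpairsPdep/andP => [[Q [c' [QI + ->]]] | [cc]].
  rewrite IHa => /andP[cc' sz]; move: QI; rewrite mem_enum inE => /andP[dQ cQ].
  by rewrite /= dQ cQ.
case: c cc => // Q c /= /and3P[dQ cQ cc]; rewrite eqSS => sz.
by exists Q, c; rewrite mem_enum inE dQ cQ IHa cc.
Qed.

Lemma chains_uniq I a : uniq (chains I a).
Proof.
elim: a I => //= a IHa I; apply: allpairs_uniq_dep => [|Q _|]; first exact: enum_uniq.
  exact: IHa.
by move=> [Q c] [Q' c'] _ _ /= [-> ->].
Qed.

Section FixedLevel.
Variable a : nat.
Local Notation pair := (seq 'M['F_p]_n * 'M['Z_(p ^ a.+1)]_n)%type.
Implicit Types x : pair.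

Definition index_pairs : seq pair :=
  [seq (c, s) | c <- chains [set: 'I_n] a,
                s <- enum (sym_annihilator a (chain_mx p_pr c))].

Lemma mem_index_pairs x : reflect (index_pair p_pr x.1 x.2) (x \in index_pairs).
Proof.
apply: (iffP allpairsPdep) => [[c [s [+ + ->]]] | [cc sz sP]].
  by rewrite mem_chains mem_enum => /andP[cc /eqP sz] sP; split.
by exists x.1, x.2; rewrite mem_chains cc sz eqxx mem_enum; case: (x) sP.
Qed.

Lemma index_pairs_uniq : uniq index_pairs.
Proof.
apply: allpairs_uniq_dep => [|c _|]; [exact: chains_uniq|exact: enum_uniq|].
by move=> [c s] [c' s'] _ _ /= [-> ->].
Qed.

Let rep x := coset_rep p_pr x.1 x.2.

Let dcoset_self (M : 'M[Zp]_(n + n)) : dcoset_of M M.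
Proof. by exists 1%:M, 1%:M; rewrite mul1mx mulmx1; split=> //; apply: Gamma1. Qed.

Let dcoset_sub (M M' : 'M[Zp]_(n + n)) : dcoset_of M M' -> (dcoset_of M' `<=` dcoset_of M)%classic.
Proof.
move=> [g [h [Gg Gh ->]]] _ [g' [h' [Gg' Gh' ->]]].
by exists (g' *m g), (h *m h'); rewrite !mulmxA; split=> //; apply: GammaM.
Qed.

Let dcoset_eq (M M' : 'M[Zp]_(n + n)) : dcoset_of M M' -> dcoset_of M' = dcoset_of M.
Proof.
move=> MM'; apply/seteqP; split; apply: dcoset_sub => //.
case: MM' => g [h [Gg Gh ->]]; exists (invmx g), (invmx h); split; try exact: GammaV.
by rewrite -!mulmxA mulmxV ?(mulmx1, mulmxA) ?mulVmx ?mul1mx //; case: Gg; case: Gh.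
Qed.

Let gcoset_dcoset (M M' : 'M[Zp]_(n + n)) : gcoset_of M = gcoset_of M' -> dcoset_of M M'.
Proof.
case/gcoset_of_eq=> g Gg ->; exists g, 1%:M; rewrite mulmx1; split=> //.
exact: Gamma1.
Qed.

(** Each coset lies in exactly one of the double cosets of the operator, so its
    image is a plain sum over cosets, of a term independent of [s]. *)
Lemma Omega_TC : Omega (n := n) (p_pr := p_pr) (TC C (p ^ a)) =
  \sum_(c <- chains [set: 'I_n] a)
     satake_monomial p C (a, chain_exponents c) *+ #|sym_annihilator a (chain_mx p_pr c)|.
Proof.
pose A := [set dcoset_of g | g in DC (n := n) (p_pr := p_pr) (p ^ a)]%classic.
pose B (S : set 'M[Zp]_(n + n)) := [set gcoset_of M | M in S]%classic.
transitivity (\sum_(S \in A) \sum_(L \in B S) satake_monomial p C (satake_exponents L)).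
  rewrite /Omega -(@fsbig_widen _ _ _ _ A).
  - by apply: eq_fsbigr => S SA; rewrite /TC SA scale1r.
  - by move=> _ [g [Gg _] <-]; exists g.
  move=> S [_ /asboolPn SA]; rewrite /= /TC (_ : (S \in _) = false) ?scale0r //.
  by apply/asboolPn/asboolPn.
have DCrep x : x \in index_pairs -> DC (p ^ a) (rep x).
  by move/mem_index_pairs/coset_rep_DC.
have exrep g M : DC (p ^ a) g -> dcoset_of g M ->
    exists2 x, x \in index_pairs & gcoset_of M = gcoset_of (rep x).
  by move=> Dg /(coset_rep_exists Dg)[c [s [cs E]]]; exists (c, s) => //; apply/mem_index_pairs.
rewrite (@fsum_fibers _ _ _ _ index_pairs (fun x => dcoset_of (rep x))
  (fun x => gcoset_of (rep x))); first 1 last.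
- exact: index_pairs_uniq.
- move=> [c s] [c' s'] /mem_index_pairs cs /mem_index_pairs cs'.
  exact: coset_rep_inj cs cs'.
- move=> S; split=> [[g Dg <-] | [x /DCrep Dx <-]]; last by exists (rep x).
  have [x xI E] := exrep g g Dg (dcoset_self g); exists x => //.
  exact/dcoset_eq/gcoset_dcoset.
- move=> S L [g Dg <-]; split=> [[M gM <-] | [x xI [<- <-]]].
    have [x xI E] := exrep g M Dg gM; exists x => //; split=> //.
    by rewrite (dcoset_eq (gcoset_dcoset E)) (dcoset_eq gM).
  by exists (rep x) => //; apply: dcoset_self.
rewrite /index_pairs big_allpairs_dep big_seq [RHS]big_seq; apply: eq_bigr => c cP.
rewrite -sumr_const -[RHS]big_enum big_seq [RHS]big_seq; apply: eq_bigr => s sP.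
rewrite coset_rep_exponents //; apply/(mem_index_pairs (c, s)).
by apply/allpairsPdep; exists c, s.
Qed.

End FixedLevel.

Lemma chain_exponents_monomial a (c : seq 'M['F_p]_n) : size c = a ->
  satake_monomial p C (a, chain_exponents c) =
  \prod_(Q <- c) ('X_ord0 * \prod_(j in digit_set Q) ((p%:R ^- j.+1 : C) *: 'X_(lift ord0 j))).
Proof.
move=> <-; rewrite /satake_monomial /= big_split /= big_const_seq count_predT iter_mulr_1.
congr (_ * _); elim: c => [|Q c IHc].
  by rewrite big_nil big1 // => j _; rewrite ffunE big_nil expr0.
rewrite big_cons -IHc [X in X * _]big_mkcond -big_split /=; apply: eq_bigr => j _.
by rewrite !ffunE big_cons exprD; case: (j \in _).
Qed.

End OmegaSum.

(** * Power series attached to sequences of polynomials *)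

Section SeriesMorphisms.
Variables (K : comNzRingType) (n : nat).

Lemma fps_of_mpolyM (P Q : {mpoly K[n]}) :
  fps_of_mpoly (P * Q) = fps_of_mpoly P * fps_of_mpoly Q.
Proof. by apply: fps_ext => m; rewrite /= mcoeffM. Qed.

Lemma fps_of_mpoly_inj : injective (@fps_of_mpoly K n).
Proof. by move=> P Q E; apply/mpolyP => m; have := congr1 (fun f => fcoef f m) E. Qed.

Fact fps_of_mpoly_is_zmod_morphism : zmod_morphism (@fps_of_mpoly K n).
Proof. by move=> P Q; apply: fps_ext => m; rewrite /= mcoeffB. Qed.

Fact fps_of_mpoly_is_monoid_morphism : monoid_morphism (@fps_of_mpoly K n).
Proof. by split=> // P Q; apply: fps_of_mpolyM. Qed.

HB.instance Definition _ := GRing.isZmodMorphism.Build {mpoly K[n]} (fps K n)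
  (@fps_of_mpoly K n) fps_of_mpoly_is_zmod_morphism.
HB.instance Definition _ := GRing.isMonoidMorphism.Build {mpoly K[n]} (fps K n)
  (@fps_of_mpoly K n) fps_of_mpoly_is_monoid_morphism.

Definition fps_cst (c : K) : fps K n := fps_of_mpoly c%:MP.

HB.instance Definition _ := GRing.RMorphism.copy fps_cst (@fps_of_mpoly K n \o @mpolyC n K).

Lemma fcoefD (f g : fps K n) m : fcoef (f + g) m = fcoef f m + fcoef g m.
Proof. by []. Qed.

Lemma fcoefB (f g : fps K n) m : fcoef (f - g) m = fcoef f m - fcoef g m.
Proof. by []. Qed.

Lemma fcoef0 m : fcoef (0 : fps K n) m = 0.
Proof. by rewrite /= mcoeff0. Qed.

Lemma fcoef1 m : fcoef (1 : fps K n) m = (m == 0%MM)%:R.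
Proof. by rewrite /= mcoeff1. Qed.

Lemma fcoef_sum I (r : seq I) (P : pred I) (F : I -> fps K n) m :
  fcoef (\sum_(i <- r | P i) F i) m = \sum_(i <- r | P i) fcoef (F i) m.
Proof. by apply: (big_morph (fun f => fcoef f m)) => //; apply: fcoef0. Qed.

Lemma fcoef_mulE b (P Q : {mpoly K[n]}) (f g : fps K n) m :
    (forall k, (mdeg k < b)%N -> fcoef f k = P@_k) ->
    (forall k, (mdeg k < b)%N -> fcoef g k = Q@_k) ->
  (mdeg m < b)%N -> fcoef (f * g) m = (P * Q)@_m.
Proof.
move=> fP gQ mb; rewrite -[f * g]/(fps_mul f g) (fps_mulE f g mb).
by apply: mcoeffM_agree mb => k kb; rewrite fps_truncE ?fP ?gQ.
Qed.

Lemma fcoef_cstM c (f : fps K n) m : fcoef (fps_cst c * f) m = c * fcoef f m.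
Proof.
rewrite (@fcoef_mulE (mdeg m).+1 c%:MP (fps_trunc (mdeg m).+1 f)) // => [|k kb].
  by rewrite mcoeffCM fps_truncE.
by rewrite fps_truncE.
Qed.

Lemma mcoeff_varM (P : {mpoly K[n]}) i m :
  ('X_i * P)@_m = if (0 < m i)%N then P@_(m - U_(i))%MM else 0.
Proof.
case: ltnP => mi.
  have {1}-> : m = (U_(i) + (m - U_(i)))%MM by rewrite addmC submK // lep1mP -lt0n.
  by rewrite mulrC mcoeffMX.
rewrite mcoeffM big1 // => k /eqP Dm; rewrite mcoeffX; case: eqP => [Dk|]; last by rewrite mul0r.
by have := congr1 (fun m : 'X_{1..n} => m i) Dm; rewrite /= mnmDE -Dk mnm1E eqxx; lia.
Qed.

Lemma fcoef_varM (f : fps K n) i m :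
  fcoef (fps_var K i * f) m = if (0 < m i)%N then fcoef f (m - U_(i))%MM else 0.
Proof.
rewrite (@fcoef_mulE (mdeg m).+1 'X_i (fps_trunc (mdeg m).+1 f)) // => [|k kb].
  by rewrite mcoeff_varM; case: ifP => // _; rewrite fps_truncE // ltnS mdegB.
by rewrite fps_truncE.
Qed.

End SeriesMorphisms.

Section MapSeries.
Variables (K L : comNzRingType) (u : {rmorphism K -> L}) (n : nat).

Fact fps_map_is_zmod_morphism : zmod_morphism (@fps_map K L u n).
Proof. by move=> f g; apply: fps_ext => m; rewrite /= rmorphB. Qed.

Fact fps_map_is_monoid_morphism : monoid_morphism (@fps_map K L u n).
Proof.
split=> [|f g]; apply: fps_ext => m; first by rewrite /= !mcoeff1 rmorph_nat.
by rewrite /= rmorph_sum; apply: eq_bigr => k _; rewrite rmorphM.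
Qed.

HB.instance Definition _ := GRing.isZmodMorphism.Build (fps K n) (fps L n)
  (@fps_map K L u n) fps_map_is_zmod_morphism.
HB.instance Definition _ := GRing.isMonoidMorphism.Build (fps K n) (fps L n)
  (@fps_map K L u n) fps_map_is_monoid_morphism.

Lemma fps_map_var i : fps_map u (fps_var K i) = fps_var L i :> fps L n.
Proof. by apply: fps_ext => m; rewrite /= !mcoeffX rmorph_nat. Qed.

End MapSeries.

Section SequenceSeries.
Variables (C : comNzRingType) (n : nat).
Implicit Types G : nat -> {mpoly C[n.+1]}.

Definition xpart (m : 'X_{1..n.+2}) : 'X_{1..n.+1} := [multinom m (x_idx i) | i < n.+1].

(** The series [\sum_a G a X^a]; the variables of [G a] are [x_0, ..., x_n]. *)
Definition series G : fps C n.+2 := FPS (fun m => (G (m (X_idx n)))@_(xpart m)).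

Lemma x_idx_neq_X i : x_idx i != X_idx n.
Proof. by rewrite -val_eqE /= ltn_eqF. Qed.

Lemma seriesXM G : Xvar C n * series G = series (fun a => if a is a'.+1 then G a' else 0).
Proof.
apply: fps_ext => m; rewrite fcoef_varM /=.
case Da: (m (X_idx n)) => [|a] /=; first by rewrite mcoeff0.
rewrite mnmBE Da mnm1E eqxx subn1 /=; congr (_@__); apply/mnmP => i.
by rewrite !mnmE eq_sym (negPf (x_idx_neq_X i)) subn0.
Qed.

Lemma series_xM i G : xvar C i * series G = series (fun a => 'X_i * G a).
Proof.
have xpartE m : xpart m i = m (x_idx i) by rewrite mnmE.
apply: fps_ext => m; rewrite fcoef_varM /= mcoeff_varM xpartE; case: ifP => // _.
rewrite mnmBE mnm1E (negPf (x_idx_neq_X i)) subn0; congr (_@__); apply/mnmP => j.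
by rewrite !mnmE; congr (_ - _)%N; rewrite -!val_eqE.
Qed.

Lemma series_cstM c G : fps_cst n.+2 c * series G = series (fun a => c *: G a).
Proof. by apply: fps_ext => m; rewrite fcoef_cstM /= mcoeffZ. Qed.

Lemma series_sum I (r : seq I) (P : pred I) (G : I -> nat -> {mpoly C[n.+1]}) :
  \sum_(i <- r | P i) series (G i) = series (fun a => \sum_(i <- r | P i) G i a).
Proof. by apply: fps_ext => m; rewrite fcoef_sum /= raddf_sum. Qed.

Lemma series_prod_xM I (r : seq I) (P : pred I) (F : I -> 'I_n.+1) G :
  (\prod_(i <- r | P i) xvar C (F i)) * series G
  = series (fun a => (\prod_(i <- r | P i) 'X_(F i)) * G a).
Proof.
elim: r => [|i r IHr].
  by rewrite !big_nil mul1r; apply: fps_ext => m; rewrite /= mul1r.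
rewrite !big_cons; case: ifP => // Pi; rewrite -mulrA IHr series_xM.
by apply: fps_ext => m; rewrite /= mulrA.
Qed.

Lemma series_delta : series (fun a => (a == 0)%N%:R) = 1.
Proof.
apply: fps_ext => m; rewrite fcoef1 /= mcoeffMn mcoeff1 -mulrnA; congr (_%:R).
have -> : (m == 0%MM) = (m (X_idx n) == 0)%N && (xpart m == 0%MM).
  apply/eqP/andP => [->|[/eqP mX /eqP/mnmP mx]].
    by split; [rewrite mnmE | apply/eqP/mnmP => i; rewrite !mnmE].
  apply/mnmP => i; rewrite mnmE; case: (unliftP ord_max i) => [j ->|-> //].
  have := mx j; rewrite !mnmE => <-; congr (m _); apply: val_inj => /=.
  by rewrite /bump leqNgt ltn_ord.
by rewrite mulnb andbC.
Qed.

(** The monomial [x_0 X \prod_(j in J) x_j], where the coordinate [j] of the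
    lattices goes with the variable of index [j + 1]. *)
Definition flag_var (J : {set 'I_n}) : fps C n.+2 :=
  xvar C ord0 * Xvar C n * \prod_(j in J) xvar C (lift ord0 j).

Lemma flag_var_series J G : flag_var J * series G = series (fun a =>
  if a is a'.+1 then 'X_ord0 * \prod_(j in J) 'X_(lift ord0 j) * G a' else 0).
Proof.
rewrite /flag_var -!mulrA series_prod_xM seriesXM series_xM.
by apply: fps_ext => m /=; case: (m _) => [|a]; rewrite ?mulr0 ?mulrA.
Qed.

End SequenceSeries.

(** * The linear system satisfied by the generating series *)

Section TransferSystem.
Variables (K : comNzRingType) (n : nat).
Implicit Types I J : {set 'I_n}.

Definition proper_flag J := (J != finset.set0) && (J != [set: 'I_n]).

(** The equations of the path sums [F I] from [I], over the paths through nonempty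
    proper subsets, by separation of the first step. *)
Definition transfer_system (c : {set 'I_n} -> {set 'I_n} -> K) (F : {set 'I_n} -> fps K n.+2) :=
  forall I, F I = 1 + \sum_(J | proper_flag J) fps_cst n.+2 (c I J) * (flag_var K J * F J).

End TransferSystem.

(** The proportion, with [t] in place of the residue cardinality, of the points of
    the Schubert cell of [J] that are transversal to the coordinate subspace of
    [I].  Indeed, the power of [t] that counts symmetric matrices and those of the
    Satake normalization multiply to the inverse of the cardinality of the cell. *)
Definition transfer_coef (C : fieldType) n (t : C) (I J : {set 'I_n}) : C :=
  (\prod_(j in J) (t ^+ #|before j J| - (j \notin I)%:R * t ^+ #|before j I|))
  * (t ^+ 'C(#|J|.+1, 2) * \prod_(j in J) t ^- j.+1).

Section LatticeSum.
Variables (p : nat) (p_pr : prime p) (n : nat) (C : numFieldType).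
Hypothesis n_gt0 : (0 < n)%N.
Implicit Types (I J : {set 'I_n}).
Local Notation coef := (transfer_coef (p%:R : C)).

(** The contribution of the chains of length [a] starting from [I]; a step through
    [J] carries its share of the number of symmetric matrices. *)
Definition lattice_sum I a : {mpoly C[n.+1]} :=
  \sum_(c <- chains p I a) \prod_(Q <- c)
    ((p ^ 'C(#|digit_set Q|.+1, 2))%:R *:
     ('X_ord0 * \prod_(j in digit_set Q) ((p%:R ^- j.+1 : C) *: 'X_(lift ord0 j)))).

Lemma Omega_lattice_sum a :
  Omega (n := n) (p_pr := p_pr) (TC C (p ^ a)) = lattice_sum [set: 'I_n] a.
Proof.
rewrite Omega_TC // /lattice_sum big_seq [RHS]big_seq; apply: eq_bigr => c.
rewrite mem_chains => /andP[cc /eqP sz].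
rewrite (card_sym_annihilator_chain p_pr cc) ?sz // (chain_exponents_monomial _ sz).
rewrite expn_sum -scaler_nat natr_prod.
elim: c {cc sz} => [|Q c IHc]; first by rewrite !big_nil scale1r.
by rewrite !big_cons -IHc -scalerAl -scalerAr !scalerA mulrC.
Qed.

Lemma card_cell I J :
  (#|[set Q : 'M['F_p]_n | [&& digit Q, digit_set Q == J & compatible I Q]]|%:R : C)
  = \prod_(j in J) (p%:R ^+ #|before j J| - (j \notin I)%:R * p%:R ^+ #|before j I|).
Proof.
have := congr1 (fun k : int => k%:~R : C) (@card_compatible_digits 'F_p n I J).
rewrite -pmulrn => ->; rewrite rmorph_prod /=; apply: eq_bigr => j _.
by rewrite intrB intrM -!pmulrn !natrX card_Fp.
Qed.

Lemma lattice_sumS I a : lattice_sum I a.+1 =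
  \sum_J coef I J *: ('X_ord0 * \prod_(j in J) 'X_(lift ord0 j) * lattice_sum J a).
Proof.
rewrite /lattice_sum /= big_allpairs_dep /=.
under eq_bigr => Q _ do (under eq_bigr do rewrite big_cons; rewrite -mulr_sumr).
rewrite -/(lattice_sum _ _) big_enum /= (partition_big (@digit_set n _) xpredT) //=.
apply: eq_bigr => J _.
rewrite (eq_bigr (fun _ => ((p ^ 'C(#|J|.+1, 2))%:R * \prod_(j in J) p%:R ^- j.+1) *:
    ('X_ord0 * \prod_(j in J) 'X_(lift ord0 j) * lattice_sum J a))) => [|Q /andP[_ /eqP ->]].
  rewrite sumr_const -scaler_nat scalerA /transfer_coef -card_cell natrX.
  congr ((_%:R * _) *: _); apply: eq_card => Q.
  by rewrite -[LHS]topredE /= !inE -andbA [compatible _ _ && _]andbC.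
by rewrite scaler_prod -scalerAr -!scalerAl scalerA.
Qed.

Lemma transfer_coef0 I : coef I finset.set0 = 1.
Proof. by rewrite /transfer_coef !big_pred0 => [|j|j]; rewrite ?inE // cards0 expr0 !mul1r. Qed.

Let p0 : (p%:R : C) != 0.
Proof. by rewrite pnatr_eq0 -lt0n prime_gt0. Qed.

(** Only the whole space, whose set is empty, is transversal to the zero subspace:
    otherwise the first element of [J] gives a zero factor. *)
Lemma transfer_coef0l J : coef finset.set0 J = (J == finset.set0)%:R.
Proof.
have [->|/set0Pn[j0 j0J]] := eqVneq; first exact: transfer_coef0.
have [j jJ minj] := @arg_minnP _ j0 (mem J) (@nat_of_ord n) j0J.
rewrite /transfer_coef (bigD1 j) //= inE mul1r.
have -> : before j J = before j finset.set0.
  apply/setP => i; rewrite !inE andbT; apply/andb_idr => lt_ij.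
  by apply: contraL lt_ij => /minj; rewrite -leqNgt.
by rewrite subrr !mul0r.
Qed.

(** The cell of the full set is the zero subspace, transversal to the whole space
    only: otherwise the first element outside [I] gives a zero factor. *)
Lemma transfer_coefT I : I != [set: 'I_n] -> coef I [set: 'I_n] = 0.
Proof.
rewrite -properT => /properP[_ [j0 _ j0I]].
have [j jI minj] := @arg_minnP _ j0 (fun j => j \notin I) (@nat_of_ord n) j0I.
rewrite /transfer_coef (bigD1 j) ?inE //= jI mul1r.
have -> : before j I = before j [set: 'I_n].
  apply/setP => i; rewrite !inE andbF; apply/andP => -[lt_ij /minj].
  by rewrite leqNgt lt_ij.
by rewrite subrr !mul0r.
Qed.

Lemma transfer_coefTT : coef [set: 'I_n] [set: 'I_n] = 1.
Proof.
rewrite /transfer_coef big1 => [|j _]; last first.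
  rewrite inE mul0r subr0 (_ : before j _ = finset.set0) ?cards0 ?expr0 //.
  by apply/setP => i; rewrite !inE andbF.
rewrite mul1r cardsT card_ord -bin2_sum big_mkord big_ord_recl add0n -prodrXr.
rewrite (eq_bigl _ _ (fun j => finset.in_setT j)) -big_split /= big1 // => j _.
by rewrite /bump add1n mulfV // expf_neq0.
Qed.

Lemma flag_var0 : flag_var C finset.set0 = xvar C ord0 * Xvar C n.
Proof. by rewrite /flag_var big_set0 mulr1. Qed.

Lemma flag_varT : flag_var C [set: 'I_n] = (\prod_(i < n.+1) xvar C i) * Xvar C n.
Proof.
rewrite big_ord_recl /flag_var mulrAC; congr (_ * _ * _).
by apply: eq_bigl => j; rewrite inE.
Qed.

Lemma series_lattice_sum I : series (lattice_sum I) = 1 +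
  \sum_J fps_cst n.+2 (coef I J) * (flag_var C J * series (lattice_sum J)).
Proof.
under eq_bigr do rewrite flag_var_series series_cstM.
rewrite series_sum -series_delta; apply: fps_ext => m /=; rewrite -mcoeffD; congr (_@__).
case: (m _) => [|a] /=; last by rewrite add0r lattice_sumS.
by rewrite big1 ?addr0 => [|J _]; rewrite ?scaler0 // /lattice_sum /= big_seq1 big_nil.
Qed.

(** Removing the factors [1 - x_0 X] and [1 - x_0 x_1 ... x_n X] from the
    generating series amounts to discarding the empty and the full sets. *)
Theorem Rpr_transfer_system : exists F : {set 'I_n} -> fps C n.+2,
  transfer_system coef F /\ F [set: 'I_n] = Rpr n p_pr C.
Proof.
pose z := flag_var C (finset.set0 : {set 'I_n}); pose y := flag_var C [set: 'I_n].
pose R I := series (lattice_sum I).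
have RE : Rpr n p_pr C = (1 - z) * (1 - y) * R [set: 'I_n].
  rewrite /Rpr /z /y flag_var0 flag_varT; congr (_ * _).
  by apply: fps_ext => m /=; rewrite Omega_lattice_sum.
have R0 : (1 - z) * R finset.set0 = 1.
  rewrite mulrBl mul1r {1}/R series_lattice_sum (bigD1 finset.set0) //= big1 => [|J J0].
    by rewrite transfer_coef0 rmorph1 mul1r addr0 addrK.
  by rewrite transfer_coef0l (negPf J0) rmorph0 mul0r.
have nz : finset.set0 != [set: 'I_n].
  by apply/eqP/setP => /(_ (Ordinal n_gt0)); rewrite !inE.
have step I : (1 - z) * R I =
    1 + fps_cst n.+2 (coef I [set: 'I_n]) * (y * ((1 - z) * R [set: 'I_n]))
    + \sum_(J | proper_flag J) fps_cst n.+2 (coef I J) * (flag_var C J * ((1 - z) * R J)).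
  rewrite {1}/R series_lattice_sum mulrDr mulr1 mulr_sumr.
  under eq_bigr do rewrite mulrCA (mulrCA (1 - z)).
  rewrite (bigD1 finset.set0) //= -/(R _) R0 transfer_coef0 rmorph1 mul1r mulr1 -/z.
  rewrite (bigD1 [set: 'I_n]) /=; last by rewrite eq_sym.
  by rewrite addrA subrK addrA; congr (_ + _); apply: eq_bigl => J; rewrite /proper_flag.
exists (fun I => if I == [set: 'I_n] then Rpr n p_pr C else (1 - z) * R I).
rewrite eqxx; split=> // I.
under eq_bigr => J JP do rewrite (negPf (proj2 (andP JP))).
have [->|IT] := eqVneq I [set: 'I_n].
  rewrite RE [_ * (1 - y)]mulrC -mulrA mulrBl mul1r {1}step transfer_coefTT rmorph1 mul1r.
  by rewrite addrAC addrK.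
by rewrite step transfer_coefT // rmorph0 mul0r addr0.
Qed.

End LatticeSum.

(** * Rationality in the prime *)

Section Rationality.
Variables (C : fieldType) (n : nat).
Local Notation A := {mpoly {poly C}[n.+2]}.
Implicit Types I J : {set 'I_n}.

Definition flag_monomial (K : comNzRingType) J : {mpoly K[n.+2]} :=
  'X_(x_idx ord0) * 'X_(X_idx n) * \prod_(j in J) 'X_(x_idx (lift ord0 j)).

Lemma fps_flag_monomial (K : comNzRingType) J :
  fps_of_mpoly (flag_monomial K J) = flag_var K J.
Proof. by rewrite /flag_monomial !rmorphM rmorph_prod. Qed.

HB.instance Definition _ (a : C) := GRing.RMorphism.copy (@specialize C n a)
  (map_mpoly (horner_eval a)).

Lemma specializeM (a : C) (P Q : A) : specialize a (P * Q) = specialize a P * specialize a Q.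
Proof. exact: rmorphM. Qed.

Lemma specialize_var (a : C) i : specialize a 'X_i = 'X_i :> {mpoly C[n.+2]}.
Proof. exact: map_mpolyX. Qed.

Lemma specialize_flag_monomial (a : C) J : specialize a (flag_monomial _ J) = flag_monomial C J.
Proof.
rewrite /flag_monomial !rmorphM /= !specialize_var rmorph_prod /=.
by congr (_ * _); apply: eq_bigr => j _; rewrite specialize_var.
Qed.

Lemma specializeC (a : C) (c : {poly C}) : specialize a c%:MP_[n.+2] = (c.[a])%:MP.
Proof. exact: map_mpolyC. Qed.

(** Multiplication by this power of [t] makes the transfer coefficients polynomial. *)
Definition clearing_exponent := (\sum_(j < n) j.+1)%N.

Definition transfer_poly I J : {poly C} :=
  (\prod_(j in J) ('X^#|before j J| - (j \notin I)%:R * 'X^#|before j I|))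
  * 'X^('C(#|J|.+1, 2) + (clearing_exponent - \sum_(j in J) j.+1)).

Lemma transfer_polyE (t : C) I J : t != 0 ->
  (transfer_poly I J).[t] = t ^+ clearing_exponent * transfer_coef t I J.
Proof.
move=> t0; rewrite hornerM hornerXn horner_prod /transfer_coef mulrCA.
congr (_ * _).
  by apply: eq_bigr => j _; rewrite hornerD hornerN hornerM !hornerXn -[_%:R]polyC_natr hornerC.
have le_sum : (\sum_(j in J) j.+1 <= clearing_exponent)%N.
  by rewrite /clearing_exponent [X in (_ <= X)%N](bigID (mem J)) leq_addr.
rewrite exprD mulrCA; congr (_ * _).
have -> : \prod_(j in J) t ^- j.+1 = t ^- (\sum_(j in J) j.+1)%N by rewrite prodfV prodrXr.
by rewrite expfB_cond //= (negPf t0) add0n.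
Qed.

Definition transfer_mx : 'M[A]_#|{: {set 'I_n}}| :=
  ('X^clearing_exponent)%:MP%:M - \matrix_(i, j)
    (if proper_flag (enum_val j) then
       (transfer_poly (enum_val i) (enum_val j))%:MP * flag_monomial _ (enum_val j)
     else 0).

Definition transfer_rhs : 'cV[A]_#|{: {set 'I_n}}| := const_mx ('X^clearing_exponent)%:MP.

Definition transfer_fun : ratfun C n :=
  FracField.tofrac ((\adj transfer_mx *m transfer_rhs) (enum_rank [set: 'I_n]) 0)
  / FracField.tofrac (\det transfer_mx).

Lemma transfer_det_neq0 (a : C) : a != 0 -> specialize a (\det transfer_mx) != 0.
Proof.
move=> a0; apply: contraNneq (expf_neq0 (clearing_exponent * #|{: {set 'I_n}}|) a0) => det0.
rewrite exprM -det_scalar; have /eqP := congr1 (mcoeff 0%MM) det0; rewrite mcoeff0.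
rewrite -!det_map_mx (_ : map_mx _ _ = (a ^+ clearing_exponent)%:M) //.
apply/matrixP=> i j; rewrite !mxE rmorphB /= rmorphMn /= specializeC hornerXn.
rewrite mcoeffB mcoeffMn mcoeffC eqxx mulr1.
rewrite [X in _ - X](_ : _ = 0) ?subr0 //; case: ifP => _; last by rewrite rmorph0 mcoeff0.
rewrite rmorphM /= specialize_flag_monomial /flag_monomial -mulrA mulrCA.
by rewrite mcoeff_varM mnmE.
Qed.

(** Cramer's rule; the determinant is invertible as a rational function, because
    its constant term is a power of [t]. *)
Lemma transfer_fun_specializes (a : C) (F : {set 'I_n} -> fps C n.+2) : a != 0 ->
  transfer_system (transfer_coef a) F -> specializes_to transfer_fun a (F [set: 'I_n]).
Proof.
move=> a0 sysF.
pose ev : {rmorphism A -> fps C n.+2} := (@fps_of_mpoly C n.+2) \o (@specialize C n a).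
exists ((\adj transfer_mx *m transfer_rhs) (enum_rank [set: 'I_n]) 0), (\det transfer_mx).
split=> //; first exact: transfer_det_neq0.
pose Fc : 'cV_#|{: {set 'I_n}}| := \col_i F (enum_val i).
have evM : map_mx ev transfer_mx *m Fc = map_mx ev transfer_rhs.
  rewrite /transfer_mx map_mxB mulmxBl map_scalar_mx mul_scalar_mx; apply/colP=> i.
  rewrite !mxE /= specializeC hornerXn -/(fps_cst n.+2 _).
  apply: (canLR (addrK _)); rewrite {1}(sysF (enum_val i)) mulrDr mulr1; congr (_ + _).
  rewrite mulr_sumr big_mkcond (reindex (fun k : 'I_#|{: {set 'I_n}}| => enum_val k)) /=;
      last first.
    by apply: onW_bij; apply: enum_val_bij.
  apply: eq_bigr => j _; rewrite !mxE; case: ifP => _; last by rewrite /= !rmorph0 mul0r.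
  rewrite /= specializeM specializeC specialize_flag_monomial.
  rewrite fps_of_mpolyM fps_flag_monomial -/(fps_cst n.+2 _) transfer_polyE //.
  by rewrite (rmorphM (@fps_cst C n.+2) (a ^+ _)) -[RHS]mulrA -[RHS]mulrA.
rewrite -[X in X * _]/(ev _) -[RHS]/(ev _) -det_map_mx.
have : \adj (map_mx ev transfer_mx) *m (map_mx ev transfer_mx *m Fc)
     = map_mx ev (\adj transfer_mx *m transfer_rhs).
  by rewrite evM -map_mx_adj -map_mxM.
rewrite mulmxA mul_adj_mx mul_scalar_mx => /matrixP/(_ (enum_rank [set: 'I_n]) 0).
by rewrite !mxE enum_rankK.
Qed.

End Rationality.

Lemma poly_eq0_primes (C : numFieldType) (q : {poly C}) :
  (forall p, prime p -> q.[p%:R] = 0) -> q = 0.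
Proof.
move=> q0; apply/eqP/idPn => nz.
have [s [us sz ps]] : exists s : seq nat, [/\ uniq s, size s = size q & all prime s].
  elim: (size q) => [|k [s [us sz ps]]]; first by exists [::].
  have [p lt_p p_pr] := prime_above (\max_(i <- s) i).
  exists (p :: s); rewrite /= us sz ps p_pr andbT; split=> //.
  apply: contraL lt_p => ps'; rewrite -leqNgt.
  by rewrite (big_rem p) //= leq_maxl.
have := max_poly_roots nz (rs := [seq k%:R | k <- s]).
rewrite size_map sz ltnn => H; suff: false by []; apply: H.
  by apply/allP => _ /mapP[k ks ->]; apply/rootP/q0/(allP ps).
by rewrite map_inj_uniq // => k l /eqP; rewrite eqr_nat => /eqP.
Qed.

(** The numerator of the difference of two functions that agree at every prime
    has coefficients in [t] with infinitely many roots. *)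
Lemma represents_Rpr_uniq (C : numFieldType) n (W W' : ratfun C n) :
  represents_Rpr W -> represents_Rpr W' -> W = W'.
Proof.
move=> WP WP'; have nz (a : C) (Q : {mpoly {poly C}[n.+2]}) : specialize a Q != 0 -> Q != 0.
  by apply: contraNneq => ->; rewrite rmorph0.
have [A [B [DW B0 _]]] := WP 2 isT; have [A' [B' [DW' B'0 _]]] := WP' 2 isT.
move/nz in B0; move/nz in B'0.
have fracP (P Q P' Q' : {mpoly {poly C}[n.+2]}) : Q != 0 -> Q' != 0 ->
    (FracField.tofrac P / FracField.tofrac Q == FracField.tofrac P' / FracField.tofrac Q')
    = (P * Q' == P' * Q).
  by move=> Q0 Q'0; rewrite eqr_div ?tofrac_eq0 // -!tofracM tofrac_eq.
suff N0 : A * B' - A' * B = 0 by apply/eqP; rewrite DW DW' fracP // -subr_eq0 N0.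
apply/mpolyP => m; rewrite mcoeff0; apply: poly_eq0_primes => p p_pr.
have [P [Q [DP Q0 QP]]] := WP p p_pr; have [P' [Q' [DP' Q'0 QP']]] := WP' p p_pr.
have E : A * Q = P * B by apply/eqP; rewrite -fracP ?(nz _ _ Q0) // -DW DP.
have E' : A' * Q' = P' * B' by apply/eqP; rewrite -fracP ?(nz _ _ Q'0) // -DW' DP'.
have EP : specialize p%:R P * specialize p%:R Q' = specialize p%:R P' * specialize p%:R Q.
  by apply: fps_of_mpoly_inj; rewrite !rmorphM /= -QP -QP'; ring.
have : specialize p%:R ((A * B' - A' * B) * (Q * Q')) = 0.
  have -> : (A * B' - A' * B) * (Q * Q') = B * B' * (P * Q' - P' * Q).
    transitivity ((A * Q) * (B' * Q') - (A' * Q') * (B * Q)); first by ring.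
    by rewrite E E'; ring.
  by rewrite rmorphM rmorphB !rmorphM /= EP subrr mulr0.
rewrite !rmorphM /= => /eqP; rewrite !mulf_eq0 (negPf Q0) (negPf Q'0) !orbF => /eqP S0.
have := congr1 (mcoeff m) S0; rewrite mcoeff0.
by rewrite /specialize mcoeff_map_mpoly.
Qed.

(** * Sums over chains of subsets *)

Section ChainSums.
Variables (n : nat) (R : comUnitRingType) (y : yvertex n -> R).
Hypothesis unit_y : forall J, 1 - y J \is a GRing.unit.
Local Notation D := (sd (bd_simplex n)).
Implicit Types (s : {set yvertex n}) (J K : yvertex n).

Definition chain_sum (P : pred (yvertex n)) : R :=
  \sum_(s in D | [forall K in s, P K]) \prod_(J in s) (y J / (1 - y J)).

Lemma sd_faceP s : reflect
  (forall J K, J \in s -> K \in s -> (val J \subset val K) || (val K \subset val J))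
  (s \in faces D).
Proof.
rewrite inE; apply: (iffP forall_inP) => [sD J K /sD/forall_inP + Ks | sD J Js]; first exact.
by apply/forall_inP => K; apply: sD.
Qed.

Definition is_top J s := (J \in s) && [forall K in s, val K \subset val J].

(** Removing the largest element [J] of a chain. *)
Lemma sum_top J :
  \sum_(s in D | is_top J s) \prod_(K in s) (y K / (1 - y K))
  = y J / (1 - y J) * chain_sum (fun K => val K \proper val J).
Proof.
rewrite mulr_sumr (reindex_onto (fun s => J |: s) (fun s => s :\ J)) /=; last first.
  by move=> s /andP[_ /andP[Js _]]; apply: finset.setD1K.
have JP s : [forall K in s, val K \proper val J] -> J \notin s.
  by move=> /forall_inP sP; apply/negP => /sP; rewrite fintype.properxx.
apply: eq_big => s; last by case/andP=> _ /eqP <-; rewrite big_setU1 //= finset.setD11.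
apply/andP/andP => [[/andP[/sd_faceP sD /andP[_ /forall_inP sJ]] /eqP eqs] | [/sd_faceP sD sP]].
  have Js : J \notin s by rewrite -eqs finset.setD11.
  split; first by apply/sd_faceP => K L Ks Ls; apply: sD; rewrite inE ?Ks ?Ls orbT.
  apply/forall_inP => K Ks; rewrite finset.properEneq sJ ?inE ?Ks ?orbT // andbT.
  by apply: contraNneq Js => /val_inj <-.
have Js := JP s sP; split; last by rewrite finset.setU1K.
move/forall_inP in sP; apply/andP; split; last first.
  rewrite /is_top finset.setU11; apply/forall_inP => K; rewrite !inE => /predU1P[->//|/sP].
  exact: fintype.proper_sub.
apply/sd_faceP => K L; rewrite !inE => /predU1P[->|Ks] /predU1P[->|Ls].
- by rewrite fintype.subxx.
- by rewrite (fintype.proper_sub (sP _ Ls)) orbT.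
- by rewrite (fintype.proper_sub (sP _ Ks)).
exact: sD.
Qed.

(** Adding the chains without and with [J] multiplies by
    [1 + y J / (1 - y J) = 1 / (1 - y J)]. *)
Lemma chain_sum_below J :
  y J * chain_sum (fun K => val K \subset val J)
  = y J / (1 - y J) * chain_sum (fun K => val K \proper val J).
Proof.
have -> : chain_sum (fun K => val K \subset val J)
    = y J / (1 - y J) * chain_sum (fun K => val K \proper val J)
      + chain_sum (fun K => val K \proper val J).
  rewrite -sum_top /chain_sum (bigID (fun s => J \in s)) /=; congr (_ + _).
    by apply: eq_bigl => s; rewrite /is_top -andbA [_ && (J \in s)]andbC.
  apply: eq_bigl => s; rewrite -andbA; congr (_ && _).
  apply/andP/forall_inP => [[/forall_inP sJ Js] K Ks | sP].
    rewrite finset.properEneq sJ // andbT; apply: contraNneq Js => /val_inj <-.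
    exact: Ks.
  split; first by apply/forall_inP => K /sP/fintype.proper_sub.
  by apply/negP => /sP; rewrite fintype.properxx.
rewrite -[X in _ + X]mul1r -mulrDl mulrA; congr (_ * _).
apply: (mulIr (unit_y J)).
by rewrite -mulrA mulrDl divrK // mul1r addrC subrK mulr1.
Qed.

(** The nonempty chains are sorted by their largest elements. *)
Lemma chain_sumE (P : pred (yvertex n)) : (forall J K, val K \subset val J -> P J -> P K) ->
  chain_sum P = 1 + \sum_(J | P J) y J * chain_sum (fun K => val K \subset val J).
Proof.
move=> Pdown; under eq_bigr do rewrite chain_sum_below -sum_top.
rewrite (exchange_big_dep (fun s => s \in faces D)) /=; last by move=> J s _ /andP[].
have D0 : finset.set0 \in faces D := faces0 _.
rewrite /chain_sum big_mkcondr /= (bigD1 _ D0) [X in _ = _ + X](bigD1 _ D0) /=.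
rewrite ifT; last by apply/forall_inP => K; rewrite inE.
rewrite big_set0 [X in _ + (X + _)]big_pred0 ?add0r => [|J]; last first.
  by rewrite /is_top finset.in_set0 /= !andbF.
congr (_ + _); apply: eq_bigr => s /andP[sD /set0Pn[J0 J0s]].
case: (@arg_maxnP _ J0 (mem s) (fun J => #|val J|) J0s) => J Js maxJ.
have topJ : is_top J s.
  apply/andP; split=> //; apply/forall_inP => K Ks; have /orP[|JK] // := sd_faceP _ sD _ _ Ks Js.
  by have /eqP <- : val J == val K by rewrite eqEcard JK; apply: maxJ.
have uniqJ K : is_top K s = (K == J).
  apply/idP/eqP => [/andP[Ks /forall_inP Kmax]|->//].
  apply/val_inj/eqP; rewrite finset.eqEsubset Kmax // andbT.
  by have /andP[_ /forall_inP] := topJ; apply.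
rewrite [RHS](eq_bigl (fun K => (K == J) && P K)) => [|K]; last first.
  by rewrite uniqJ (_ : s \in _) ?andTb 1?andbC.
rewrite big_mkcondr big_pred1_eq; congr (if _ then _ else _).
apply/forall_inP/idP => [/(_ J Js) //|PJ K Ks]; apply: Pdown PJ.
by have /andP[_ /forall_inP] := topJ; apply.
Qed.

End ChainSums.

(** * The Hilbert series of the Stanley-Reisner ring *)

Section TruncatedSeries.
Variables (K : comNzRingType) (n : nat).
Implicit Types f g : fps K n.

Definition eq_upto b f g := forall m, (mdeg m < b)%N -> fcoef f m = fcoef g m.

Lemma eq_uptoM b f f' g g' : eq_upto b f f' -> eq_upto b g g' -> eq_upto b (f * g) (f' * g').
Proof.
move=> ff gg m mb.
by rewrite !(@fcoef_mulE K n b (fps_trunc b f') (fps_trunc b g')) // => k kb;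
  rewrite fps_truncE // ?ff ?gg.
Qed.

Lemma eq_upto_sum b I (r : seq I) (P : pred I) (F G : I -> fps K n) :
  (forall i, P i -> eq_upto b (F i) (G i)) ->
  eq_upto b (\sum_(i <- r | P i) F i) (\sum_(i <- r | P i) G i).
Proof. by move=> FG m mb; rewrite !fcoef_sum; apply: eq_bigr => i Pi; apply: FG. Qed.

Lemma eq_upto_prod b I (r : seq I) (P : pred I) (F G : I -> fps K n) :
  (forall i, P i -> eq_upto b (F i) (G i)) ->
  eq_upto b (\prod_(i <- r | P i) F i) (\prod_(i <- r | P i) G i).
Proof. by move=> FG; apply: big_ind2 => [//|*|//]; apply: eq_uptoM. Qed.

Lemma order_mul b c f g : eq_upto b f 0 -> eq_upto c g 0 -> eq_upto (b + c) (f * g) 0.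
Proof.
move=> f0 g0 m mbc; rewrite fcoef0; apply: big1 => k /eqP Dm.
have [kb|bk] := ltnP (mdeg k.1) b; first by rewrite f0 // fcoef0 mul0r.
rewrite g0 ?fcoef0 ?mulr0 //; have := congr1 mdeg Dm; rewrite mdegD => Em.
by rewrite -(ltn_add2l b); apply: leq_ltn_trans mbc;
  apply: leq_trans (eq_leq (esym Em)); rewrite leq_add2r.
Qed.

Lemma order_exp k f : eq_upto 1 f 0 -> eq_upto k (f ^+ k) 0.
Proof. by move=> f0; elim: k => [|k IHk] //; rewrite exprS; apply: (order_mul f0 IHk). Qed.

(** The inverse is the geometric series, each coefficient of which is a finite sum. *)
Lemma unit_1sub f : eq_upto 1 f 0 -> 1 - f \is a GRing.unit.
Proof.
move=> f0; apply/unitrPr.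
exists (FPS (fun m => \sum_(k < (mdeg m).+1) fcoef (f ^+ k) m)).
apply: fps_ext => m; pose b := (mdeg m).+1.
rewrite (@eq_uptoM b (1 - f) (1 - f) _ (\sum_(k < b) f ^+ k)) //; last first.
  move=> k kb; rewrite fcoef_sum /= -(subnK kb).
  rewrite addnC big_split_ord /= [X in _ + X]big1 ?addr0 // => i _.
  by rewrite order_exp ?fcoef0 //= addSn ltnS leq_addr.
by rewrite -opprB mulNr -subrX1 opprB fcoefB (order_exp f0) // fcoef0 subr0.
Qed.

Lemma geometric_upto b f : eq_upto 1 f 0 ->
  eq_upto b.+1 (f / (1 - f)) (\sum_(k < b) f ^+ k.+1).
Proof.
move=> f0; have uf := unit_1sub f0.
have -> : f / (1 - f) = \sum_(k < b) f ^+ k.+1 + f ^+ b.+1 / (1 - f).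
  apply: (mulIr uf); rewrite mulrDl !divrK //.
  under eq_bigr do rewrite exprS.
  rewrite -mulr_sumr -mulrA [_ * (1 - f)]mulrC -opprB mulNr -subrX1 opprB.
  by rewrite mulrBr mulr1 -exprS subrK.
move=> m mb; rewrite fcoefD -[RHS]addr0; congr (_ + _).
have z : eq_upto 0 (1 - f)^-1 0 by [].
by rewrite (order_mul (@order_exp b.+1 f f0) z) ?addn0 ?fcoef0.
Qed.

End TruncatedSeries.

Section StanleyReisnerRank.
Variables (V : finType) (D : scomplex V).
Local Notation mon := 'X_{1..#|V|}.
Local Notation I := (@SR_ideal int V D).

Definition msupport (a : mon) : {set V} := [set v | a (enum_rank v) != 0%N].

(** A monomial whose support is a face is divisible by no generator of the ideal. *)
Lemma SR_ideal_coef (f : {mpoly int[#|V|]}) (a : mon) :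
  f \in I -> msupport a \in faces D -> f@_a = 0.
Proof.
move=> /asboolP[g ->] aD; rewrite raddf_sum /= big1 // => s sD.
have /subsetPn[v vs va] : ~~ (s \subset msupport a).
  by apply: contra sD => sa; apply: facesS sa aD.
rewrite (bigD1 v) //= mulrCA mcoeff_varM.
by move: va; rewrite inE negbK => /eqP ->.
Qed.

Lemma monomial_SR_ideal (c : int) (a : mon) : msupport a \notin faces D -> c *: 'X_[a] \in I.
Proof.
move=> aD; apply/asboolP; pose m := (\sum_(v in msupport a) U_(enum_rank v))%MM.
have mE j : m (enum_rank j) = (j \in msupport a).
  rewrite mnm_sumE (eq_bigr (fun v => (v == j) : nat)) => [|v _]; last first.
    by rewrite mnm1E (inj_eq enum_rank_inj).
  have [ja|ja] := boolP (j \in msupport a).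
    by rewrite (bigD1 j) //= eqxx big1 // => v /andP[_ /negPf->].
  by rewrite big1 // => v va; case: eqP => // vj; rewrite -vj va in ja.
exists (fun s => if s == msupport a then c *: 'X_[(a - m)%MM] else 0).
rewrite (bigD1 (msupport a)) //= eqxx [X in _ + X]big1; last first.
  by move=> s /andP[_ /negPf->]; rewrite mul0r.
rewrite addr0.
have -> : \prod_(v in msupport a) 'X_(enum_rank v) = 'X_[m] :> {mpoly int[#|V|]}.
  by rewrite /m (big_morph (fun m : mon => 'X_[m]) (@mpolyXD _ _) (mpolyX0 _ _)).
rewrite -scalerAl -mpolyXD submK //; apply/mnm_lepP => i.
by rewrite -(enum_valK i) mE inE enum_valK; case: (a i).
Qed.

Local Notation pi := (\pi_(@SR_ring int V D))%qT.

Lemma SR_pi_eq0 (f : {mpoly int[#|V|]}) : (pi f == 0) = (f \in I).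
Proof.
rewrite -(rmorph0 pi) -[f in RHS]subr0.
by rewrite (Quotient.idealrBE (I : idealr _)).
Qed.

Lemma SR_graded_comb k (c : 'I_k -> int) (b : 'I_k -> int) a :
  \sum_i pi (b i *: 'X_[a]) *~ c i = pi ((\sum_i b i * c i) *: 'X_[a]).
Proof.
rewrite scaler_suml raddf_sum; apply: eq_bigr => i _.
by rewrite -raddfMz -scaler_int scalerA mulrC intz.
Qed.

(** A graded piece is generated by the class of a monomial, which generates a
    free group if the support of the monomial is a face and vanishes otherwise. *)
Lemma Zrank_SR_graded a : Zrank (@SR_graded int V D a) = (msupport a \in faces D).
Proof.
have coefs k (v : 'I_k -> SR_ring int D) : (forall i, SR_graded a (v i)) ->
    exists b : 'I_k -> int, v = fun i => pi (b i *: 'X_[a]).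
  move=> va; have /choice[b bP] : forall i, exists c : int, pi (c *: 'X_[a]) = v i.
    by move=> i; have [c _ <-] := va i; exists c.
  by exists b; apply/funext => i; rewrite bP.
have free_le k : Zfree (@SR_graded int V D a) k -> (k <= (msupport a \in faces D))%N.
  case=> v /coefs[b ->]; case: k v b => // k _ b free.
  have relP (c : 'I_k.+1 -> int) : (\sum_i b i * c i) *: 'X_[a] \in I -> forall i, c i = 0.
    by rewrite -SR_pi_eq0 => /eqP cI; apply: free; rewrite SR_graded_comb.
  have [aD|aD] := boolP (msupport a \in faces D); last first.
    by have := relP (fun=> 1) (monomial_SR_ideal _ aD) ord0.
  rewrite ltnS leqn0; apply/negPn/negP; rewrite -lt0n => k0.
  (* Two multiples [b 0], [b j] of the monomial satisfy [b j * b 0 - b 0 * b j = 0]. *)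
  pose j : 'I_k.+1 := lift ord0 (Ordinal k0).
  have j0 : (j == ord0) = false by [].
  have c0 := relP (fun i => if i == ord0 then b j else if i == j then - b ord0 else 0).
  have bj : b j = 0.
    apply: (c0 _ ord0); rewrite (bigD1 ord0) //= (bigD1 j) //= ?eqxx big1 => [|i].
      by rewrite addr0 mulrN mulrC subrr scale0r rpred0.
    by case/andP=> /negPf-> /negPf->; rewrite mulr0.
  have := relP (fun i => (i == j)%:R) _ j; rewrite eqxx => H.
  have /eqP : (1%:R : int) = 0.
    apply: H; rewrite (bigD1 j) //= bj mul0r add0r big1 ?scale0r ?rpred0 // => i /negPf->.
    by rewrite mulr0.
  by rewrite oner_eq0.
have free_face : Zfree (@SR_graded int V D a) (msupport a \in faces D).
  have [aD|aD] := boolP (msupport a \in faces D); last first.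
    by exists (fun=> 0) => [[]//|c _ []].
  exists (fun=> pi ((1 : int) *: 'X_[a])) => [i|c]; first by exists 1.
  rewrite (SR_graded_comb c (fun=> 1)) => /eqP; rewrite SR_pi_eq0 => /SR_ideal_coef/(_ aD).
  rewrite mcoeffZ mcoeffX eqxx mulr1 big_ord1 mul1r => c0 i; by rewrite ord1.
rewrite /Zrank; case: xgetP => [k _ /= [fk maxk]|]; last first.
  by move/(_ (msupport a \in faces D : nat)) => [].
by apply/eqP; rewrite eqn_leq free_le // maxk.
Qed.

End StanleyReisnerRank.

Section SubstitutedHilbertSeries.
Variables (V : finType) (D : scomplex V) (n : nat) (g : V -> fps int n).
Hypothesis g_order : forall v, eq_upto 1 (g v) 0.

(** Up to a given degree, both sides are the sum of the monomials in the [g v]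
    with bounded exponents whose support is a face. *)
Lemma subst_SR_hilb : fps_subst (fun j => g (enum_val j)) (SR_hilb D)
  = \sum_(s in D) \prod_(v in s) (g v / (1 - g v)).
Proof.
apply: fps_ext => m; pose B := mdeg m.
pose supp (f : {ffun V -> 'I_B.+1}) := [set v | f v != ord0].
transitivity (fcoef (\sum_(f : {ffun V -> 'I_B.+1} | supp f \in faces D) \prod_v g v ^+ f v) m);
    last first.
  have -> : fcoef (\sum_(s in D) \prod_(v in s) (g v / (1 - g v))) m
      = fcoef (\sum_(s in D) \prod_(v in s) \sum_(k < B) g v ^+ k.+1) m.
    apply: (@eq_upto_sum int n B.+1) => // s _; apply: eq_upto_prod => v _.
    exact: geometric_upto.
  congr fcoef; rewrite (partition_big supp (mem (faces D))) //=; apply: eq_bigr => s sD.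
  rewrite [RHS]big_mkcond /=.
  transitivity (\prod_v \sum_(k < B.+1 | (k != ord0) == (v \in s)) g v ^+ k).
    rewrite bigA_distr_big_dep; apply: eq_bigl => f; apply/andP/familyP => [[_ /eqP fs] v|fP].
      by rewrite -[_ \in _]/((f v != ord0) == (v \in s)) -fs inE eqxx.
    have -> : supp f = s.
      apply/setP => v; rewrite inE; have := fP v.
      by rewrite -[_ \in _]/((f v != ord0) == (v \in s)) => /eqP.
    by rewrite eqxx.
  apply: eq_bigr => v _; case: (v \in s).
    rewrite big_mkcond big_ord_recl /= add0r; apply: eq_bigr => k _.
    by rewrite /bump add1n.
  by rewrite (big_pred1 ord0) ?expr0 // => k; rewrite /= eqbF_neg negbK.
rewrite /fps_subst /= fcoef_sum.
pose mn (f : {ffun V -> 'I_B.+1}) : 'X_{1..#|V|} := [multinom (f (enum_val j) : nat) | j < #|V|].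
have mn_inj : injective mn.
  move=> f f' /mnmP E; apply/ffunP => v; apply: val_inj.
  by have := E (enum_rank v); rewrite !mnmE enum_rankK.
rewrite (fsbigE [seq mn f | f <- enum {: {ffun V -> 'I_B.+1}}]); first last.
- move=> a _ ar; have [j Bj] : exists j, (B < a j)%N.
    apply/existsP; rewrite -[X in is_true X]negbK negb_exists; apply: contra ar => /forallP aB.
    apply/mapP; exists [ffun v => inord (a (enum_rank v))]; first by rewrite mem_enum.
    apply/mnmP => j; rewrite mnmE ffunE enum_valK inordK // ltnS leqNgt.
    exact: aB.
  rewrite (bigD1 j) //; set rest := \prod_(i < _ | _) _.
  have z : eq_upto 0 rest 0 by [].
  by rewrite (order_mul (@order_exp _ _ (a j) _ (g_order _)) z) ?addn0 // fcoef0 mulr0.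
- by move=> a.
- by rewrite map_inj_uniq // enum_uniq.
rewrite (eq_bigl xpredT) => [|a]; last by rewrite mem_setT.
rewrite big_map big_enum /= [RHS]big_mkcond; apply: eq_bigr => f _.
rewrite Zrank_SR_graded.
have -> : msupport (mn f) = supp f by apply/setP => v; rewrite !inE mnmE enum_rankK.
have -> : \prod_(i < #|V|) g (enum_val i) ^+ mn f i = \prod_v g v ^+ f v.
  rewrite [RHS](reindex (fun k : 'I_#|V| => enum_val k)) /=;
    last by apply: onW_bij; apply: enum_val_bij.
  by apply: eq_bigr => j _; rewrite mnmE.
by case: (_ \in _); rewrite ?mul1r ?mul0r.
Qed.

End SubstitutedHilbertSeries.

(** * The value at one *)

Section AtOne.
Variable n : nat.

Lemma flag_var_order (K : comNzRingType) (J : {set 'I_n}) : eq_upto 1 (flag_var K J) 0.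
Proof.
move=> m m1; rewrite /flag_var -mulrA fcoef_varM fcoef0 ifF //; move: m1.
by rewrite ltnS leqn0 mdeg_eq0 => /eqP->; rewrite mnmE.
Qed.

Lemma fps_map_flag_var (K L : comNzRingType) (u : {rmorphism K -> L}) (J : {set 'I_n}) :
  fps_map u (flag_var K J) = flag_var L J.
Proof.
rewrite /flag_var !rmorphM rmorph_prod /=; congr (_ * _ * _); try exact: fps_map_var.
by apply: eq_bigr => j _; apply: fps_map_var.
Qed.

Lemma phi_SR_hilb : phi (SR_hilb (sd (bd_simplex n))) =
  \sum_(s in sd (bd_simplex n)) \prod_(J in s) (phi (yvar J) / (1 - phi (yvar J))).
Proof.
under eq_bigr do under eq_bigr do rewrite phi_yvar.
apply: (@subst_SR_hilb _ _ _ (fun J : yvertex n => flag_var int (val J))) => J.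
exact: flag_var_order.
Qed.

Lemma transfer_coef1 (C : fieldType) (I J : {set 'I_n}) :
  transfer_coef (1 : C) I J = (J \subset I)%:R.
Proof.
rewrite /transfer_coef expr1n mul1r [X in _ * X]big1 => [|j _]; last by rewrite expr1n invr1.
rewrite mulr1; have [/fintype.subsetP JI|/subsetPn[j jJ jI]] := boolP (J \subset I).
  by rewrite big1 // => j /JI jI; rewrite !expr1n jI mul0r subr0.
by rewrite (bigD1 j) //= !expr1n jI mul1r subrr mul0r.
Qed.

Definition flag_sum (I : {set 'I_n}) : fps int n.+2 :=
  chain_sum (fun J : yvertex n => flag_var int (val J)) (fun J => val J \subset I).

(** At [t = 1] only the inclusions survive, and the solution of the system is
    given by the sums over the chains of subsets of a given set. *)
Lemma flag_sum_transfer_system (C : fieldType) :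
  transfer_system (transfer_coef (1 : C)) (fun I => fps_map intr (flag_sum I)).
Proof.
move=> I; rewrite {1}/flag_sum chain_sumE; first last.
- by move=> J K JK; apply: fintype.subset_trans.
- by move=> J; apply/unit_1sub/flag_var_order.
rewrite rmorphD rmorph1 rmorph_sum; congr (_ + _).
transitivity (\sum_(J : {set 'I_n} | proper_flag J && (J \subset I))
    flag_var C J * fps_map intr (flag_sum J)); last first.
  rewrite big_mkcondr; apply: eq_bigr => J _; rewrite transfer_coef1.
  by case: (J \subset I); rewrite ?rmorph1 ?mul1r // rmorph0 mul0r.
rewrite [RHS](reindex_omap (val : yvertex n -> {set 'I_n}) insub)
  => [|J /andP[/andP[J0 JT] _]]; last first.
  by rewrite insubT //= inE JT.
apply: eq_big => [J | J _].
  have := valP J; rewrite inE /proper_flag valK eqxx andbT => /andP[-> ->].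
  by [].
by rewrite rmorphM; congr (_ * _); apply: fps_map_flag_var.
Qed.

Lemma flag_sumT : flag_sum [set: 'I_n] = phi (SR_hilb (sd (bd_simplex n))).
Proof.
rewrite phi_SR_hilb /flag_sum /chain_sum; apply: eq_big => [s | s _].
  rewrite [X in _ && X](_ : _ = true) ?andbT //.
  by apply/forall_inP => J _; apply: finset.subsetT.
by apply: eq_bigr => J _; rewrite phi_yvar.
Qed.

End AtOne.

Theorem theorem6 (R : realType) (n : nat) (n_gt0 : (0 < n)%N) :
  [/\ exists! W : ratfun R[i] n, represents_Rpr W,
      forall W : ratfun R[i] n, represents_Rpr W ->
        specializes_to W 1
          (fps_map intr (phi (SR_hilb (sd (bd_simplex n))))) &
      phi (SR_hilb (sd (bd_simplex n)))
      = \sum_(s in sd (bd_simplex n))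
          \prod_(J in s) (phi (yvar J) / (1 - phi (yvar J)))].
Proof.
have repW : represents_Rpr (transfer_fun R[i] n).
  move=> p p_pr; have [F [sysF <-]] := Rpr_transfer_system p_pr R[i] n_gt0.
  by apply: transfer_fun_specializes sysF; rewrite pnatr_eq0 -lt0n prime_gt0.
split; last exact: phi_SR_hilb.
  by exists (transfer_fun R[i] n); split=> // W; apply: represents_Rpr_uniq repW.
move=> W /(represents_Rpr_uniq repW) <-; rewrite -flag_sumT.
apply: (transfer_fun_specializes (F := fun I => fps_map intr (flag_sum I))).
  exact: oner_neq0.
exact: flag_sum_transfer_system.
Qed.
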